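(* Consider the multirate Lagrangian $L(q^s,q^f,\dot q^s,\dot q^f)=\tfrac12(\dot q^s)^TM^s\dot q^s+\tfrac12(\dot q^f)^TM^f\dot q^f-V(q^s,q^f)-W(q^f)$ and the multirate discrete Lagrangian $L_d$ obtained with piecewise linear trajectories, where the pair (rule for the fast potential $W$, rule for the slow potential $V$) is one of (midpoint, midpoint), (midpoint, trapezoidal with parameter $\alpha_V\in[0,1]$), (trapezoidal with parameter $\alpha_W\in[0,1]$, trapezoidal with parameter $\alpha_V\in[0,1]$). Assume that all discrete and continuous critical curves minimise their respective actions and that these minimisers are unique. Then the maximal local error of $L_d$, and therefore of the discrete evolution map $(q_k,p_k)\mapsto(q_{k+1},p_{k+1})$ of the corresponding scheme, is $$\|L_d^E(q_0,q_1,\Delta T)-L_d(q_0,q_1,\Delta T)\|=\begin{cases}\mathcal O(\Delta T^3)+p\,\mathcal O(\Delta t^3)&\text{if each of the two potentials is approximated by the midpoint rule or by the}\\&\text{trapezoidal rule with parameter }\tfrac12,\\[1ex]\frac1p\,\mathcal O(\Delta T^2)&\text{for all the other combinations.}\end{cases}$$ This leads to a second order integrator in the first case and to a first order integrator otherwise.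
   Context: $Q=Q^s\times Q^f\subset\mathbb{R}^{n^s}\times\mathbb{R}^{n^f}$ is open (slow and fast variables), $L$ is smooth and regular, $\Delta T=p\,\Delta t$ with $p\in\mathbb{N}$ the constant number of micro steps per macro step, and asymptotics are for $\Delta T\to0$. On a macro interval, $q_k^s,q_{k+1}^s$ are the slow end values and $q_k^{f,0},\dots,q_k^{f,p}$ the fast values on the micro nodes. The slow values at micro nodes are $q_k^{s,m}=q_k^s+\frac mp(q_{k+1}^s-q_k^s)$. The multirate discrete Lagrangian is $L_d(q_k^s,q_{k+1}^s,q_k^{f})=T_d-V_d-W_d$ with $$T_d=\frac{1}{2\Delta T}(q_{k+1}^s-q_k^s)^TM^s(q_{k+1}^s-q_k^s)+\sum_{m=0}^{p-1}\frac{1}{2\Delta t}(q_k^{f,m+1}-q_k^{f,m})^TM^f(q_k^{f,m+1}-q_k^{f,m}).$$ With $Z=V$ and node values $z^m=(q_k^{s,m},q_k^{f,m})$, respectively $Z=W$ and node values $z^m=q_k^{f,m}$, the approximation $Z_d$ is - midpoint rule: $Z_d=\Delta t\sum_{m=0}^{p-1}Z\big(\tfrac{z^m+z^{m+1}}2\big)$; - trapezoidal rule with parameter $\alpha_Z\in[0,1]$: $Z_d=\Delta t\sum_{m=0}^{p-1}\big(\alpha_ZZ(z^m)+(1-\alpha_Z)Z(z^{m+1})\big)$ ($\alpha_Z=\tfrac12$: Lobatto quadrature; $\alpha_Z=1$: left rectangle rule; $\alpha_Z=0$: right rectangle rule). The two-point discrete Lagrangian $L_d(q_0,q_1,\Delta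 T)$, with $q_0=(q_0^s,q_0^{f,0})$ and $q_1=(q_1^s,q_0^{f,p})$, is obtained by extremising $L_d(q_0^s,q_1^s,q_0^f)$ over the inner values $q_0^{f,1},\dots,q_0^{f,p-1}$. The exact discrete Lagrangian is $L_d^E(q_0,q_1,\Delta T)=\int_0^{\Delta T}L(q,\dot q)\,dt$, for sufficiently small $\Delta T$ and close $q_0,q_1$, with $q$ the unique solution of the Euler-Lagrange equations with $q(0)=q_0$, $q(\Delta T)=q_1$. The scheme is the map $(q_k,p_k)\mapsto(q_{k+1},p_{k+1})$ determined by $p_k=-D_1L_d(q_k,q_{k+1})$, $p_{k+1}=D_2L_d(q_k,q_{k+1})$; it is of order $\rho$ if its local error with respect to the exact Hamiltonian flow over time $\Delta T$ is $\mathcal O(\Delta T^{\rho+1})$. The continuous action of a curve with given end points is $\int_0^{\Delta T}L\,dt$; the discrete action is $L_d(q_0^s,q_1^s,q_0^f)$ as a function of the inner values. *)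

(* Defs.v *)
From HB Require Import structures.
From mathcomp Require Import all_boot all_order all_algebra.
From mathcomp Require Import all_classical all_reals all_analysis.
Set Implicit Arguments.
Unset Strict Implicit.
Unset Printing Implicit Defensive.
Import Order.TTheory GRing.Theory Num.Theory.
Import numFieldNormedType.Exports.
Local Open Scope classical_set_scope.
Local Open Scope ring_scope.

Section Calculus.
Context {R : realType}.

Definition qform n (M : 'M[R]_n) (x : 'cV[R]_n) : R := (x^T *m M *m x) 0 0.

Definition iter_derive (U : normedModType R) (vs : seq U) (f : U -> R) : U -> R :=
  foldr (fun v g => 'D_v g) f vs.

(* C^oo on a set (used for open sets): all iterated directional derivatives
   exist and are continuous at every point of the set. *)
Definition smooth_on (U : normedModType R) (A : set U) (f : U -> R) : Prop :=
  forall (vs : seq U) (x : U), A x ->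
    {for x, continuous (iter_derive vs f)} /\
    forall v, derivable (iter_derive vs f) x v.

Context {ns nf : nat}.
Notation E := ('cV[R]_ns * 'cV[R]_nf)%type.

Definition grad (f : E -> R) (x : E) : E :=
  (\col_i 'D_((delta_mx i 0, 0) : E) f x, \col_i 'D_((0, delta_mx i 0) : E) f x).

Definition dotE (x y : E) : R := (x.1^T *m y.1) 0 0 + (x.2^T *m y.2) 0 0.

End Calculus.

Notation config R ns nf := ('cV[R]_ns * 'cV[R]_nf)%type.

Section Lagrangian.
Context {R : realType} {ns nf : nat}.
Notation E := (config R ns nf).
Variables (Q : set E) (L : E -> E -> R).

Definition regular : Prop := forall q v, Q q ->
  forall w, (forall w', 'D_w ('D_w' (L q)) v = 0) -> w = 0.

(* A C^1 curve in A over [0, h] is a pair (q, v): v is the velocity of q inside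
   the interval and, by continuity, the one-sided velocity at the end points.
   Values of q and v outside [0, h] are irrelevant. *)
Definition C1_curve (A : set E) (h : R) (q v : R -> E) : Prop :=
  [/\ {within `[0, h], continuous q},
      {within `[0, h], continuous v},
      forall t, 0 < t < h -> is_derive t 1 q (v t) &
      forall t, 0 <= t <= h -> A (q t)].

Definition joins (h : R) (q : R -> E) (q0 q1 : E) : Prop := q 0 = q0 /\ q h = q1.

Definition action (h : R) (q v : R -> E) : R :=
  \int[lebesgue_measure]_(t in `[0, h]) L (q t) (v t).

Definition EL_solution (h : R) (q v : R -> E) : Prop :=
  C1_curve Q h q v /\
  forall t, 0 < t < h ->
    is_derive t 1 (fun s => grad (L (q s)) (v s)) (grad (fun a => L a (v t)) (q t)).

Definition critical_curve (h : R) (q v : R -> E) : Prop :=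
  C1_curve Q h q v /\
  forall d d', C1_curve setT h d d' -> joins h d 0 0 ->
    is_derive (0 : R) 1
      (fun e : R => action h (fun t => q t + e *: d t) (fun t => v t + e *: d' t)) 0.

Definition unique_minimiser (h : R) (q v : R -> E) : Prop :=
  forall q' v', C1_curve Q h q' v' -> joins h q' (q 0) (q h) ->
    action h q v <= action h q' v' /\
    (action h q' v' = action h q v -> forall t, 0 <= t <= h -> q' t = q t).

(* The action of the Euler-Lagrange solution joining q0 and q1 in time h;
   meaningful when that solution is unique (0 if there is none). *)
Definition Ld_exact (h : R) (q0 q1 : E) : R :=
  xget 0 [set a | exists q v,
    [/\ EL_solution h q v, joins h q q0 q1 & a = action h q v]].

Definition legendre_inv (q pi : E) : E := xget 0 [set v | grad (L q) v = pi].

Definition hamiltonian (q pi : E) : R :=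
  let v := legendre_inv q pi in dotE pi v - L q v.

Definition hamilton_solution (h : R) (q pi : R -> E) : Prop :=
  [/\ {within `[0, h], continuous q},
      {within `[0, h], continuous pi},
      forall t, 0 <= t <= h -> Q (q t) &
      forall t, 0 < t < h ->
        is_derive t 1 q (grad (hamiltonian (q t)) (pi t)) /\
        is_derive t 1 pi (- grad (fun a => hamiltonian a (pi t)) (q t))].

End Lagrangian.

Section Scheme.
Context {R : realType} {ns nf : nat}.
Notation E := (config R ns nf).
Variables (Q : set E) (L : E -> E -> R).

(* Ld h is a two-point discrete Lagrangian for the (macro) step size h. *)
Variable Ld : R -> E -> E -> R.

Definition scheme_step (h : R) (z0 z1 : E * E) : Prop :=
  [/\ differentiable (Ld h ^~ z1.1) z0.1,
      differentiable (Ld h z0.1) z1.1,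
      z0.2 = - grad (Ld h ^~ z1.1) z0.1 &
      z1.2 = grad (Ld h z0.1) z1.1].

(* For all small h and all z0 = (q0, p0) in K, the equations of the scheme have
   exactly one solution z1 = (q1, p1) with q1 near q0, and it is e h-close to
   the exact Hamiltonian flow over time h. *)
Definition local_error_le (K : set (E * E)) (e : R -> R) : Prop :=
  exists delta h0 : R, [/\ 0 < delta, 0 < h0 &
    forall h, 0 < h < h0 -> forall z0, K z0 ->
    exists z1, [/\ `|z1.1 - z0.1| < delta,
      scheme_step h z0 z1,
      forall z, `|z.1 - z0.1| < delta -> scheme_step h z0 z -> z = z1 &
      forall q pi, hamilton_solution Q L h q pi -> (q 0, pi 0) = z0 ->
        `|z1 - (q h, pi h)| <= e h]].

Definition scheme_of_order (rho : nat) : Prop :=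
  forall K : set (E * E), compact K -> K `<=` Q `*` setT ->
    exists C : R, local_error_le K (fun h => C * h ^+ rho.+1).

End Scheme.

Inductive quad_rule (R : realType) : Type :=
| Midpoint
| Trapezoidal of R.
Arguments Midpoint {R}.

Section Quadrature.
Context {R : realType}.

Definition rule_param_ok (r : quad_rule R) : Prop :=
  match r with Midpoint => True | Trapezoidal a => 0 <= a <= 1 end.

Definition rule_symmetric (r : quad_rule R) : bool :=
  match r with Midpoint => true | Trapezoidal a => a == 2^-1 end.

Definition rules_allowed (rW rV : quad_rule R) : Prop :=
  match rW, rV with Trapezoidal _, Midpoint => False | _, _ => True end.

Definition quad (r : quad_rule R) (U : lmodType R) (p : nat) (dt : R)
    (Z : U -> R) (z : nat -> U) : R :=
  match r with
  | Midpoint => dt * \sum_(0 <= m < p) Z (2^-1 *: (z m + z m.+1))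
  | Trapezoidal a => dt * \sum_(0 <= m < p) (a * Z (z m) + (1 - a) * Z (z m.+1))
  end.

End Quadrature.

Section Multirate.
Context {R : realType} {ns nf : nat}.
Notation E := (config R ns nf).
Variables (Qs : set 'cV[R]_ns) (Qf : set 'cV[R]_nf).
Variables (Ms : 'M[R]_ns) (Mf : 'M[R]_nf) (V : E -> R) (W : 'cV[R]_nf -> R).
Variables (rW rV : quad_rule R).

Definition Q_multi : set E := Qs `*` Qf.

Definition L_multi (q v : E) : R :=
  2^-1 * qform Ms v.1 + 2^-1 * qform Mf v.2 - V q - W q.2.

Section MacroInterval.
Variables (p : nat) (h : R).

Definition slow_micro (qs0 qs1 : 'cV[R]_ns) (m : nat) : 'cV[R]_ns :=
  qs0 + (m%:R / p%:R) *: (qs1 - qs0).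

(* The fast micro values are y 0, ..., y p; later terms of y are never used. *)
Definition Ld_micro (qs0 qs1 : 'cV[R]_ns) (y : nat -> 'cV[R]_nf) : R :=
  let dt := h / p%:R in
  (2 * h)^-1 * qform Ms (qs1 - qs0)
  + \sum_(0 <= m < p) (2 * dt)^-1 * qform Mf (y m.+1 - y m)
  - quad rV p dt V (fun m => (slow_micro qs0 qs1 m, y m))
  - quad rW p dt W y.

(* The piecewise linear trajectory with the given nodes joins q0 and q1 in Q. *)
Definition discrete_curve (q0 q1 : E) (y : nat -> 'cV[R]_nf) : Prop :=
  [/\ y 0%N = q0.2, y p = q1.2,
      forall s : R, 0 <= s <= 1 -> Qs (q0.1 + s *: (q1.1 - q0.1)) &
      forall (m : nat) (s : R), (m < p)%N -> 0 <= s <= 1 ->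
        Qf (y m + s *: (y m.+1 - y m))].

Definition discrete_critical (q0 q1 : E) (y : nat -> 'cV[R]_nf) : Prop :=
  discrete_curve q0 q1 y /\
  forall d : nat -> 'cV[R]_nf, d 0%N = 0 -> d p = 0 ->
    is_derive (0 : R) 1
      (fun e : R => Ld_micro q0.1 q1.1 (fun m => y m + e *: d m)) 0.

Definition discrete_unique_minimiser (q0 q1 : E) (y : nat -> 'cV[R]_nf) : Prop :=
  forall y', discrete_curve q0 q1 y' ->
    Ld_micro q0.1 q1.1 y <= Ld_micro q0.1 q1.1 y' /\
    (Ld_micro q0.1 q1.1 y' = Ld_micro q0.1 q1.1 y ->
     forall m, (m <= p)%N -> y' m = y m).

(* The critical value of Ld_micro; meaningful when the critical point is unique
   (0 if there is none). *)
Definition Ld_multi (q0 q1 : E) : R :=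
  xget 0 [set a | exists2 y, discrete_critical q0 q1 y & a = Ld_micro q0.1 q1.1 y].

Definition critical_minimise_at (q0 q1 : E) : Prop :=
  (forall q v, critical_curve Q_multi L_multi h q v -> joins h q q0 q1 ->
     unique_minimiser Q_multi L_multi h q v) /\
  (forall y, discrete_critical q0 q1 y -> discrete_unique_minimiser q0 q1 y).

End MacroInterval.

(* For all small macro steps and close end points (locally uniformly in Q),
   every continuous or discrete critical curve is the unique minimiser. *)
Definition critical_curves_minimise (p : nat) : Prop :=
  forall K : set E, compact K -> K `<=` Q_multi ->
  exists delta h0 : R, [/\ 0 < delta, 0 < h0 &
    forall h, 0 < h < h0 -> forall q0 q1, K q0 -> `|q1 - q0| < delta ->
      critical_minimise_at p h q0 q1].

(* The right-hand side of the estimate, with implied constant C. *)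
Definition error_bound (C : R) (p : nat) (h : R) : R :=
  if rule_symmetric rV && rule_symmetric rW
  then C * h ^+ 3 + p%:R * (C * (h / p%:R) ^+ 3)
  else p%:R^-1 * (C * h ^+ 2).

End Multirate.

(* Main.v *)
Require Import Defs.
From HB Require Import structures.
From mathcomp Require Import all_boot all_order all_algebra.
From mathcomp Require Import all_classical all_reals all_analysis.
From mathcomp Require Import ring lra.
Set Implicit Arguments.
Unset Strict Implicit.
Unset Printing Implicit Defensive.
Import Order.TTheory GRing.Theory Num.Theory.
Import numFieldNormedType.Exports.
Local Open Scope classical_set_scope.
Local Open Scope ring_scope.

(* Write the nodes of a discrete path from [q0] to [q1] as those of the straight line
   plus a correction [e] of the fast variables. The discrete Euler-Lagrange equations
   say that [e] is a fixed point of the discrete Green operator applied to the forces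
   at the quadrature nodes; this map is a contraction with constant O(h^2) uniformly
   in p, so [e] exists, has size O(h^2) and is Lipschitz in the end points. The
   minimality hypothesis makes the critical value unique, hence L_d is the action of
   the corrected path. Its quadratic remainder yields differentiability and, as the
   inner variations cancel,
     p0 = M (q1 - q0) / h + h <(1 - sigma) grad>,
     p1 = M (q1 - q0) / h - h <sigma grad>,
   where <.> averages over the quadrature nodes and sigma in [0, 1] is their relative
   time. The first equation is solved for q1 by a second contraction. Up to O(h^3) the
   expansions at (q0, p0) of the discrete map and of the discrete action depend on the
   rules only through <sigma> = 1/2 + (s - 1/2) / p, with s = 1/2 for the symmetric
   rules; the exact flow and action have the same expansions with 1/2 in its place.
   For h <= 1/p the terms O(h^3) are absorbed by h^2 / p in the nonsymmetric case. *)

(** * Compactness and contractions *)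

(** A bound on the error of [L_d] gives no bound on the error of its derivatives, so the estimate
    for the discrete map is not deduced from it: the action and the momenta are expanded separately,
    each with an explicit remainder. Minimality enters through the values selected by [xget]: any
    two critical curves with the same end points have the same action, so the selected value is that
    of the curve at hand, on the discrete and on the continuous side. As [smooth_on] speaks of
    directional derivatives, linearity in the direction and uniform Taylor bounds must first be
    recovered on compact sets; [tame] collects them. The constants have to be chosen before [p].
    This works because in the relevant bounds the number of micro steps appears only in the product
    of [p] with the micro step, which is [h]; only the admissible range of [h] depends on [p]. The
    two potentials may follow different rules, but both rules evaluate at affine interpolations of
    neighbouring nodes, which lets one notion of average serve both. *)

Section NormedSpaces.
Context {R : realType}.

Lemma mx_norm_le m n (x : 'M[R]_(m, n)) (c : R) : 0 <= c ->
  (`|x| <= c) <-> (forall i j, `|x i j| <= c).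
Proof.
move=> c0; split=> [xc i j|xc].
  apply: le_trans xc; rewrite [leRHS]/Num.norm /= mx_normrE.
  by apply/bigmax_geP; right => /=; exists (i, j).
rewrite [leLHS]/Num.norm /= mx_normrE; apply/bigmax_leP; split => // i _.
Qed.

Lemma mx_entry_le m n (x : 'M[R]_(m, n)) i j : `|x i j| <= `|x|.
Proof. by have /mx_norm_le := lexx `|x|; apply. Qed.

(** The norm is the largest modulus of an entry, and an entry of the product is a sum of [n]
    terms. *)
Lemma mulmx_norm_le m n k (A : 'M[R]_(m, n)) (B : 'M[R]_(n, k)) :
  `|A *m B| <= n%:R * `|A| * `|B|.
Proof.
apply/mx_norm_le => [|i j]; first by rewrite !mulr_ge0.
rewrite mxE; apply: le_trans (ler_norm_sum _ _ _) _.
rewrite -mulrA mulr_natl -[X in _ *+ X]card_ord -sumr_const.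
by apply: ler_sum => l _; rewrite normrM ler_pM// mx_entry_le.
Qed.

Lemma within_continuous_epsP (U V : normedModType R) (A : set U) (f : U -> V) :
  {within A, continuous f} <->
  (forall x, A x -> forall e : R, 0 < e -> exists2 d : R, 0 < d &
    forall y, A y -> `|y - x| < d -> `|f y - f x| < e).
Proof.
rewrite subspace_continuousP; split=> [cf x Ax e e0|cf x Ax].
  have /cvgrPdist_lt/(_ e e0) := cf x Ax.
  rewrite near_withinE => /nbhs_normP[d d0 fd]; exists d => // y Ay yx.
  by rewrite distrC; apply: fd => //=; rewrite /ball_/= distrC.
apply/cvgrPdist_lt => e e0; have [d d0 fd] := cf x Ax e e0.
rewrite near_withinE; apply/nbhs_normP; exists d => // y; rewrite /ball_/= => yx Ay.
by rewrite distrC; apply: fd => //; rewrite distrC.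
Qed.

Lemma lipschitz_within_continuous (U V : normedModType R) (A : set U) (f : U -> V) (k : R) :
  0 <= k -> (forall x y, A x -> A y -> `|f x - f y| <= k * `|x - y|) ->
  {within A, continuous f}.
Proof.
move=> k0 fk; apply/within_continuous_epsP => x Ax e e0.
have k1 : 0 < k + 1 by rewrite ltr_wpDl.
exists (e / (k + 1)); first by rewrite divr_gt0.
move=> y Ay yx; apply: le_lt_trans (fk _ _ Ay Ax) _.
have [->|k0'] := eqVneq k 0; first by rewrite mul0r.
apply: (@le_lt_trans _ _ (k * (e / (k + 1)))); first by rewrite ler_wpM2l// ltW.
by rewrite mulrCA gtr_pMr// ltr_pdivrMr// mul1r ltrDl.
Qed.

(** For the entrywise maximum norm the ball is a cube, that is, the image of a product of segments
    under the 1-Lipschitz map [vec_mx]. *)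
Lemma mx_closed_ball_compact m n (r : R) : compact [set x : 'M[R]_(m, n) | `|x| <= r].
Proof.
have [r0|r0] := ltP r 0.
  rewrite (_ : [set _ | _] = set0); first exact: compact0.
  by rewrite -subset0 => x /= /le_lt_trans/(_ r0); rewrite normr_lt0.
rewrite (_ : [set _ | _] = [set vec_mx v | v in
    [set v : 'rV[R]_(m * n) | forall i, v 0 i \in `[- r, r]]]); last first.
  apply/seteqP; split=> [x /= xr|_ [v /= vr <-]].
    exists (mxvec x); last exact: mxvecK.
    move=> k; case/mxvec_indexP: k => i j; rewrite mxvecE in_itv /= -ler_norml.
    exact: le_trans (mx_entry_le _ _ _) xr.
  apply/mx_norm_le => // i j; rewrite mxE.
  by have := vr (mxvec_index i j); rewrite in_itv /= -ler_norml.
apply: continuous_compact; first last.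
  by apply: (@rV_compact _ _ (fun=> `[- r, r]%classic)) => i; exact: segment_compact.
apply: (@lipschitz_within_continuous _ _ _ _ 1) => // x y _ _.
rewrite mul1r -linearB; apply/mx_norm_le => // i j.
by rewrite mxE; exact: mx_entry_le.
Qed.

Lemma prod_norm_le (U V : normedModType R) (x : U * V) (c : R) :
  (`|x| <= c) <-> (`|x.1| <= c /\ `|x.2| <= c).
Proof. by rewrite prod_normE ge_max; split=> /andP. Qed.

Lemma prod_closed_ball_compact (U V : normedModType R) (r : R) :
  compact [set x : U | `|x| <= r] -> compact [set x : V | `|x| <= r] ->
  compact [set x : U * V | `|x| <= r].
Proof.
move=> cU cV; rewrite (_ : [set _ | _] = [set x : U | `|x| <= r] `*` [set x : V | `|x| <= r]).
  exact: compact_setX.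
by apply/seteqP; split=> -[x y] /=; rewrite prod_norm_le.
Qed.

(* The minimum over the compact ball of the displacement [`|T x - x|] of a
   contraction must vanish. *)
Lemma ball_contraction_fixpoint (X : normedModType R) (T : X -> X) (r : R) :
  0 <= r -> compact [set x : X | `|x| <= r] ->
  (forall x, `|x| <= r -> `|T x| <= r) ->
  (forall x y, `|x| <= r -> `|y| <= r -> `|T x - T y| <= 2^-1 * `|x - y|) ->
  exists2 x, `|x| <= r & T x = x.
Proof.
move=> r0 cB TB Tc; set B := [set x : X | `|x| <= r].
have cT : {within B, continuous (fun x => `|T x - x| : R)}.
  apply: (@lipschitz_within_continuous _ _ _ _ 2) => // x y Bx By.
  apply: le_trans (ler_dist_dist _ _) _.
  rewrite (_ : T x - x - (T y - y) = (T x - T y) - (x - y)); last first.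
    by rewrite !opprB addrACA [RHS]addrACA [- x + _]addrC.
  apply: le_trans (ler_normB _ _) _; have := Tc x y Bx By.
  have := normr_ge0 (x - y); lra.
have B0 : B !=set0 by exists 0; rewrite /B /= normr0.
have [x /set_mem Bx xmin] := compact_EVT_min B0 cB cT.
exists x => //; apply/eqP; rewrite -subr_eq0 -normr_eq0.
have /mem_set/xmin := TB _ Bx; have := Tc _ _ (TB _ Bx) Bx.
by have := normr_ge0 (T x - x); lra.
Qed.

Lemma compact_thickening (X : normedModType R) (K : set X) (r : R) :
  compact [set x : X | `|x| <= r] -> compact K ->
  compact [set y | exists2 x, K x & `|y - x| <= r].
Proof.
move=> cB cK; rewrite (_ : [set _ | _] = (fun z : X * X => z.1 + z.2) @`
    (K `*` [set x : X | `|x| <= r])).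
  apply: continuous_compact; last exact: compact_setX.
  by apply: continuous_subspaceT => z; exact: add_continuous.
apply/seteqP; split=> [y [x Kx yx]|_ [[x d] [/= Kx dr] <-]].
  by exists (x, y - x) => //=; rewrite addrC subrK.
by exists x => //; rewrite addrC addKr.
Qed.

(** If the ball of radius [e] around [x] lies in [A], radius [e / 2] works at every point within
    [e / 2] of [x]; the near-covering form of compactness makes the radius uniform. *)
Lemma compact_uniform_ball (X : normedModType R) (A K : set X) :
  open A -> compact K -> K `<=` A ->
  \forall r \near 0^'+, forall x y, K x -> `|y - x| <= r -> A y.
Proof.
move=> oA /compact_near_coveringP cK KA.
suff : \forall r \near 0^'+, K `<=` (fun x => forall y, `|y - x| <= r -> A y).
  by apply: filterS => r Kr x y Kx; exact: Kr.
apply: cK => x /KA Ax.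
have /nbhs_normP[e /= e0 eA] : nbhs x A by exact: open_nbhs_nbhs.
near=> x' r => /=; have re : r <= e / 2.
  by near: r; apply: nbhs_right_le; exact: divr_gt0.
move=> y yx'; apply: eA; rewrite /ball_ /=.
rewrite (_ : x - y = (x - x') - (y - x')); last by rewrite opprB addrA subrK.
apply: le_lt_trans (ler_normB _ _) _.
rewrite [e]splitr; apply: ltr_leD; last exact: le_trans yx' re.
by near: x'; apply: cvgr_dist_lt => //; exact: divr_gt0.
Unshelve. all: by end_near. Qed.

(** The bound is stated for all large [M] so that finitely many such bounds can be intersected in
    the filter. *)
Lemma compact_bounded_above (T : topologicalType) (K : set T) (f : T -> R) :
  compact K -> (forall x, K x -> {for x, continuous f}) ->
  \forall M \near +oo, forall x, K x -> `|f x| <= M.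
Proof.
move=> cK fc.
have cf : {within K, continuous f} by apply/subspace_continuousP => x /fc; exact: cvg_within_filter.
have [M [Mr MK]] := compact_bounded (continuous_compact cf cK).
exists M; split => // M' MM' x Kx; apply: MK => //; by exists x.
Qed.
End NormedSpaces.

(** * Directional derivatives *)

Section Lines.
Context {R : realType} {U : normedModType R}.
Implicit Types (f : U -> R) (x d : U).

Lemma is_derive_line f x d (s : R) : derivable f (x + s *: d) d ->
  is_derive s 1 (fun t : R => f (x + t *: d)) ('D_d f (x + s *: d)).
Proof.
have E : (fun h : R => h^-1 *: (((fun t : R => f (x + t *: d)) \o shift s) (h *: 1)
      - f (x + s *: d))) =
    (fun h : R => h^-1 *: ((f \o shift (x + s *: d)) (h *: d) - f (x + s *: d))).
  apply/funext => h /=; congr (_ *: (f _ - _)).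
  by rewrite scalerDl [h *: 1]mulr1 addrCA.
move=> df; apply: DeriveDef; first by rewrite /derivable E.
by rewrite /derive E.
Qed.

Lemma line_MVT f x d :
  (forall s : R, 0 <= s <= 1 -> derivable f (x + s *: d) d) ->
  exists2 c : R, 0 <= c <= 1 & f (x + d) - f x = 'D_d f (x + c *: d).
Proof.
move=> df; pose g (t : R) := f (x + t *: d).
have dg (s : R) : 0 <= s <= 1 -> is_derive s 1 g ('D_d f (x + s *: d)).
  by move=> /df; exact: is_derive_line.
have [| |c c01 E] := @MVT_segment R g (fun s => 'D_d f (x + s *: d)) 0 1 ler01.
- by move=> s; rewrite in_itv /= => /andP[/ltW s0 /ltW s1]; apply: dg; rewrite s0.
- apply: derivable_within_continuous => s; rewrite in_itv /= => /dg s01.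
  exact: ex_derive.
exists c; first by move: c01; rewrite in_itv.
by move: E; rewrite /g scale1r scale0r addr0 subr0 mulr1.
Qed.

(** The directional form of C^1. Additivity in the direction is not part of it and is derived below
    from the continuity of the derivatives. *)
Definition C1_on (A : set U) f : Prop := forall x, A x -> forall v,
  derivable f x v /\ {for x, continuous ('D_v f)}.

Lemma smooth_on_C1 (A : set U) f : smooth_on A f -> C1_on A f.
Proof.
move=> sf x Ax v; have [_ df] := sf [::] x Ax.
by split; [exact: df|have [] := sf [:: v] x Ax].
Qed.

Lemma smooth_on_derive (A : set U) f v : smooth_on A f -> smooth_on A ('D_v f).
Proof.
move=> sf vs x Ax; have := sf (rcons vs v) x Ax.
by rewrite /iter_derive foldr_rcons.
Qed.

Lemma smooth_on_continuous (A : set U) f : smooth_on A f ->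
  forall x, A x -> {for x, continuous f}.
Proof. by move=> sf x Ax; have [] := sf [::] x Ax. Qed.

(** Chain rule for the reparametrisation of the line by the factor [a], which covers [a = 0] as
    well. *)
Lemma C1_on_derive_scale (A : set U) f x v (a : R) : C1_on A f -> A x ->
  'D_(a *: v) f x = a * 'D_v f x.
Proof.
move=> fA Ax; pose g (t : R) := f (x + t *: v).
have dg w : is_derive (0 : R) 1 (fun t : R => f (x + t *: w)) ('D_w f x).
  by rewrite -{2}[x]addr0 -(scale0r w); apply: is_derive_line;
     rewrite scale0r addr0; exact: (fA x Ax w).1.
have E : (fun t : R => f (x + t *: (a *: v))) = g \o ( *%R^~ a).
  by apply/funext => t /=; rewrite /g scalerA.
have := dg (a *: v); rewrite E => /@derive_val <-.
rewrite -derive1E derive1_comp.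
- rewrite mul0r derive1E (@derive_val _ _ _ _ _ _ _ (dg v)) mulrC; congr (_ * _).
  by rewrite (@derive1Mr _ id)// derive1_id mul1r.
- by apply: derivableM.
- by rewrite mul0r; exact: (@ex_derive _ _ _ _ _ _ _ (dg v)).
Qed.

(** The increment along [t (u + w)] is split into one along [t u] followed by one along [t w]. The
    mean value theorem on each piece and the continuity of the two directional derivatives at [x]
    give the sum. *)
Lemma C1_on_derive_add (A : set U) f x u w : open A -> C1_on A f -> A x ->
  'D_(u + w) f x = 'D_u f x + 'D_w f x.
Proof.
move=> oA fA Ax.
have dg v : is_derive (0 : R) 1 (fun t : R => f (x + t *: v)) ('D_v f x).
  by rewrite -{2}[x]addr0 -(scale0r v); apply: is_derive_line;
     rewrite scale0r addr0; exact: (fA x Ax v).1.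
have [/cvgrPdist_lt dlim dval] := dg (u + w).
apply/eqP; rewrite -subr_eq0 -normr_le0; apply/ler_addgt0Pl => e e0; rewrite addr0.
have e3 : 0 < e / 3%:R by exact: divr_gt0.
have lim_near v : \forall y \near x, A y /\ `|'D_v f x - 'D_v f y| < e / 3%:R.
  near=> y; split; first by near: y; exact: open_nbhs_nbhs.
  by near: y; have /cvgrPdist_lt := (fA x Ax v).2; apply.
have /nbhs_normP[d1 /= d10 B1] := lim_near u.
have /nbhs_normP[d2 /= d20 B2] := lim_near w.
have := dlim _ e3; rewrite -/(derive _ _ _) dval => dnear.
(* One step [t] serves three purposes: the difference quotient along [u + w] is within [e / 3] of
   its limit, and both pieces stay where the derivatives along [u] and [w] are within [e / 3] of
   their values at [x]. *)
have [t [t0 tD tu tw]] : exists t : R, [/\ 0 < t,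
   `|'D_(u + w) f x - t^-1 * (f (x + t *: (u + w)) - f x)| < e / 3%:R,
   t * (`|u| + `|w|) < d1 & t * (`|u| + `|w|) < d2].
  have M0 : 0 < `|u| + `|w| + 1 by rewrite ltr_wpDl// addr_ge0.
  have H (d : R) : 0 < d -> \forall t \near (0:R)^'+, t * (`|u| + `|w|) < d.
    move=> d0; near=> t; have t0 : 0 < t by [].
    apply: (@lt_le_trans _ _ (t * (`|u| + `|w| + 1))).
      by rewrite ltr_pM2l// ltrDl.
    rewrite -ler_pdivlMr//; near: t; apply: nbhs_right_le; exact: divr_gt0.
  have dn : \forall t \near (0:R)^'+, `|'D_(u + w) f x - t^-1 * (f (x + t *: (u + w)) - f x)| < e / 3%:R.
    have /nbhs_normP[d /= d0 dn] : nbhs (0 : R) (fun t => t != 0 -> _) := dnear.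
    near=> t; have t0 : 0 < t by [].
    have := dn t; rewrite /ball_ /= sub0r normrN gtr0_norm// !scale0r !addr0.
    rewrite [t%:A]mulr1; apply; last exact: lt0r_neq0.
    by near: t; exact: nbhs_right_lt.
  near (0:R)^'+ => t; exists t; split; [by []| | |]; near: t => //; exact: H.
have seg v (c d : R) : 0 <= c <= 1 -> t * (`|u| + `|w|) < d -> `|v| <= `|u| + `|w| ->
    ball_ Num.norm x d (x + c *: (t *: v)).
  move=> /andP[c0 c1] td vu; rewrite /ball_ /= opprD addNKr normrN normrZ ger0_norm//.
  apply: le_lt_trans td; apply: (@le_trans _ _ `|t *: v|); first by rewrite ler_piMl.
  by rewrite normrZ gtr0_norm// ler_pM2l.
have seg2 (c d : R) : 0 <= c <= 1 -> t * (`|u| + `|w|) < d ->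
    ball_ Num.norm x d (x + t *: u + c *: (t *: w)).
  move=> /andP[c0 c1] td; rewrite /ball_ /= -addrA opprD addNKr normrN.
  rewrite scalerA mulrC -scalerA -scalerDr normrZ gtr0_norm//.
  apply: le_lt_trans td; rewrite ler_pM2l//; apply: le_trans (ler_normD _ _) _.
  by rewrite lerD2l normrZ ger0_norm// ler_piMl.
have [|c c01 Ec] := @line_MVT f x (t *: u).
  move=> s s01; apply: (fA _ _ _).1; apply: (B1 _ _).1.
  by apply: seg => //; rewrite lerDl.
have [|c' c01' Ec'] := @line_MVT f (x + t *: u) (t *: w).
  by move=> s s01; apply: (fA _ _ _).1; apply: (B1 _ _).1; exact: seg2.
have uw : `|u| <= `|u| + `|w| by rewrite lerDl.
have P1 := B1 _ (seg u c _ c01 tu uw).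
have P2 := B2 _ (seg2 c' _ c01' tw).
move: tD; rewrite (_ : f _ - f x = t * ('D_u f (x + c *: (t *: u)) +
    'D_w f (x + t *: u + c' *: (t *: w)))); last first.
  rewrite mulrDr -!(C1_on_derive_scale _ _ fA); [|exact: P2.1|exact: P1.1].
  by rewrite -Ec -Ec' scalerDr addrA [RHS]addrC addrA subrK.
rewrite mulKf ?gt_eqF//.
case: P1 P2 => _ P1 [_ P2] P3.
move: P1 P2 P3; set a := 'D_u f x; set b := 'D_w f x; set a' := 'D_u f _; set b' := 'D_w f _.
set g := 'D__ f x; rewrite !ltr_norml ler_norml.
by move=> /andP[? ?] /andP[? ?] /andP[? ?]; apply/andP; split; lra.
Unshelve. all: by end_near. Qed.

End Lines.

(** Criticality of the discrete paths and of the exact solutions is verified by this test with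
    [a = 0]. *)
Lemma quadratic_remainder_is_derive (R : realType) (f : R -> R) (a r C : R) : 0 < r ->
  (forall t, `|t| <= r -> `|f t - f 0 - a * t| <= C * t ^+ 2) -> is_derive (0 : R) 1 f a.
Proof.
move=> r0 fC.
have lim : h^-1 *: ((f \o shift 0) (h *: (1 : R)) - f 0) @[h --> (0 : R)^'] --> a.
  apply/cvgrPdist_le => e e0.
  have C0 : 0 < `|C| + 1 by rewrite ltr_wpDl.
  have d0 : 0 < Num.min r ((`|C| + 1)^-1 * e).
    by rewrite lt_min r0 mulr_gt0// invr_gt0.
  near=> t.
  have t0 : t != 0 by near: t; exact: nbhs_dnbhs_neq.
  have tr : `|t| <= Num.min r ((`|C| + 1)^-1 * e).
    by near: t; exact: dnbhs0_le.
  move: tr; rewrite le_min => /andP[tr te].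
  rewrite /= addr0 [t%:A]mulr1 [_ *: _]/(_ * _).
  have -> : a - t^-1 * (f t - f 0) = - (t^-1 * (f t - f 0 - a * t)) by field.
  rewrite normrN normrM normfV ler_pdivrMl ?normr_gt0//.
  apply: le_trans (fC t tr) _.
  rewrite (_ : t ^+ 2 = `|t| * `|t|); last by rewrite -expr2 real_normK ?num_real.
  rewrite mulrA mulrC ler_wpM2l//.
  apply: (@le_trans _ _ ((`|C| + 1) * `|t|)); last by rewrite -ler_pdivlMl.
  by rewrite ler_wpM2r//; have := ler_norm C; lra.
by apply: DeriveDef; [exact: cvgP lim|exact: cvg_lim lim].
Unshelve. all: by end_near. Qed.

(** * Coordinates, gradients and uniform Taylor bounds on the configuration space *)

Section Coordinates.
Context {R : realType} {ns nf : nat}.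
Notation E := (config R ns nf).
Notation I := ('I_ns + 'I_nf)%type.
Implicit Types (x y d : E) (k l : I) (f : E -> R).

(** With a sum type as index set, vector identities between slow-fast pairs reduce to scalar ones
    that [ring] and [field] settle. *)
Definition coordE x k : R := match k with inl i => x.1 i 0 | inr i => x.2 i 0 end.

Definition basisE k : E :=
  match k with inl i => (delta_mx i 0, 0) | inr i => (0, delta_mx i 0) end.

Lemma coordE_inj x y : (forall k, coordE x k = coordE y k) -> x = y.
Proof.
case: x y => [x1 x2] [y1 y2] xy; congr pair; apply/matrixP => i j; rewrite ord1.
  exact: (xy (inl i)).
exact: (xy (inr i)).
Qed.

Lemma coordED x y k : coordE (x + y) k = coordE x k + coordE y k.
Proof. by case: k => i /=; rewrite mxE. Qed.

Lemma coordEN x k : coordE (- x) k = - coordE x k.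
Proof. by case: k => i /=; rewrite mxE. Qed.

Lemma coordEB x y k : coordE (x - y) k = coordE x k - coordE y k.
Proof. by rewrite coordED coordEN. Qed.

Lemma coordEZ (a : R) x k : coordE (a *: x) k = a * coordE x k.
Proof. by case: k => i /=; rewrite mxE. Qed.

Lemma coordE0 k : coordE 0 k = 0.
Proof. by case: k => i /=; rewrite mxE. Qed.

Lemma coordE_grad f x k : coordE (grad f x) k = 'D_(basisE k) f x.
Proof. by case: k => i /=; rewrite mxE. Qed.

Lemma coordE_le x (c : R) : 0 <= c -> (`|x| <= c) <-> (forall k, `|coordE x k| <= c).
Proof.
move=> c0; rewrite prod_norm_le !mx_norm_le//; split=> [[x1 x2] [i|i] //=|xc].
by split=> i j; rewrite ord1; [exact: (xc (inl i))|exact: (xc (inr i))].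
Qed.

Lemma coordE_norm x k : `|coordE x k| <= `|x|.
Proof. by have /coordE_le := lexx `|x|; apply. Qed.

Lemma dotE_sum x y : dotE x y = \sum_k coordE x k * coordE y k.
Proof.
rewrite big_sumType /= /dotE !mxE; congr (_ + _);
  by apply: eq_bigr => i _; rewrite mxE.
Qed.

Lemma dotEDl x y d : dotE (x + y) d = dotE x d + dotE y d.
Proof. by rewrite !dotE_sum -big_split; apply: eq_bigr => k _; rewrite coordED mulrDl. Qed.

Lemma dotEC x y : dotE x y = dotE y x.
Proof. by rewrite !dotE_sum; apply: eq_bigr => k _; rewrite mulrC. Qed.

Lemma dotEDr x y d : dotE d (x + y) = dotE d x + dotE d y.
Proof. by rewrite ![dotE d _]dotEC dotEDl. Qed.

Lemma dotEZl (a : R) x d : dotE (a *: x) d = a * dotE x d.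
Proof. by rewrite !dotE_sum big_distrr; apply: eq_bigr => k _; rewrite coordEZ /= mulrA. Qed.

Lemma dotEZr (a : R) x d : dotE d (a *: x) = a * dotE d x.
Proof. by rewrite ![dotE d _]dotEC dotEZl. Qed.

Lemma dotENl x d : dotE (- x) d = - dotE x d.
Proof. by rewrite -scaleN1r dotEZl mulN1r. Qed.

Lemma dotENr x d : dotE d (- x) = - dotE d x.
Proof. by rewrite ![dotE d _]dotEC dotENl. Qed.

Lemma dotEBl x y d : dotE (x - y) d = dotE x d - dotE y d.
Proof. by rewrite dotEDl dotENl. Qed.

Lemma dotEBr x y d : dotE d (x - y) = dotE d x - dotE d y.
Proof. by rewrite dotEDr dotENr. Qed.

Lemma dotE0l d : dotE 0 d = 0.
Proof. by rewrite -[0]subr0 dotEBl subrr. Qed.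

Lemma dotE0r d : dotE d 0 = 0.
Proof. by rewrite dotEC dotE0l. Qed.

Definition dimE : R := #|{: I}|%:R.

Lemma dimE_ge0 : 0 <= dimE. Proof. exact: ler0n. Qed.

Lemma dotE_norm x y : `|dotE x y| <= dimE * (`|x| * `|y|).
Proof.
rewrite dotE_sum; apply: le_trans (ler_norm_sum _ _ _) _.
rewrite mulr_natl -sumr_const; apply: ler_sum => k _.
by rewrite normrM ler_pM// coordE_norm.
Qed.

Lemma coordE_basis k l : coordE (basisE k) l = (k == l)%:R.
Proof. by case: k l => [i|i] [j|j] //=; rewrite mxE ?eqxx ?andbT// eq_sym. Qed.

Lemma dotE_basis x k : dotE x (basisE k) = coordE x k.
Proof.
rewrite dotE_sum (bigD1 k)//= big1 ?addr0 => [|l lk].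
  by rewrite coordE_basis eqxx mulr1.
by rewrite coordE_basis eq_sym (negbTE lk) mulr0.
Qed.

Lemma sum_basisE x : x = \sum_k coordE x k *: basisE k.
Proof.
apply: coordE_inj => l.
rewrite (big_morph (fun z => coordE z l) (fun a b => coordED a b l) (coordE0 l)).
rewrite (bigD1 l)//= big1 ?addr0 => [|k kl].
  by rewrite coordEZ coordE_basis eqxx mulr1.
by rewrite coordEZ coordE_basis (negbTE kl) mulr0.
Qed.

Lemma grad_eq f x (g : E) : (forall d, 'D_d f x = dotE g d) -> grad f x = g.
Proof. by move=> fg; apply: coordE_inj => k; rewrite coordE_grad fg dotE_basis. Qed.

Lemma C1_on_derive_dot (A : set E) f x d : open A -> C1_on A f -> A x ->
  'D_d f x = dotE (grad f x) d.
Proof.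
move=> oA fA Ax; rewrite {1}(sum_basisE d) dotE_sum.
apply: (big_ind2 (fun u (s : R) => 'D_u f x = s)); first exact: derive0.
  by move=> u a v b <- <-; exact: (C1_on_derive_add _ _ oA fA).
by move=> k _; rewrite (C1_on_derive_scale _ _ fA)// coordE_grad mulrC.
Qed.

Lemma norm_segment (c x y : E) (r s : R) : 0 <= s <= 1 -> `|x - c| <= r -> `|y - c| <= r ->
  `|x + s *: (y - x) - c| <= r.
Proof.
move=> /andP[s0 s1] xc yc.
have -> : x + s *: (y - x) - c = (1 - s) *: (x - c) + s *: (y - c).
  by apply: coordE_inj => k; rewrite !(coordEB, coordED, coordEZ); ring.
apply: le_trans (ler_normD _ _) _; rewrite !normrZ ger0_norm ?subr_ge0// ger0_norm//.
have : (1 - s) * `|x - c| <= (1 - s) * r by rewrite ler_wpM2l// subr_ge0.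
have : s * `|y - c| <= s * r by rewrite ler_wpM2l.
lra.
Qed.

Lemma derive_bound_lipschitz (A : set E) f (c : E) (r M : R) : 0 <= M ->
  open A -> C1_on A f -> (forall x, `|x - c| <= r -> A x) ->
  (forall x k, `|x - c| <= r -> `|'D_(basisE k) f x| <= M) ->
  forall x y, `|x - c| <= r -> `|y - c| <= r -> `|f y - f x| <= dimE * M * `|y - x|.
Proof.
move=> M0 oA fA cA fM x y xc yc.
have seg (s : R) : 0 <= s <= 1 -> `|x + s *: (y - x) - c| <= r by move=> ?; exact: norm_segment.
have [|s s01 E] := @line_MVT _ _ f x (y - x).
  by move=> s /seg/cA As; exact: (fA _ As _).1.
rewrite addrCA subrr addr0 in E; rewrite E.
rewrite (C1_on_derive_dot _ oA fA); last exact/cA/seg.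
apply: le_trans (dotE_norm _ _) _; rewrite -mulrA ler_wpM2l ?dimE_ge0// ler_wpM2r//.
by apply/coordE_le => // k; rewrite coordE_grad; apply: fM; exact: seg.
Qed.

(** The mean value theorem is applied once, and the gradient at the intermediate point is compared
    with that at [x] by its Lipschitz bound. The factor 1/2 of Taylor's formula is given up. *)
Lemma derive2_bound_taylor (A : set E) f (c : E) (r M : R) : 0 <= M ->
  open A -> smooth_on A f -> (forall x, `|x - c| <= r -> A x) ->
  (forall x k l, `|x - c| <= r -> `|'D_(basisE l) ('D_(basisE k) f) x| <= M) ->
  forall x y, `|x - c| <= r -> `|y - c| <= r ->
    `|f y - f x - dotE (grad f x) (y - x)| <= dimE * (dimE * M) * `|y - x| ^+ 2.
Proof.
move=> M0 oA sf cA fM x y xc yc; have fA := smooth_on_C1 sf.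
have seg (s : R) : 0 <= s <= 1 -> `|x + s *: (y - x) - c| <= r by move=> ?; exact: norm_segment.
have [|s s01 E] := @line_MVT _ _ f x (y - x).
  by move=> s /seg/cA As; exact: (fA _ As _).1.
rewrite addrCA subrr addr0 in E; rewrite E.
rewrite (C1_on_derive_dot _ oA fA); last exact/cA/seg.
rewrite -dotEBl; apply: le_trans (dotE_norm _ _) _.
rewrite expr2 -!mulrA ler_wpM2l ?dimE_ge0// !mulrA ler_wpM2r//.
apply/coordE_le => [|k]; first by rewrite !mulr_ge0 ?dimE_ge0.
rewrite coordEB !coordE_grad.
apply: le_trans (derive_bound_lipschitz M0 oA (smooth_on_C1 (smooth_on_derive (basisE k) sf)) cA
  (fun z l => fM z k l) xc (seg _ s01)) _.
rewrite ler_wpM2l ?mulr_ge0 ?dimE_ge0// addrC addKr normrZ.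
by case/andP: s01 => s0 s1; rewrite ger0_norm// ler_piMl.
Qed.

Definition hess f x d : E :=
  (\col_i dotE (grad ('D_(basisE (inl i)) f) x) d,
   \col_i dotE (grad ('D_(basisE (inr i)) f) x) d).

Lemma coordE_hess f x d k : coordE (hess f x d) k = dotE (grad ('D_(basisE k) f) x) d.
Proof. by case: k => i /=; rewrite mxE. Qed.

Lemma hessZ f x (a : R) d : hess f x (a *: d) = a *: hess f x d.
Proof. by apply: coordE_inj => k; rewrite coordEZ !coordE_hess dotEZr. Qed.

Lemma hessD f x d e : hess f x (d + e) = hess f x d + hess f x e.
Proof. by apply: coordE_inj => k; rewrite coordED !coordE_hess dotEDr. Qed.

Lemma hessB f x d e : hess f x (d - e) = hess f x d - hess f x e.
Proof. by rewrite hessD -scaleN1r hessZ scaleN1r. Qed.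

(** First-order Taylor bound for [f], zeroth- and first-order ones for its gradient, all with one
    constant. They are what three bounded derivatives provide, and what a local error of order [h^3]
    requires. *)
Definition tame f (c : E) (r B : R) : Prop := forall x, `|x - c| <= r ->
  [/\ `|grad f x| <= B, (forall d, `|hess f x d| <= B * `|d|) &
  forall y, `|y - c| <= r ->
   [/\ `|f y - f x - dotE (grad f x) (y - x)| <= B * `|y - x| ^+ 2,
    `|grad f y - grad f x| <= B * `|y - x| &
    `|grad f y - grad f x - hess f x (y - x)| <= B * `|y - x| ^+ 2]].

Lemma tame_le f c (r r' B B' : R) : r' <= r -> B <= B' -> tame f c r B -> tame f c r' B'.
Proof.
move=> rr BB tf x /le_trans/(_ rr) xc; have [gB hB yB] := tf x xc.
split=> [|d|y /le_trans/(_ rr) yc]; first exact: le_trans BB.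
  by apply: le_trans (hB d) _; rewrite ler_wpM2r.
have [B1 B2 B3] := yB y yc.
by split; [apply: le_trans B1 _|apply: le_trans B2 _|apply: le_trans B3 _];
   rewrite ler_wpM2r.
Qed.

Lemma coord_bounds_tame (A : set E) f (c : E) (r M : R) : 0 <= M ->
  open A -> smooth_on A f -> (forall x, `|x - c| <= r -> A x) ->
  (forall x k, `|x - c| <= r -> `|'D_(basisE k) f x| <= M) ->
  (forall x k l, `|x - c| <= r -> `|'D_(basisE l) ('D_(basisE k) f) x| <= M) ->
  (forall x k l m, `|x - c| <= r ->
     `|'D_(basisE m) ('D_(basisE l) ('D_(basisE k) f)) x| <= M) ->
  tame f c r (M + dimE * M + dimE * (dimE * M)).
Proof.
move=> M0 oA sf cA M1 M2 M3 x xc.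
have d0 := dimE_ge0; have dM : 0 <= dimE * M by rewrite mulr_ge0.
have ddM : 0 <= dimE * (dimE * M) by rewrite mulr_ge0.
have K0 : 0 <= M + dimE * M + dimE * (dimE * M) by rewrite !addr_ge0.
have sk k := smooth_on_derive (basisE k) sf.
split=> [|d|y yc].
- apply: (@le_trans _ _ M); last by lra.
  by apply/coordE_le => // k; rewrite coordE_grad; exact: M1.
- apply/coordE_le => [|k]; first by rewrite mulr_ge0.
  rewrite coordE_hess; apply: le_trans (dotE_norm _ _) _; apply: (@le_trans _ _ (dimE * M * `|d|)).
    rewrite -mulrA ler_wpM2l// ler_wpM2r//.
    by apply/coordE_le => // l; rewrite coordE_grad; exact: M2.
  by rewrite ler_wpM2r//; lra.
split.
- apply: le_trans (derive2_bound_taylor M0 oA sf cA M2 xc yc) _.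
  by rewrite ler_wpM2r ?sqr_ge0//; lra.
- apply/coordE_le => [|k]; first by rewrite mulr_ge0.
  rewrite coordEB !coordE_grad.
  apply: le_trans (derive_bound_lipschitz M0 oA (smooth_on_C1 (sk k)) cA
    (fun z l => M2 z k l) xc yc) _.
  by rewrite ler_wpM2r//; lra.
- apply/coordE_le => [|k]; first by rewrite mulr_ge0 ?sqr_ge0.
  rewrite !coordEB !coordE_grad coordE_hess.
  apply: le_trans (derive2_bound_taylor M0 oA (sk k) cA (fun z => M3 z k) xc yc) _.
  by rewrite ler_wpM2r ?sqr_ge0//; lra.
Qed.

Lemma closed_ball_compactE (r : R) : compact [set x : E | `|x| <= r].
Proof. by apply: prod_closed_ball_compact; exact: mx_closed_ball_compact. Qed.

(** The coordinate derivatives up to order three are finitely many continuous functions, hence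
    bounded on a compact thickening of [K] inside [A]; this makes [r] and [B] uniform over the
    centres. *)
Lemma smooth_on_tame (A K : set E) f : open A -> smooth_on A f -> compact K -> K `<=` A ->
  exists r B : R, [/\ 0 < r, 0 <= B, (forall c x, K c -> `|x - c| <= r -> A x) &
    forall c, K c -> tame f c r B].
Proof.
move=> oA sf cK KA.
have [r r0 rA] : exists2 r : R, 0 < r & forall c x, K c -> `|x - c| <= r -> A x.
  near (0 : R)^'+ => r; exists r => //; near: r.
  exact: compact_uniform_ball.
set K' := [set y | exists2 x, K x & `|y - x| <= r].
have cK' : compact K' by apply: compact_thickening => //; exact: closed_ball_compactE.
have K'A x : K' x -> A x by move=> [c Kc]; exact: rA.
have bnd (vs : seq E) : \forall M \near +oo, forall x, K' x -> `|iter_derive vs f x| <= M.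
  by apply: compact_bounded_above => // x /K'A Ax; exact: (sf vs x Ax).1.
have [M [M0 M1 M2 M3]] : exists M, [/\ 0 <= M,
    (forall k x, K' x -> `|iter_derive [:: basisE k] f x| <= M),
    (forall (kl : I * I) x, K' x ->
      `|iter_derive [:: basisE kl.2; basisE kl.1] f x| <= M) &
    (forall (klm : I * I * I) x, K' x ->
      `|iter_derive [:: basisE klm.2; basisE klm.1.2; basisE klm.1.1] f x| <= M)].
  near +oo_R => M; exists M; split; first by near: M; exact: nbhs_pinfty_ge.
  - near: M; apply: filter_forall => k; exact: bnd.
  - near: M; apply: filter_forall => k; exact: bnd.
  - near: M; apply: filter_forall => k; exact: bnd.
exists r, (M + dimE * M + dimE * (dimE * M)); split => //.
  have d0 := dimE_ge0; have dM : 0 <= dimE * M by rewrite mulr_ge0.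
  have ddM : 0 <= dimE * (dimE * M) by rewrite mulr_ge0.
  by rewrite !addr_ge0.
move=> c Kc; apply: (@coord_bounds_tame A) => //.
- by move=> x; exact: rA.
- by move=> x k xc; apply: M1; exists c.
- by move=> x k l xc; apply: (M2 (k, l)); exists c.
- by move=> x k l m xc; apply: (M3 (k, l, m)); exists c.
Unshelve. all: by end_near. Qed.

Lemma dotE_is_linear (g : E) : linear (dotE g).
Proof. by move=> a x y; rewrite dotEDr dotEZr. Qed.

(** Differentiability of the discrete Lagrangian is obtained from such a bound, the correction being
    known only to be Lipschitz in the end points. *)
Lemma quadratic_remainder_diff f x (g : E) (r C : R) : 0 < r ->
  (forall d, `|d| <= r -> `|f (x + d) - f x - dotE g d| <= C * `|d| ^+ 2) ->
  [/\ differentiable f x, grad f x = g & forall d, 'D_d f x = dotE g d].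
Proof.
move=> r0 fC.
pose df : {linear E -> R} := HB.pack (dotE g) (GRing.isLinear.Build _ _ _ _ _ (dotE_is_linear g)).
have cdf : continuous df.
  move=> z; apply/(@cvgrPdist_lt R R^o) => e e0.
  have k0 : 0 < dimE * `|g| + 1 by rewrite ltr_wpDl// mulr_ge0 ?dimE_ge0.
  near=> y; rewrite -linearB /=; apply: le_lt_trans (dotE_norm _ _) _; rewrite mulrA.
  apply: (@le_lt_trans _ _ ((dimE * `|g| + 1) * `|z - y|)).
    by rewrite ler_wpM2r// lerDl.
  rewrite -ltr_pdivlMl//; near: y; apply: cvgr_dist_lt => //.
  by rewrite mulr_gt0// invr_gt0.
have H : f \o shift x = (cst (f x) + df) +o_ (0 : E) id.
  have nb (s : R) : 0 < s -> \forall d \near (0 : E), `|d| <= s.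
    move=> s0; apply/nbhs_normP; exists s => // d.
    by rewrite /ball_ /= sub0r normrN => /ltW.
  apply/eqaddoP => e e0; near=> d => /=.
  have dr : `|d| <= r by near: d; exact: nb.
  rewrite [X in `|X|](_ : _ = f (x + d) - f x - dotE g d); last first.
    by rewrite /= !fctE /= [d + x]addrC opprD addrA.
  apply: le_trans (fC d dr) _; rewrite expr2 mulrA ler_wpM2r//.
  have C0 : 0 < `|C| + 1 by rewrite ltr_wpDl.
  apply: (@le_trans _ _ ((`|C| + 1) * `|d|)).
    by rewrite ler_wpM2r//; have := ler_norm C; lra.
  rewrite -ler_pdivlMl//; near: d; apply: nb.
  by rewrite mulr_gt0// invr_gt0.
have E := diff_unique cdf H.
have D : differentiable f x by apply/diff_locallyP; rewrite E.
have Df d : 'D_d f x = dotE g d by rewrite deriveE// -[RHS]/(df d) -E.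
by split => //; exact: grad_eq.
Unshelve. all: by end_near. Qed.

End Coordinates.

(** * Quadrature averages *)

Section Averages.
Context {R : realType}.
Implicit Types r : quad_rule R.

Lemma scale_regE (a b : R) : a *: (b : R^o) = a * b.
Proof. by []. Qed.

(** A rule on one micro interval as a mean of total weight one over the relative time [c]: at 1/2
    for the midpoint rule, at 0 and 1 for the trapezoidal rule. *)
Definition rsum (U : lmodType R) r (f : R -> U) : U :=
  match r with
  | Midpoint => f 2^-1
  | Trapezoidal a => a *: f 0 + (1 - a) *: f 1
  end.

(** The first moment of the rule, equal to 1/2 or to [1 - a]. Its deviation from 1/2 is the source
    of the first-order error. *)
Definition rule_mean r : R := @rsum R^o r id.

Definition avg (U : lmodType R) r (p : nat) (f : nat -> R -> U) : U :=
  p%:R^-1 *: \sum_(0 <= m < p) rsum r (f m).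

Section Lmod.
Context {U : lmodType R}.
Implicit Types f g : nat -> R -> U.

Lemma rsumD r (u v : R -> U) : rsum r (fun c => u c + v c) = rsum r u + rsum r v.
Proof. by case: r => [//|a] /=; rewrite !scalerDr addrACA. Qed.

Lemma rsumN r (u : R -> U) : rsum r (fun c => - u c) = - rsum r u.
Proof. by case: r => [//|a] /=; rewrite !scalerN opprD. Qed.

Lemma rsum_linear (W : lmodType R) (F : U -> W) r (u : R -> U) :
  (forall u v, F (u + v) = F u + F v) -> (forall a u, F (a *: u) = a *: F u) ->
  F (rsum r u) = rsum r (fun c => F (u c)).
Proof. by move=> FD FZ; case: r => [//|a] /=; rewrite FD !FZ. Qed.

Lemma eq_avg r p f g : (forall m (c : R), (m < p)%N -> 0 <= c <= 1 -> f m c = g m c) ->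
  avg r p f = avg r p g.
Proof.
move=> fg; congr (_ *: _); apply: eq_big_nat => m /andP[_ mp].
by case: r => [|a] /=; rewrite !fg// ?lexx ?ler01//; apply/andP; split; lra.
Qed.

Lemma avgD r p f g : avg r p (fun m c => f m c + g m c) = avg r p f + avg r p g.
Proof.
rewrite /avg -scalerDr -big_split; congr (_ *: _); apply: eq_bigr => m _.
exact: rsumD.
Qed.

Lemma avgZ r p (a : R) f : avg r p (fun m c => a *: f m c) = a *: avg r p f.
Proof.
rewrite /avg scalerA mulrC -scalerA; congr (_ *: _); rewrite scaler_sumr; apply: eq_bigr => m _.
by case: r => [//|b] /=; rewrite scalerDr !scalerA ![_ * a]mulrC.
Qed.

Lemma avgN r p f : avg r p (fun m c => - f m c) = - avg r p f.
Proof.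
by rewrite -scaleN1r -avgZ; congr avg; apply/funext => m; apply/funext => c; rewrite scaleN1r.
Qed.

Lemma avgB r p f g : avg r p (fun m c => f m c - g m c) = avg r p f - avg r p g.
Proof. by rewrite avgD avgN. Qed.

Lemma avg_cst r p (u : U) : (0 < p)%N -> avg r p (fun _ _ => u) = u.
Proof.
move=> p0; rewrite /avg (eq_bigr (fun=> u)) => [|m _]; last first.
  by case: r => [//|a] /=; rewrite -scalerDl subrKC scale1r.
by rewrite sumr_const_nat subn0 -[u *+ p]scaler_nat scalerA mulVf ?scale1r// pnatr_eq0 -lt0n.
Qed.

Lemma avg_linear (W : lmodType R) (F : U -> W) r p f :
  (forall u v, F (u + v) = F u + F v) -> (forall a u, F (a *: u) = a *: F u) ->
  F (avg r p f) = avg r p (fun m c => F (f m c)).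
Proof.
move=> FD FZ; rewrite /avg FZ; congr (_ *: _).
have F0 : F 0 = 0 by rewrite -(scale0r 0) FZ scale0r.
rewrite (big_morph F FD F0); apply: eq_bigr => m _; exact: rsum_linear.
Qed.

End Lmod.

Lemma rule_mean_ge0 r : rule_param_ok r -> 0 <= rule_mean r <= 1.
Proof.
case: r => [_|a /= /andP[a0 a1]]; rewrite /rule_mean /=; first by apply/andP; split; lra.
by rewrite scaler0 add0r [_ *: _]mulr1; apply/andP; split; lra.
Qed.

Lemma rule_symmetricP r : rule_symmetric r -> rule_mean r = 2^-1.
Proof.
case: r => [//|a] /= /eqP ->.
by rewrite /rule_mean /= scaler0 add0r [_ *: _]mulr1; lra.
Qed.

Definition sigma (p m : nat) (c : R) : R := (m%:R + c) / p%:R.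

Lemma sigma_le p m (c : R) : (m < p)%N -> 0 <= c <= 1 -> 0 <= sigma p m c <= 1.
Proof.
move=> mp /andP[c0 c1]; have p0 : 0 < p%:R :> R by rewrite ltr0n (leq_ltn_trans _ mp).
apply/andP; split; first by rewrite divr_ge0// ?addr_ge0// ltW.
rewrite /sigma ler_pdivrMr// mul1r.
by apply: (@le_trans _ _ (m.+1%:R)); rewrite ?ler_nat// -natr1 lerD2l.
Qed.

Lemma sum_nat_half (p : nat) : \sum_(0 <= m < p) m%:R = p%:R * (p%:R - 1) / 2 :> R.
Proof.
elim: p => [|p IH]; first by rewrite big_geq// !mul0r.
by rewrite big_nat_recr//= IH -natr1; field.
Qed.

(** The left nodes have mean [(p - 1) / (2 p)], and the position inside a micro interval adds
    [rule_mean r / p]. The factor [1 / p] of the nonsymmetric estimate originates here. *)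
Lemma avg_sigma r p : (0 < p)%N ->
  avg r p (fun m c => sigma p m c : R^o) = 2^-1 + (rule_mean r - 2^-1) / p%:R.
Proof.
move=> p0; have pN : p%:R != 0 :> R by rewrite pnatr_eq0 -lt0n.
rewrite /avg (eq_bigr (fun m => (m%:R + rule_mean r) / p%:R)) => [|m _].
  rewrite -mulr_suml big_split /= sum_nat_half sumr_const_nat subn0 -mulr_natr.
  by rewrite [_ *: _]mulrC; field.
case: r => [//|a]; rewrite /rule_mean /sigma /= scaler0 add0r [_ *: 1]mulr1.
by rewrite !scale_regE; field.
Qed.

Lemma rsum_norm (U : normedModType R) r (f : R -> U) (M : R) : rule_param_ok r ->
  (forall c : R, 0 <= c <= 1 -> `|f c| <= M) -> `|rsum r f| <= M.
Proof.
move=> okr fM; case: r okr => [_|a /= /andP[a0 a1]] /=.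
  by apply: fM => //; apply/andP; split; lra.
apply: le_trans (ler_normD _ _) _; rewrite !normrZ ger0_norm// ger0_norm ?subr_ge0//.
have := ler_wpM2l a0 (fM 0 _); rewrite lexx ler01 => /(_ isT).
have a1' : 0 <= 1 - a by rewrite subr_ge0.
have := ler_wpM2l a1' (fM 1 _); rewrite lexx ler01 => /(_ isT).
lra.
Qed.

Lemma avg_sigmaZ (U : lmodType R) r p (u : U) : (0 < p)%N ->
  avg r p (fun m c => sigma p m c *: u) = (2^-1 + (rule_mean r - 2^-1) / p%:R) *: u.
Proof.
move=> p0; rewrite -avg_sigma// -[RHS]/((fun a : R^o => a *: u) _) avg_linear//.
  by move=> a b; rewrite scalerDl.
by move=> a b; rewrite scalerA.
Qed.

Lemma avg_norm (U : normedModType R) r p (f : nat -> R -> U) (M : R) :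
  (0 < p)%N -> rule_param_ok r ->
  (forall m (c : R), (m < p)%N -> 0 <= c <= 1 -> `|f m c| <= M) -> `|avg r p f| <= M.
Proof.
move=> p0 okr fM; rewrite /avg normrZ ger0_norm ?invr_ge0// mulrC ler_pdivrMr ?ltr0n//.
apply: le_trans (ler_norm_sum _ _ _) _.
apply: (@le_trans _ _ (\sum_(0 <= m < p) M)).
  by apply: ler_sum_nat => m /= mp; apply: rsum_norm => // c; exact: fM.
by rewrite sumr_const_nat subn0 mulr_natr.
Qed.

(** Both rules evaluate [Z] at [(1 - c) z_m + c z_{m+1}], with [c = 1/2] or [c] in {0, 1}; the micro
    step times a sum over [p] intervals is [h] times a mean. *)
Lemma quad_avg (U : lmodType R) r p (h : R) (Z : U -> R) (z : nat -> U) :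
  quad r p (h / p%:R) Z z =
  h * avg r p (fun m c => Z ((1 - c) *: z m + c *: z m.+1) : R^o).
Proof.
rewrite /avg [_ *: _]/(_ * _) mulrA; case: r => [|a] /=; congr (_ * _).
  apply: eq_bigr => m _; rewrite scalerDr (_ : 1 - 2^-1 = 2^-1 :> R)//; lra.
by apply: eq_bigr => m _; rewrite subr0 subrr !scale1r !scale0r addr0 add0r.
Qed.

End Averages.

(** * Kinetic energy *)

Section Mass.
Context {R : realType} {ns nf : nat}.
Notation E := (config R ns nf).
Variables (Ms : 'M[R]_ns) (Mf : 'M[R]_nf).

(** No symmetry of the mass matrices is assumed, but a quadratic form sees only the symmetric part,
    which therefore governs the momenta. *)
Definition sym_part n (M : 'M[R]_n) : 'M[R]_n := 2^-1 *: (M + M^T).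

Definition mass (v : E) : E := (sym_part Ms *m v.1, sym_part Mf *m v.2).
Definition mass_inv (v : E) : E := (invmx (sym_part Ms) *m v.1, invmx (sym_part Mf) *m v.2).

Lemma mass_is_linear : linear mass.
Proof. by move=> a u v; congr pair; rewrite /= mulmxDr -scalemxAr. Qed.
HB.instance Definition _ := GRing.isLinear.Build R E E _ mass mass_is_linear.

Lemma mass_inv_is_linear : linear mass_inv.
Proof. by move=> a u v; congr pair; rewrite /= mulmxDr -scalemxAr. Qed.
HB.instance Definition _ := GRing.isLinear.Build R E E _ mass_inv mass_inv_is_linear.

Lemma massZ (a : R) (v : E) : mass (a *: v) = a *: mass v.
Proof. exact: linearZ. Qed.

Lemma mass_invZ (a : R) (v : E) : mass_inv (a *: v) = a *: mass_inv v.
Proof. exact: linearZ. Qed.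

Lemma mass_invD (u v : E) : mass_inv (u + v) = mass_inv u + mass_inv v.
Proof. exact: linearD. Qed.

Lemma mass_inv0 : mass_inv 0 = 0.
Proof. exact: linear0. Qed.

Lemma mass_invB (u v : E) : mass_inv (u - v) = mass_inv u - mass_inv v.
Proof. exact: linearB. Qed.

Lemma massB (u v : E) : mass (u - v) = mass u - mass v.
Proof. exact: linearB. Qed.

Definition kin (v : E) : R := 2^-1 * dotE (mass v) v.

Lemma sym_partT n (M : 'M[R]_n) : (sym_part M)^T = sym_part M.
Proof. by rewrite /sym_part linearZ /= linearD /= trmxK addrC. Qed.

Lemma qform_sym n (M : 'M[R]_n) (x : 'cV[R]_n) :
  ((sym_part M *m x)^T *m x) 0 0 = qform M x.
Proof.
have T : qform M^T x = qform M x.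
  rewrite /qform -[RHS]trace_mx11 -mxtrace_tr !trmx_mul trmxK trace_mx11.
  by rewrite mulmxA.
rewrite trmx_mul sym_partT /sym_part -scalemxAr -scalemxAl mulmxDr mulmxDl mxE mxE.
by rewrite -![(_ *m _) 0 0]/(qform _ _) T; field.
Qed.

Lemma kinE (v : E) : 2^-1 * qform Ms v.1 + 2^-1 * qform Mf v.2 = kin v.
Proof. by rewrite /kin /dotE /= !qform_sym mulrDr. Qed.

Lemma mass_sym (u v : E) : dotE (mass u) v = dotE (mass v) u.
Proof.
have S n (M : 'M[R]_n) (x y : 'cV[R]_n) :
    ((sym_part M *m x)^T *m y) 0 0 = ((sym_part M *m y)^T *m x) 0 0.
  rewrite -[LHS]trace_mx11 -mxtrace_tr trace_mx11 !trmx_mul !trmxK sym_partT.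
  by rewrite mulmxA.
by rewrite /dotE /= S (S _ Mf).
Qed.

Lemma kinD (u v : E) : kin (u + v) = kin u + dotE (mass u) v + kin v.
Proof.
rewrite /kin linearD /= dotEDl !dotEDr (mass_sym v u).
set a := dotE _ u; set b := dotE _ v; set c := dotE _ v; by field.
Qed.

Lemma kinZ (a : R) (v : E) : kin (a *: v) = a ^+ 2 * kin v.
Proof. by rewrite /kin linearZ /= dotEZl dotEZr; ring. Qed.

(** One constant that bounds both [mass] and [mass_inv]. *)
Definition mass_bound : R :=
  ns%:R * `|sym_part Ms| + nf%:R * `|sym_part Mf| +
  ns%:R * `|invmx (sym_part Ms)| + nf%:R * `|invmx (sym_part Mf)|.

Let nonneg n (A : 'M[R]_n) : 0 <= n%:R * `|A|. Proof. by rewrite mulr_ge0. Qed.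

Lemma mass_bound_ge0 : 0 <= mass_bound.
Proof. by rewrite !addr_ge0. Qed.

Lemma mass_norm (v : E) : `|mass v| <= mass_bound * `|v|.
Proof.
have := nonneg (sym_part Ms); have := nonneg (sym_part Mf).
have := nonneg (invmx (sym_part Ms)); have := nonneg (invmx (sym_part Mf)).
have /prod_norm_le[v1 v2] := lexx `|v|.
move=> ? ? ? ?; apply/prod_norm_le; split; apply: le_trans (mulmx_norm_le _ _) _;
  apply: ler_pM => //; rewrite /mass_bound; lra.
Qed.

Lemma mass_inv_norm (v : E) : `|mass_inv v| <= mass_bound * `|v|.
Proof.
have := nonneg (sym_part Ms); have := nonneg (sym_part Mf).
have := nonneg (invmx (sym_part Ms)); have := nonneg (invmx (sym_part Mf)).
have /prod_norm_le[v1 v2] := lexx `|v|.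
move=> ? ? ? ?; apply/prod_norm_le; split; apply: le_trans (mulmx_norm_le _ _) _;
  apply: ler_pM => //; rewrite /mass_bound; lra.
Qed.

Lemma kin_norm (v : E) : `|kin v| <= dimE (R := R) (ns := ns) (nf := nf) * mass_bound * `|v| ^+ 2.
Proof.
rewrite /kin normrM ger0_norm ?invr_ge0//.
have := dotE_norm (mass v) v.
have : dimE (R := R) (ns := ns) (nf := nf) * (`|mass v| * `|v|) <=
    dimE (R := R) (ns := ns) (nf := nf) * (mass_bound * `|v| * `|v|).
  by rewrite ler_wpM2l ?dimE_ge0// ler_wpM2r// mass_norm.
have := normr_ge0 (dotE (mass v) v); rewrite expr2 !mulrA.
set a := `|dotE _ _|; set b := _ * `|v| * `|v|; lra.
Qed.

Hypotheses (uS : sym_part Ms \in unitmx) (uF : sym_part Mf \in unitmx).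

Lemma massK : cancel mass mass_inv.
Proof. by move=> [a b]; congr pair; rewrite /= mulKmx. Qed.

Lemma mass_invK : cancel mass_inv mass.
Proof. by move=> [a b]; congr pair; rewrite /= mulKVmx. Qed.

End Mass.

Section Regularity.
Context {R : realType} {ns nf : nat}.
Notation E := (config R ns nf).
Variables (Ms : 'M[R]_ns) (Mf : 'M[R]_nf) (V : E -> R) (W : 'cV[R]_nf -> R).
Notation L := (L_multi Ms Mf V W).

Lemma L_multiE (q v : E) : L q v = kin Ms Mf v - (V q + W q.2).
Proof. by rewrite /L_multi kinE opprD addrA. Qed.

Lemma L_multi_velocity (q v : E) :
  grad (L q) v = mass Ms Mf v /\ forall d, 'D_d (L q) v = dotE (mass Ms Mf v) d.
Proof.
have [|_ -> D] := @quadratic_remainder_diff _ _ _ (L q) v (mass Ms Mf v) 1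
    (dimE (R := R) (ns := ns) (nf := nf) * mass_bound Ms Mf) ltr01; last by split.
move=> d _; rewrite !L_multiE kinD.
have -> : kin Ms Mf v + dotE (mass Ms Mf v) d + kin Ms Mf d - (V q + W q.2) -
  (kin Ms Mf v - (V q + W q.2)) - dotE (mass Ms Mf v) d = kin Ms Mf d by ring.
exact: kin_norm.
Qed.

(** The second velocity derivative of [L] is the form [dotE (mass w') w], so regularity at a single
    point of [Q] makes [mass] injective, and an injective square matrix is invertible. For empty [Q]
    regularity would say nothing. *)
Lemma regular_unitmx (Q : set E) : regular Q L -> Q !=set0 ->
  sym_part Ms \in unitmx /\ sym_part Mf \in unitmx.
Proof.
move=> rL [q Qq].
have minj (w : E) : mass Ms Mf w = 0 -> w = 0.
  move=> w0; apply: (rL q 0 Qq) => w'.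
  have -> : 'D_w' (L q) = fun v => dotE (mass Ms Mf v) w'.
    by apply/funext => v; rewrite (L_multi_velocity q v).2.
  have [|_ _ ->] := @quadratic_remainder_diff _ _ _ (fun v => dotE (mass Ms Mf v) w')
    0 (mass Ms Mf w') 1 0 ltr01.
    move=> d _; rewrite add0r linear0 dotE0l subr0 mass_sym subrr normr0 mul0r.
    by [].
  by rewrite mass_sym w0 dotE0l.
have unit n (M : 'M[R]_n) : (forall x : 'cV[R]_n, sym_part M *m x = 0 -> x = 0) ->
    sym_part M \in unitmx.
  move=> Mx; rewrite -row_free_unit -kermx_eq0; apply/eqP/row_matrixP => i.
  apply: trmx_inj; rewrite row0 trmx0; apply: Mx.
  by rewrite -[X in X *m _]sym_partT -trmx_mul -row_mul mulmx_ker row0 trmx0.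
split; apply: unit => x Mx.
  have : (x, 0) = 0 :> E by apply: minj; rewrite /mass /= Mx mulmx0.
  by case.
have : (0, x) = 0 :> E by apply: minj; rewrite /mass /= Mx mulmx0.
by case.
Qed.

End Regularity.

(** * Discrete Euler-Lagrange equations *)

Section Correction.
Context {R : realType} {ns nf : nat}.
Notation E := (config R ns nf).
Variables (Ms : 'M[R]_ns) (Mf : 'M[R]_nf) (rW rV : quad_rule R).
Hypotheses (okW : rule_param_ok rW) (okV : rule_param_ok rV).
Hypotheses (uS : sym_part Ms \in unitmx) (uF : sym_part Mf \in unitmx).
Variables (p : nat) (h : R).
Hypotheses (p_gt0 : (0 < p)%N) (h_gt0 : 0 < h).

Notation dt := (h / p%:R).
Notation mass := (mass Ms Mf).
Notation mass_inv := (mass_inv Ms Mf).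
Notation kin := (kin Ms Mf).

Let pR_gt0 : 0 < p%:R :> R. Proof. by rewrite ltr0n. Qed.
Let pR_neq0 : p%:R != 0 :> R. Proof. by rewrite lt0r_neq0. Qed.
Let h_neq0 : h != 0. Proof. by rewrite lt0r_neq0. Qed.
Let dt_gt0 : 0 < dt. Proof. by rewrite divr_gt0. Qed.
Let dt_ge0 : 0 <= dt. Proof. exact: ltW. Qed.
Let dt_p : dt * p%:R = h. Proof. by rewrite divfK. Qed.

(** The Boolean tags the potential: [true] for the slow potential with [rV], [false] for the fast
    one with [rW]. The total weight is two, whence the factors 2 in the norm bounds. *)
Definition psum (U : lmodType R) (f : bool -> R -> U) : U :=
  rsum rV (f true) + rsum rW (f false).

Definition tavg (U : lmodType R) (f : bool -> nat -> R -> U) : U :=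
  avg rV p (f true) + avg rW p (f false).

Lemma psumD (U : lmodType R) (f g : bool -> R -> U) :
  psum (fun b c => f b c + g b c) = psum f + psum g.
Proof. by rewrite /psum !rsumD addrACA. Qed.

Lemma psumN (U : lmodType R) (f : bool -> R -> U) :
  psum (fun b c => - f b c) = - psum f.
Proof. by rewrite /psum !rsumN opprD. Qed.

Lemma psum_linear (U T : lmodType R) (F : U -> T) (f : bool -> R -> U) :
  (forall u v, F (u + v) = F u + F v) -> (forall a u, F (a *: u) = a *: F u) ->
  F (psum f) = psum (fun b c => F (f b c)).
Proof. by move=> FD FZ; rewrite /psum FD !(rsum_linear _ _ FD FZ). Qed.

Lemma psum_norm (U : normedModType R) (f : bool -> R -> U) (G : R) :
  (forall b (c : R), 0 <= c <= 1 -> `|f b c| <= G) -> `|psum f| <= 2 * G.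
Proof.
move=> fG; apply: le_trans (ler_normD _ _) _; rewrite mulr_natl.
by apply: lerD; apply: rsum_norm => // c c01; exact: fG.
Qed.

Lemma tavg_psum (U : lmodType R) (f : bool -> nat -> R -> U) :
  tavg f = p%:R^-1 *: \sum_(0 <= m < p) psum (fun b => f b m).
Proof. by rewrite /tavg /avg -scalerDr -big_split. Qed.

Lemma tavg_norm (U : normedModType R) (f : bool -> nat -> R -> U) (G : R) :
  (forall b m (c : R), (m < p)%N -> 0 <= c <= 1 -> `|f b m c| <= G) ->
  `|tavg f| <= 2 * G.
Proof.
move=> fG; apply: le_trans (ler_normD _ _) _; rewrite mulr_natl.
by apply: lerD; apply: avg_norm => // m c; exact: fG.
Qed.

Lemma tavgD (U : lmodType R) (f g : bool -> nat -> R -> U) :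
  tavg (fun b m c => f b m c + g b m c) = tavg f + tavg g.
Proof. by rewrite /tavg !avgD addrACA. Qed.

Lemma tavgB (U : lmodType R) (f g : bool -> nat -> R -> U) :
  tavg (fun b m c => f b m c - g b m c) = tavg f - tavg g.
Proof. by rewrite /tavg !avgB opprD addrACA. Qed.

Lemma tavg_linear (U T : lmodType R) (F : U -> T) (f : bool -> nat -> R -> U) :
  (forall u v, F (u + v) = F u + F v) -> (forall a u, F (a *: u) = a *: F u) ->
  F (tavg f) = tavg (fun b m c => F (f b m c)).
Proof. by move=> FD FZ; rewrite /tavg FD !(avg_linear _ _ _ FD FZ). Qed.

Lemma eq_tavg (U : lmodType R) (f g : bool -> nat -> R -> U) :
  (forall b m (c : R), (m < p)%N -> 0 <= c <= 1 -> f b m c = g b m c) ->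
  tavg f = tavg g.
Proof. by move=> fg; congr (_ + _); apply: eq_avg => m c; exact: fg. Qed.

(** Corrections and nodal forces live in the full space with vanishing slow part, so that the same
    [mass], [dotE] and norm apply to them. *)
Definition fast (x : E) : E := (0, x.2).

Lemma fastD x y : fast (x + y) = fast x + fast y.
Proof. by congr pair; rewrite /= addr0. Qed.

Lemma fastN x : fast (- x) = - fast x.
Proof. by congr pair; rewrite /= oppr0. Qed.

Lemma fast_norm x : `|fast x| <= `|x|.
Proof.
by apply/prod_norm_le; rewrite /= normr0; have /prod_norm_le[] := lexx `|x|.
Qed.

Lemma fast_id x : x.1 = 0 -> fast x = x.
Proof. by case: x => a b /= ->. Qed.

Lemma dotE_fast x d : d.1 = 0 -> dotE (fast x) d = dotE x d.
Proof. by move=> d1; rewrite /dotE /= d1 !mulmx0. Qed.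

Implicit Types g : bool -> nat -> R -> E.

(** The forces on micro interval [m] tested with the hat functions of its two nodes: weight [1 - c]
    for the left node, [c] for the right one. *)
Definition left_force g m : E := fast (psum (fun b c => (1 - c) *: g b m c)).
Definition right_force g m : E := fast (psum (fun b c => c *: g b m c)).

(** Total of the nodal forces at the nodes 0 to [m]: an inner node collects [right_force] from the
    interval before it and [left_force] from the one after it. *)
Definition impulse g m : E :=
  dt *: (\sum_(0 <= k < m) (left_force g k + right_force g k) + left_force g m).

(** The constant of the first summation, determined by the boundary value 0 at node [p]. *)
Definition mean_impulse g : E := p%:R^-1 *: \sum_(0 <= k < p) impulse g k.

(* Double summation of the forces, i.e. the discrete Green operator with zero
   boundary values applied to [g]. *)
Definition green g m : E :=
  dt *: mass_inv (\sum_(0 <= k < m) (mean_impulse g - impulse g k)).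

Lemma greenS g m : green g m.+1 - green g m = dt *: mass_inv (mean_impulse g - impulse g m).
Proof.
have S n (F : nat -> E) : \sum_(0 <= k < n.+1) F k = \sum_(0 <= k < n) F k + F n.
  by rewrite big_nat_recr.
rewrite /green S (mass_invD _ _ (\sum_(0 <= k < m) _)) scalerDr.
have addK (x y : E) : x + y - x = y by rewrite addrAC subrr add0r.
exact: addK.
Qed.

Lemma green0 g : green g 0 = 0.
Proof. by rewrite /green big_geq// mass_inv0 scaler0. Qed.

Lemma greenp g : green g p = 0.
Proof.
rewrite /green big_split /= sumr_const_nat subn0 sumrN -[mean_impulse g *+ p]scaler_nat.
by rewrite /mean_impulse scalerA divff// scale1r subrr mass_inv0 scaler0.
Qed.

Lemma impulse1 g m : (impulse g m).1 = 0.
Proof.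
rewrite /impulse /= (big_morph (fun x : E => x.1) (fun x y => erefl) erefl) /=.
by rewrite big1 ?addr0 ?scaler0// => k _; rewrite addr0.
Qed.

Lemma mean_impulse1 g : (mean_impulse g).1 = 0.
Proof.
rewrite /mean_impulse /= (big_morph (fun x : E => x.1) (fun x y => erefl) erefl).
by rewrite big1 ?scaler0// => i _; rewrite impulse1.
Qed.

Lemma green1 g m : (green g m).1 = 0.
Proof.
rewrite /green /= (big_morph (fun x : E => x.1) (fun x y => erefl) erefl).
rewrite big1 ?mulmx0 ?scaler0// => k _.
by rewrite -[LHS]/((mean_impulse g).1 - (impulse g k).1) impulse1 mean_impulse1 subr0.
Qed.

Lemma left_forceB g g' m :
  left_force (fun b m c => g b m c - g' b m c) m = left_force g m - left_force g' m.
Proof.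
rewrite /left_force -fastN -fastD -psumN -psumD; congr fast.
by congr psum; apply/funext => b; apply/funext => c; rewrite scalerBr.
Qed.

Lemma right_forceB g g' m :
  right_force (fun b m c => g b m c - g' b m c) m = right_force g m - right_force g' m.
Proof.
rewrite /right_force -fastN -fastD -psumN -psumD; congr fast.
by congr psum; apply/funext => b; apply/funext => c; rewrite scalerBr.
Qed.

Lemma impulseB g g' m :
  impulse (fun b m c => g b m c - g' b m c) m = impulse g m - impulse g' m.
Proof.
rewrite /impulse -scalerBr left_forceB opprD addrACA; congr (_ *: (_ + _)).
rewrite -sumrB; apply: eq_bigr => k _.
by rewrite left_forceB right_forceB opprD addrACA.
Qed.

Lemma mean_impulseB g g' :
  mean_impulse (fun b m c => g b m c - g' b m c) = mean_impulse g - mean_impulse g'.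
Proof.
rewrite /mean_impulse -scalerBr -sumrB; congr (_ *: _).
by apply: eq_bigr => i _; rewrite impulseB.
Qed.

(** Linearity in the forces turns the norm bounds below into the Lipschitz bound of the correction
    map. *)
Lemma greenB g g' m :
  green (fun b m c => g b m c - g' b m c) m = green g m - green g' m.
Proof.
rewrite /green -scalerBr -mass_invB -sumrB; congr (_ *: mass_inv _).
apply: eq_bigr => k _; rewrite impulseB mean_impulseB.
by rewrite !opprB addrACA [RHS]addrACA [- mean_impulse g' + _]addrC.
Qed.

Section Bounds.
Variables (g : bool -> nat -> R -> E) (G : R).
Hypothesis gG : forall b m (c : R), (m < p)%N -> 0 <= c <= 1 -> `|g b m c| <= G.

Let G_ge0 : 0 <= G.
Proof. by apply: le_trans (gG true p_gt0 (_ : 0 <= 0 <= 1)) => //; rewrite lexx ler01. Qed.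

Lemma left_force_norm m : (m < p)%N -> `|left_force g m| <= 2 * G.
Proof.
move=> mp; apply: le_trans (fast_norm _) _; apply: psum_norm => b c /[dup] c01 /andP[c0 c1].
rewrite normrZ ger0_norm ?subr_ge0//; apply: le_trans (gG b mp c01).
by rewrite ler_piMl//; lra.
Qed.

Lemma right_force_norm m : (m < p)%N -> `|right_force g m| <= 2 * G.
Proof.
move=> mp; apply: le_trans (fast_norm _) _; apply: psum_norm => b c /[dup] c01 /andP[c0 c1].
rewrite normrZ ger0_norm//; apply: le_trans (gG b mp c01).
by rewrite ler_piMl.
Qed.

(** At most [p] intervals contribute, each at most [4 * G] and weighted by [h / p]: the number of
    micro steps cancels. *)
Lemma impulse_norm m : (m < p)%N -> `|impulse g m| <= 4 * G * h.
Proof.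
move=> mp; rewrite /impulse normrZ gtr0_norm//.
have -> : 4 * G * h = dt * (p%:R * (4 * G)) by rewrite mulrA dt_p mulrC.
rewrite ler_wpM2l//; apply: (@le_trans _ _ (m.+1%:R * (4 * G))); last first.
  by rewrite ler_wpM2r ?ler_nat// mulr_ge0.
rewrite -natr1 mulrDl mul1r; apply: le_trans (ler_normD _ _) _; apply: lerD; last first.
  by apply: le_trans (left_force_norm mp) _; have := G_ge0; lra.
apply: le_trans (ler_norm_sum _ _ _) _.
rewrite mulr_natl -[X in _ *+ X]subn0 -sumr_const_nat.
apply: ler_sum_nat => k /= km; apply: le_trans (ler_normD _ _) _.
have -> : 4 * G = 2 * G + 2 * G by ring.
by apply: lerD; [apply: left_force_norm|apply: right_force_norm]; exact: ltn_trans mp.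
Qed.

Lemma mean_impulse_norm : `|mean_impulse g| <= 4 * G * h.
Proof.
rewrite normrZ ger0_norm ?invr_ge0// ler_pdivrMl//.
have -> : p%:R * (4 * G * h) = \sum_(0 <= k < p) (4 * G * h).
  by rewrite sumr_const_nat subn0 -[RHS]mulr_natl.
apply: le_trans (ler_norm_sum _ _ _) _.
by apply: ler_sum_nat => k /= km; exact: impulse_norm.
Qed.

Lemma greenS_norm m : (m < p)%N ->
  `|green g m.+1 - green g m| <= 8 * mass_bound Ms Mf * G * h * dt.
Proof.
move=> mp; rewrite greenS normrZ gtr0_norm// mulrC ler_wpM2r//.
apply: (@le_trans _ _ (mass_bound Ms Mf * (8 * G * h))); last by rewrite le_eqVlt; apply/orP; left; apply/eqP; ring.
apply: le_trans (mass_inv_norm _ _ _) _; rewrite ler_wpM2l ?mass_bound_ge0//.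
apply: le_trans (ler_normB _ _) _.
have := mean_impulse_norm; have := impulse_norm mp; lra.
Qed.

Lemma green_norm m : (m <= p)%N -> `|green g m| <= 8 * mass_bound Ms Mf * G * h ^+ 2.
Proof.
move=> mp.
apply: (@le_trans _ _ (m%:R * (8 * mass_bound Ms Mf * G * h * dt))).
  elim: m mp => [_|m IH mp]; first by rewrite green0 normr0 mul0r.
  rewrite -[green g m.+1](subrK (green g m)); apply: le_trans (ler_normD _ _) _.
  rewrite addrC -natr1 mulrDl mul1r; apply: lerD; first exact/IH/ltnW.
  exact: greenS_norm.
have -> : 8 * mass_bound Ms Mf * G * h ^+ 2 =
    p%:R * (8 * mass_bound Ms Mf * G * h * dt).
  by rewrite expr2 -{2}dt_p; ring.
by rewrite ler_wpM2r ?ler_nat// !mulr_ge0 ?mass_bound_ge0// ltW.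
Qed.

End Bounds.

(* Summation by parts: [green g] solves the weak form of the discrete Euler-Lagrange
   equations with forces [g]. *)
Lemma green_variation g (d : nat -> E) : d 0%N = 0 -> d p = 0 -> (forall m, (d m).1 = 0) ->
  \sum_(0 <= m < p) dt^-1 * dotE (mass (green g m.+1 - green g m)) (d m.+1 - d m) =
  h * tavg (fun b m c => dotE (g b m c) ((1 - c) *: d m + c *: d m.+1) : R^o).
Proof.
move=> d0 dp d1; have dtN : dt != 0 by rewrite lt0r_neq0.
pose Rm m := dt *: \sum_(0 <= k < m) (left_force g k + right_force g k).
have psum_dot m (w : R -> R) (e : E) : e.1 = 0 ->
    psum (fun b c => w c * dotE (g b m c) e : R^o) =
    dotE (fast (psum (fun b c => w c *: g b m c))) e.
  move=> e1; rewrite dotE_fast// (@psum_linear E R^o (fun x => dotE x e)).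
  - by congr psum; apply/funext => b; apply/funext => c; rewrite dotEZl.
  - by move=> u v; rewrite dotEDl.
  - by move=> a u; rewrite dotEZl.
have -> : h * tavg (fun b m c => dotE (g b m c) ((1 - c) *: d m + c *: d m.+1) : R^o) =
    \sum_(0 <= m < p) dt * (dotE (left_force g m) (d m) + dotE (right_force g m) (d m.+1)).
  rewrite tavg_psum scale_regE mulrA -mulr_sumr; congr (_ * _).
  apply: eq_bigr => m _; rewrite -!psum_dot// -psumD; congr psum.
  by apply/funext => b; apply/funext => c; rewrite dotEDr !dotEZr.
have tel (x : E) : \sum_(0 <= m < p) dotE x (d m.+1 - d m) = 0.
  under eq_bigr => m _ do rewrite dotEBr.
  by rewrite telescope_sumr// d0 dp subrr.
(* Discrete product rule for the running sum [Rm] paired with [d]. Since [d] vanishes at both ends,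
   its telescoping increments sum to zero, and so do those paired with the constant
   [mean_impulse g]; the work of the nodal forces remains. *)
rewrite (eq_bigr (fun m => dotE (mean_impulse g) (d m.+1 - d m) +
   dt * (dotE (left_force g m) (d m) + dotE (right_force g m) (d m.+1)) -
   (dotE (Rm m.+1) (d m.+1) - dotE (Rm m) (d m)))) => [|m _].
  rewrite sumrB big_split /= tel add0r telescope_sumr//.
  by rewrite d0 dp !dotE0r subrr subr0.
rewrite greenS massZ mass_invK// dotEZl mulKf// dotEBl /Rm big_nat_recr//= /impulse.
move: (mean_impulse g) (left_force g m) (right_force g m) (d m) (d m.+1) (\sum_(0 <= k < m) _).
by move=> M lf rf x y S; rewrite !dotEZl !dotEDl !dotEBr; ring.
Qed.

End Correction.

(** * The two-point discrete Lagrangian *)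

Section DiscreteCritical.
Context {R : realType} {ns nf : nat}.
Notation E := (config R ns nf).
Variables (Qs : set 'cV[R]_ns) (Qf : set 'cV[R]_nf).
Variables (Ms : 'M[R]_ns) (Mf : 'M[R]_nf) (V : E -> R) (W : 'cV[R]_nf -> R).
Variables (rW rV : quad_rule R).
Hypotheses (okW : rule_param_ok rW) (okV : rule_param_ok rV).
Hypotheses (uS : sym_part Ms \in unitmx) (uF : sym_part Mf \in unitmx).
Variables (p : nat) (h : R).
Hypotheses (p_gt0 : (0 < p)%N) (h_gt0 : 0 < h).

Notation dt := (h / p%:R).
Notation mass := (mass Ms Mf).
Notation mass_inv := (mass_inv Ms Mf).
Notation kin := (kin Ms Mf).
Notation tavg := (tavg rW rV p).
Notation green := (green Ms Mf rW rV p h).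
Notation dimE := (dimE (R := R) (ns := ns) (nf := nf)).

Let pR_gt0 : 0 < p%:R :> R. Proof. by rewrite ltr0n. Qed.
Let pR_neq0 : p%:R != 0 :> R. Proof. by rewrite lt0r_neq0. Qed.
Let h_neq0 : h != 0. Proof. by rewrite lt0r_neq0. Qed.
Let dt_gt0 : 0 < dt. Proof. by rewrite divr_gt0. Qed.

Definition pot (b : bool) : E -> R := if b then V else fun x => W x.2.

(* The points where the potentials are evaluated: those of the straight line from
   [q0] to [q1], corrected by the piecewise linear interpolation of [e]. *)
Definition node (q0 q1 : E) (e : nat -> E) m (c : R) : E :=
  q0 + sigma p m c *: (q1 - q0) + ((1 - c) *: e m + c *: e m.+1).

Definition force q0 q1 e (b : bool) m c : E := grad (pot b) (node q0 q1 e m c).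

Definition corrected_action q0 q1 (e : nat -> E) : R :=
  h^-1 * kin (q1 - q0) + \sum_(0 <= m < p) dt^-1 * kin (e m.+1 - e m)
  - h * tavg (fun b m c => pot b (node q0 q1 e m c) : R^o).

Definition corrected_path (q0 q1 : E) (e : nat -> E) m : 'cV[R]_nf :=
  q0.2 + (m%:R / p%:R) *: (q1.2 - q0.2) + (e m).2.

Definition admissible_correction (e : nat -> E) : Prop :=
  [/\ e 0%N = 0, e p = 0 & forall m, (e m).1 = 0].

(** The cross term between the constant increment of the straight line and the increments of [e]
    telescopes and vanishes with [e] at both ends, so the kinetic energies of line and correction
    add up. *)
Lemma Ld_micro_corrected q0 q1 e : admissible_correction e ->
  Ld_micro Ms Mf V W rW rV p h q0.1 q1.1 (corrected_path q0 q1 e) =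
  corrected_action q0 q1 e.
Proof.
move=> [e0 ep e1]; rewrite /Ld_micro /corrected_action.
have qform0 n (M : 'M[R]_n) : qform M 0 = 0 by rewrite /qform mulmx0 mxE.
have kinf (y : 'cV[R]_nf) : 2^-1 * qform Mf y = kin (0, y).
  by rewrite -kinE /= qform0 mulr0 add0r.
have kins (y : 'cV[R]_ns) : 2^-1 * qform Ms y = kin (y, 0).
  by rewrite -kinE /= qform0 mulr0 addr0.
have -> : (2 * h)^-1 * qform Ms (q1.1 - q0.1) = h^-1 * kin ((q1 - q0).1, 0).
  by rewrite -kins invfM; ring.
have -> : \sum_(0 <= m < p) (2 * dt)^-1 * qform Mf (corrected_path q0 q1 e m.+1 - corrected_path q0 q1 e m) =
    h^-1 * kin (0, (q1 - q0).2) + \sum_(0 <= m < p) dt^-1 * kin (e m.+1 - e m).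
  (* The increment of the straight line over one micro step, in the fast variables. *)
  pose D : E := p%:R^-1 *: (0, (q1 - q0).2).
  transitivity (\sum_(0 <= m < p) (dt^-1 * kin D + dt^-1 * kin (e m.+1 - e m) +
      (dotE (dt^-1 *: mass D) (e m.+1) - dotE (dt^-1 *: mass D) (e m)))).
    apply: eq_bigr => m _.
    have -> : (2 * dt)^-1 * qform Mf (corrected_path q0 q1 e m.+1 - corrected_path q0 q1 e m) =
        dt^-1 * kin (D + (e m.+1 - e m)).
      rewrite [X in kin X](_ : _ = (0, corrected_path q0 q1 e m.+1 - corrected_path q0 q1 e m)).
        by rewrite -kinf invfM; ring.
      congr pair; first by rewrite /= !e1 subrr addr0 scaler0.
      rewrite /corrected_path /= opprD addrACA; congr (_ + _).
      by rewrite opprD addrACA subrr add0r -scalerBl -mulrBl -natr1 addrAC subrr add0r mul1r.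
    by rewrite kinD dotEBr !dotEZl; ring.
  rewrite big_split big_split /= telescope_sumr// e0 ep !dotE0r subrr addr0.
  congr (_ + _); rewrite sumr_const_nat subn0 kinZ -[LHS]mulr_natl.
  by rewrite /=; field; rewrite pR_neq0 h_neq0.
have zE m c : (1 - c) *: (slow_micro p q0.1 q1.1 m, corrected_path q0 q1 e m) +
    c *: (slow_micro p q0.1 q1.1 m.+1, corrected_path q0 q1 e m.+1) = node q0 q1 e m c.
  have zz k : (slow_micro p q0.1 q1.1 k, corrected_path q0 q1 e k) =
      q0 + (k%:R / p%:R) *: (q1 - q0) + e k.
    by congr pair; rewrite /= ?e1 ?addr0.
  rewrite !zz /node /sigma; apply: coordE_inj => k.
  rewrite !(coordED, coordEZ, coordEB, coordEN) -natr1; field; exact: pR_neq0.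
rewrite !quad_avg /tavg mulrDr opprD !addrA; congr (_ - _ * _ - _ * _).
- by rewrite -mulrDr; congr (_ * _ + _); rewrite -!kins -!kinf kinE.
- by apply: eq_avg => m c _ _; rewrite zE.
- by apply: eq_avg => m c _ _; rewrite -zE.
Qed.

Definition critical_correction q0 q1 (e : nat -> E) : Prop :=
  admissible_correction e /\ forall m, (m <= p)%N -> e m = green (force q0 q1 e) m.

Section Ball.
Variables (c0 : E) (r B : R).
Hypotheses (r_gt0 : 0 < r) (B_ge0 : 0 <= B).
Hypothesis tameV : forall b, tame (pot b) c0 r B.
(* Smallness of the step: makes the correction map a contraction. *)
Hypothesis h_r : 8 * mass_bound Ms Mf * B * h ^+ 2 <= r / 4.
Hypothesis h_half : 8 * mass_bound Ms Mf * B * h ^+ 2 <= 2^-1.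

Implicit Types (q : E) (e : nat -> E).

Let r4_r2 : r / 4 <= r / 2. Proof. by have := r_gt0; lra. Qed.
Let r2_r : r / 2 <= r. Proof. by have := r_gt0; lra. Qed.

(** Half of the radius is reserved for the straight line and half for the correction, which keeps
    all nodes in the ball where [tame] holds. *)
Definition small q0 q1 e : Prop :=
  [/\ `|q0 - c0| <= r / 2, `|q1 - c0| <= r / 2 & forall m, (m <= p)%N -> `|e m| <= r / 2].

Lemma convex_norm (u v : E) (s M : R) : 0 <= s <= 1 -> `|u| <= M -> `|v| <= M ->
  `|(1 - s) *: u + s *: v| <= M.
Proof.
move=> /andP[s0 s1] uM vM; apply: le_trans (ler_normD _ _) _.
have s1' : 0 <= 1 - s by rewrite subr_ge0.
rewrite !normrZ (ger0_norm s1') (ger0_norm s0).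
by have := ler_wpM2l s1' uM; have := ler_wpM2l s0 vM; lra.
Qed.

Lemma node_ball q0 q1 e m (c : R) : small q0 q1 e -> (m < p)%N -> 0 <= c <= 1 ->
  `|node q0 q1 e m c - c0| <= r.
Proof.
move=> [q0r q1r er] mp c01; rewrite /node addrAC [leRHS]splitr.
apply: le_trans (ler_normD _ _) _; apply: lerD.
  by apply: norm_segment => //; exact: sigma_le.
by apply: convex_norm => //; apply: er => //; exact: ltnW.
Qed.

Lemma node_lip q0 q1 e q0' q1' e' (D : R) m (c : R) :
  (forall k, (k <= p)%N -> `|e' k - e k| <= D) -> (m < p)%N -> 0 <= c <= 1 ->
  `|node q0' q1' e' m c - node q0 q1 e m c| <= `|q0' - q0| + `|q1' - q1| + D.
Proof.
move=> eD mp c01; have /andP[s0 s1] := sigma_le mp c01; set s := sigma p m c in s0 s1.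
have -> : node q0' q1' e' m c - node q0 q1 e m c =
    ((1 - s) *: (q0' - q0) + s *: (q1' - q1)) +
    ((1 - c) *: (e' m - e m) + c *: (e' m.+1 - e m.+1)).
  apply: coordE_inj => k; rewrite !(coordED, coordEZ, coordEB, coordEN) -/s; ring.
apply: le_trans (ler_normD _ _) _; apply: lerD.
  apply: convex_norm; rewrite ?s0 ?s1 ?lerDl ?lerDr//.
by apply: convex_norm => //; apply: eD => //; exact: ltnW.
Qed.

Lemma force_norm q0 q1 e : small q0 q1 e -> forall b m (c : R), (m < p)%N -> 0 <= c <= 1 ->
  `|force q0 q1 e b m c| <= B.
Proof.
move=> sm b m c mp c01; have [] := tameV b (node_ball sm mp c01); exact.
Qed.

Lemma force_lip q0 q1 e q0' q1' e' (D : R) : small q0 q1 e -> small q0' q1' e' ->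
  (forall k, (k <= p)%N -> `|e' k - e k| <= D) ->
  forall b m (c : R), (m < p)%N -> 0 <= c <= 1 ->
  `|force q0' q1' e' b m c - force q0 q1 e b m c| <= B * (`|q0' - q0| + `|q1' - q1| + D).
Proof.
move=> sm sm' eD b m c mp c01.
have [_ _ /(_ _ (node_ball sm' mp c01))[_ L _]] := tameV b (node_ball sm mp c01).
by apply: le_trans L _; rewrite ler_wpM2l//; exact: node_lip.
Qed.

(** The factor 1/2 is [h_half]. Variation of the end points is included, so the same bound gives the
    contraction and the dependence of its fixed point on [q0] and [q1]. *)
Lemma green_force_lip q0 q1 e q0' q1' e' (D : R) : small q0 q1 e -> small q0' q1' e' ->
  (forall k, (k <= p)%N -> `|e' k - e k| <= D) -> forall m, (m <= p)%N ->
  `|green (force q0' q1' e') m - green (force q0 q1 e) m| <=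
  2^-1 * (`|q0' - q0| + `|q1' - q1| + D).
Proof.
move=> sm sm' eD m mp; rewrite -greenB.
have FL := force_lip sm sm' eD.
apply: le_trans (green_norm _ _ okW okV p_gt0 h_gt0 FL mp) _.
rewrite mulrA [leLHS]mulrAC ler_wpM2r//.
by rewrite addr_ge0 ?addr_ge0//; apply: le_trans (eD 0%N _).
Qed.

(** The fast values at the nodes 0 to [p] are stored as columns of a matrix because the fixed point
    is sought in a normed space with compact balls. *)
Definition seq_of_mx (X : 'M[R]_(nf, p.+1)) (m : nat) : E := (0, col (inord m) X).

Definition mx_of_seq (e : nat -> E) : 'M[R]_(nf, p.+1) := \matrix_(i, j) (e j).2 i 0.

Lemma mx_of_seqK e m : (e m).1 = 0 -> (m <= p)%N -> seq_of_mx (mx_of_seq e) m = e m.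
Proof.
move=> e1 mp; rewrite -[RHS](fast_id e1); congr pair.
by apply/matrixP => i j; rewrite !mxE inordK// ord1.
Qed.

Lemma seq_of_mx_norm X m : `|seq_of_mx X m| <= `|X|.
Proof.
apply/prod_norm_le; rewrite /= normr0; split => //.
by apply/mx_norm_le => // i j; rewrite mxE; exact: mx_entry_le.
Qed.

Lemma seq_of_mxB X Y m : seq_of_mx X m - seq_of_mx Y m = seq_of_mx (X - Y) m.
Proof. by congr pair; [exact: subrr|apply/matrixP => i j; rewrite !mxE]. Qed.

Lemma mx_of_seq_norm e (D : R) : (forall m, (m <= p)%N -> `|e m| <= D) ->
  `|mx_of_seq e| <= D.
Proof.
move=> eD; have D0 : 0 <= D by exact: le_trans (eD 0%N _).
apply/mx_norm_le => // i j; rewrite mxE.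
apply: le_trans (mx_entry_le _ _ _) _; apply: le_trans (eD j _).
  by have /prod_norm_le[] := lexx `|e j|.
by rewrite -ltnS.
Qed.

Lemma critical_correction_exists q0 q1 : `|q0 - c0| <= r / 2 -> `|q1 - c0| <= r / 2 ->
  exists e, critical_correction q0 q1 e /\ small q0 q1 e.
Proof.
move=> q0r q1r.
pose T X := mx_of_seq (green (force q0 q1 (seq_of_mx X))).
have sm X : `|X| <= r / 2 -> small q0 q1 (seq_of_mx X).
  by move=> Xr; split => // m _; apply: le_trans (seq_of_mx_norm _ _) Xr.
have [| |X Y /sm sX /sm sY|X /sm sX TX] :=
    @ball_contraction_fixpoint R _ T (r / 2) _ (@mx_closed_ball_compact R nf p.+1 (r / 2)).
- by rewrite divr_ge0// ltW.
- move=> X /sm sX; apply: mx_of_seq_norm => m mp; apply: (@le_trans _ _ (r / 4)); last exact: r4_r2.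
  apply: le_trans h_r.
  exact: (@green_norm R ns nf Ms Mf rW rV okW okV p h p_gt0 h_gt0 _ B (force_norm sX) m mp).
- rewrite (_ : T X - T Y = mx_of_seq (fun m => green (force q0 q1 (seq_of_mx X)) m -
     green (force q0 q1 (seq_of_mx Y)) m)); last by apply/matrixP => i j; rewrite !mxE.
  apply: mx_of_seq_norm => m mp.
  have eD k : (k <= p)%N -> `|seq_of_mx X k - seq_of_mx Y k| <= `|X - Y|.
    by move=> _; rewrite seq_of_mxB; exact: seq_of_mx_norm.
  apply: le_trans (green_force_lip sY sX eD mp) _.
  by rewrite [q0 - q0]subrr [q1 - q1]subrr normr0 !add0r.
have XE m : (m <= p)%N -> seq_of_mx X m = green (force q0 q1 (seq_of_mx X)) m.
  by move=> mp; rewrite -{1}TX mx_of_seqK// green1.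
exists (seq_of_mx X); split => //; split=> //; split=> //.
  by rewrite XE// green0.
by rewrite XE// greenp.
Qed.

Lemma critical_correction_norm q0 q1 e : critical_correction q0 q1 e -> small q0 q1 e ->
  forall m, (m <= p)%N -> `|e m| <= 8 * mass_bound Ms Mf * B * h ^+ 2.
Proof.
by move=> [_ eE] sm m mp; rewrite eE//; 
  exact: (@green_norm R ns nf Ms Mf rW rV okW okV p h p_gt0 h_gt0 _ B (force_norm sm) m mp).
Qed.

Lemma critical_correctionS_norm q0 q1 e : critical_correction q0 q1 e -> small q0 q1 e ->
  forall m, (m < p)%N -> `|e m.+1 - e m| <= 8 * mass_bound Ms Mf * B * h * dt.
Proof.
move=> [_ eE] sm m mp; rewrite eE// eE 1?ltnW//.
exact: (@greenS_norm R ns nf Ms Mf rW rV okW okV p h p_gt0 h_gt0 _ B (force_norm sm) m mp).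
Qed.

(** With [a] for the right-hand side, the largest distance [D] of the two corrections satisfies
    [D <= (a + D) / 2], hence [D <= a]. For equal end points this is uniqueness. *)
Lemma critical_correction_lip q0 q1 e q0' q1' e' : critical_correction q0 q1 e -> small q0 q1 e ->
  critical_correction q0' q1' e' -> small q0' q1' e' ->
  forall m, (m <= p)%N -> `|e' m - e m| <= `|q0' - q0| + `|q1' - q1|.
Proof.
move=> [[_ _ e1] eE] sm [[_ _ e1'] eE'] sm'.
pose D := `|mx_of_seq (fun m => e' m - e m)|.
have eD m : (m <= p)%N -> `|e' m - e m| <= D.
  move=> mp; rewrite -(@mx_of_seqK (fun m => e' m - e m) m)//; last first.
    by rewrite -[LHS]/((e' m).1 - (e m).1) e1 e1' subrr.
  exact: seq_of_mx_norm.
have DD : D <= 2^-1 * (`|q0' - q0| + `|q1' - q1| + D).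
  apply: mx_of_seq_norm => m mp; rewrite eE// eE'//.
  exact: green_force_lip.
by move=> m mp; apply: le_trans (eD m mp) _; lra.
Qed.

(* At a critical correction the inner variations do not contribute, so the derivatives
   of the discrete Lagrangian may be computed by moving all nodes affinely with the end
   points; this gives slow and fast variables the same weights [1 - sigma] and [sigma]. *)
Definition momentum0 q0 q1 e : E :=
  h^-1 *: mass (q1 - q0) + h *: tavg (fun b m c => (1 - sigma p m c) *: force q0 q1 e b m c).

Definition momentum1 q0 q1 e : E :=
  h^-1 *: mass (q1 - q0) - h *: tavg (fun b m c => sigma p m c *: force q0 q1 e b m c).

Lemma tavg_dot (f : bool -> nat -> R -> E) (d : E) :
  tavg (fun b m c => dotE (f b m c) d : R^o) = dotE (tavg f) d.
Proof.
rewrite (@tavg_linear R rW rV p E R^o (fun x => dotE x d))//.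
  by move=> u v; rewrite dotEDl.
by move=> a u; rewrite dotEZl.
Qed.

(** Used with fixed end points and an arbitrary inner variation, it shows criticality; used with the
    corrections of neighbouring end points, it gives the derivatives of the discrete Lagrangian. The
    constant may depend on [h] and [p], since it only serves to identify derivatives. *)
Lemma corrected_action_expansion q0 q1 e : critical_correction q0 q1 e -> small q0 q1 e ->
  exists C : R, forall q0' q1' e' (D : R), admissible_correction e' -> small q0' q1' e' ->
    (forall k, (k <= p)%N -> `|e' k - e k| <= D) ->
    `|corrected_action q0' q1' e' - corrected_action q0 q1 e -
      (dotE (- momentum0 q0 q1 e) (q0' - q0) + dotE (momentum1 q0 q1 e) (q1' - q1))|
    <= C * (`|q0' - q0| + `|q1' - q1| + D) ^+ 2.
Proof.
move=> [[e0 ep e1] eE] sm.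
pose kb := dimE * mass_bound Ms Mf.
(* The three terms stem from the energy of the macro increment, from [p] micro increments, each of
   size at most twice the total variation (whence 4), and from the Taylor remainders of the two
   potentials. *)
exists (h^-1 * kb + p%:R * dt^-1 * (4 * kb) + h * (2 * B)).
move=> q0' q1' e' D [e0' ep' e1'] sm' eD.
set N := `|q0' - q0| + `|q1' - q1| + D.
have D0 : 0 <= D by apply: le_trans (eD 0%N _).
have N0 : 0 <= N by rewrite !addr_ge0.
have kb0 : 0 <= kb by rewrite mulr_ge0 ?dimE_ge0 ?mass_bound_ge0.
pose d m := e' m - e m.
have dN m : (m <= p)%N -> `|d m| <= N.
  by move=> mp; apply: le_trans (eD m mp) _; rewrite /N lerDr addr_ge0.
have kinN (x : E) (a : R) : 0 <= a -> `|x| <= a * N -> `|kin x| <= kb * a ^+ 2 * N ^+ 2.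
  move=> a0 xN; apply: le_trans (kin_norm _ _ _) _; rewrite -/kb -mulrA ler_wpM2l//.
  by rewrite -exprMn lerXn2r ?nnegrE ?mulr_ge0.
pose x := (q1' - q1) - (q0' - q0).
pose rem b m c : R := pot b (node q0' q1' e' m c) - pot b (node q0 q1 e m c) -
  dotE (force q0 q1 e b m c) (node q0' q1' e' m c - node q0 q1 e m c).
have var := @green_variation R ns nf Ms Mf rW rV uS uF p h p_gt0 h_gt0 (force q0 q1 e) d.
have -> : corrected_action q0' q1' e' - corrected_action q0 q1 e -
      (dotE (- momentum0 q0 q1 e) (q0' - q0) + dotE (momentum1 q0 q1 e) (q1' - q1)) =
    h^-1 * kin x + \sum_(0 <= m < p) dt^-1 * kin (d m.+1 - d m) -
    h * tavg (fun b m c => rem b m c : R^o).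
  have kinx : kin (q1' - q0') = kin (q1 - q0) + dotE (mass (q1 - q0)) x + kin x.
    rewrite -kinD /x; congr kin; apply: coordE_inj => k.
    by rewrite !(coordED, coordEN); ring.
  (* By [green_variation] the cross terms of the micro kinetic energies equal the work of the forces
     along [d]; it cancels the last term of [sump]. *)
  have sumk : \sum_(0 <= m < p) dt^-1 * kin (e' m.+1 - e' m) =
      \sum_(0 <= m < p) dt^-1 * kin (e m.+1 - e m) +
      h * tavg (fun b m c => dotE (force q0 q1 e b m c) ((1 - c) *: d m + c *: d m.+1) : R^o) +
      \sum_(0 <= m < p) dt^-1 * kin (d m.+1 - d m).
    rewrite -var; last 3 first.
    - by rewrite /d e0 e0' subrr.
    - by rewrite /d ep ep' subrr.
    - by move=> m; rewrite -[LHS]/((e' m).1 - (e m).1) e1 e1' subrr.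
    rewrite -!big_split /=; apply: eq_big_nat => m /andP[_ mp].
    rewrite -!eE// ?(ltnW mp)// -!mulrDr -kinD; congr (_ * kin _).
    by apply: coordE_inj => k; rewrite /d !(coordED, coordEN); ring.
  have sump : tavg (fun b m c => rem b m c : R^o) =
      tavg (fun b m c => pot b (node q0' q1' e' m c) : R^o) -
      tavg (fun b m c => pot b (node q0 q1 e m c) : R^o) -
      (dotE (tavg (fun b m c => (1 - sigma p m c) *: force q0 q1 e b m c)) (q0' - q0) +
       dotE (tavg (fun b m c => sigma p m c *: force q0 q1 e b m c)) (q1' - q1) +
       tavg (fun b m c => dotE (force q0 q1 e b m c) ((1 - c) *: d m + c *: d m.+1) : R^o)).
    rewrite -!tavg_dot -!tavgD -!tavgB; apply: eq_tavg => b m c _ _.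
    rewrite /rem; congr (_ - _).
    rewrite !dotEZl -!dotEZr -!dotEDr; congr dotE.
    rewrite /node /d; apply: coordE_inj => k.
    by rewrite !(coordED, coordEZ, coordEN); ring.
  rewrite /corrected_action kinx sumk sump /momentum0 /momentum1.
  set A0 := tavg (fun b m c => (1 - sigma p m c) *: _).
  set A1 := tavg (fun b m c => sigma p m c *: _).
  set t1 := tavg _; set t2 := tavg _; set t3 := tavg _.
  set s1 := \sum_(0 <= m < p) _; set s2 := \sum_(0 <= m < p) _.
  set k1 := kin _; set k2 := kin _; set M := mass _.
  rewrite /x; move: (q0' - q0) (q1' - q1) => d0 d1.
  clearbody A0 A1 t1 t2 t3 s1 s2 k1 k2 M.
  by rewrite dotENl dotEDl dotEBl !dotEZl dotEBr; ring.
apply: le_trans (ler_normB _ _) _; rewrite mulrDl; apply: lerD; last first.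
  rewrite normrM (gtr0_norm h_gt0) -!mulrA ler_wpM2l ?(ltW h_gt0)//.
  apply: tavg_norm => // b m c mp c01.
  have [_ _ /(_ _ (node_ball sm' mp c01))[L _ _]] := tameV b (node_ball sm mp c01).
  apply: le_trans L _; rewrite ler_wpM2l//.
  by rewrite lerXn2r ?nnegrE//; exact: node_lip.
apply: le_trans (ler_normD _ _) _; rewrite mulrDl; apply: lerD.
  rewrite normrM gtr0_norm ?invr_gt0// -mulrA ler_wpM2l ?invr_ge0 ?(ltW h_gt0)//.
  have := @kinN x 1 ler01; rewrite expr1n mulr1 mul1r; apply.
  by apply: le_trans (ler_normB _ _) _; rewrite /N; lra.
apply: le_trans (ler_norm_sum _ _ _) _.
have -> : p%:R * dt^-1 * (4 * kb) * N ^+ 2 =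
    \sum_(0 <= m < p) dt^-1 * (4 * kb * N ^+ 2).
  by rewrite sumr_const_nat subn0 -[RHS]mulr_natl; ring.
apply: ler_sum_nat => m /= mp.
rewrite normrM gtr0_norm ?invr_gt0// ler_wpM2l ?invr_ge0 ?(ltW dt_gt0)//.
have -> : 4 * kb * N ^+ 2 = kb * 2 ^+ 2 * N ^+ 2 by ring.
apply: kinN => //; apply: le_trans (ler_normB _ _) _.
by have := dN m.+1 mp; have := dN m (ltnW mp); lra.
Qed.

Hypothesis ballQ : forall x, `|x - c0| <= r -> Q_multi Qs Qf x.

Notation Ldm := (Ld_micro Ms Mf V W rW rV p h).

Lemma corrected_path_critical q0 q1 e : critical_correction q0 q1 e -> small q0 q1 e ->
  discrete_critical Qs Qf Ms Mf V W rW rV p h q0 q1 (corrected_path q0 q1 e).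
Proof.
move=> ce sm; have [[e0 ep e1] eE] := ce; have [q0r q1r er] := sm.
split.
  split.
  - by rewrite /corrected_path mul0r scale0r addr0 e0 addr0.
  - by rewrite /corrected_path divff// scale1r ep addr0 subrKC.
  - move=> s s01; have := @norm_segment _ _ _ c0 q0 q1 (r / 2) s s01 q0r q1r.
    by move=> H; have [] := ballQ (le_trans H r2_r).
  (* A point of the piecewise linear fast trajectory is the fast part of a [node] with [c = s], and
     nodes stay in the ball. *)
  - move=> m s mp s01; have [_] := ballQ (node_ball sm mp s01).
    rewrite /= /corrected_path /sigma; congr (Qf _).
    apply/matrixP => i j; rewrite !mxE -natr1; field; exact: pR_neq0.
move=> d d0 dp.
have [C HC] := corrected_action_expansion ce sm.
pose ed (t : R) m : E := e m + t *: (0, d m).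
have edE (t : R) : Ldm q0.1 q1.1 (fun m => corrected_path q0 q1 e m + t *: d m) =
    corrected_action q0 q1 (ed t).
  rewrite -Ld_micro_corrected.
    by congr Ld_micro; apply/funext => m; rewrite /corrected_path /ed /= addrA.
  split; rewrite /ed.
  - by rewrite e0 d0 scaler0 addr0.
  - by rewrite ep dp scaler0 addr0.
  - by move=> m; rewrite /= e1 scaler0 addr0.
pose D := \sum_(0 <= m < p.+1) `|(0, d m) : E|.
have dD m : (m <= p)%N -> `|(0, d m) : E| <= D.
  move=> mp; rewrite /D (bigD1_seq m) ?iota_uniq//= ?lerDl ?sumr_ge0//.
  by rewrite mem_index_iota ltnS mp.
have D0 : 0 <= D by apply: le_trans (dD 0%N _).
(* For such [t] the variation takes at most [r / 4], and by [h_r] the correction takes at most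
   another [r / 4], so the sum is still [small]. Adding 1 avoids division by zero. *)
have rD : 0 < r / 4 / (D + 1) by rewrite !divr_gt0// ltr_wpDl.
apply: (@quadratic_remainder_is_derive _ _ 0 (r / 4 / (D + 1)) (C * D ^+ 2) rD) => t tr.
rewrite !edE mul0r subr0.
have ed0 : ed 0 = e by apply/funext => m; rewrite /ed scale0r addr0.
rewrite ed0.
have tD : `|t| * D <= r / 4.
  have : `|t| * (D + 1) <= r / 4 by rewrite -ler_pdivlMr// ltr_wpDl.
  have := normr_ge0 t; lra.
have dirt : admissible_correction (ed t).
  split; rewrite /ed.
  - by rewrite e0 d0 scaler0 addr0.
  - by rewrite ep dp scaler0 addr0.
  - by move=> m; rewrite /= e1 scaler0 addr0.
have edD m : (m <= p)%N -> `|ed t m - e m| <= `|t| * D.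
  by move=> mp; rewrite /ed addrC addKr normrZ ler_wpM2l// dD.
have smt : small q0 q1 (ed t).
  split => // m mp; rewrite -[ed t m](subrK (e m)); apply: le_trans (ler_normD _ _) _.
  have := critical_correction_norm ce sm mp; have := edD m mp; have := h_r; lra.
have := HC q0 q1 (ed t) (`|t| * D) dirt smt edD.
rewrite [q0 - q0]subrr [q1 - q1]subrr !dotE0r addr0 subr0 normr0 !add0r exprMn.
by rewrite real_normK ?num_real// mulrCA mulrC.
Qed.

Hypothesis crit_min : forall q0 q1, `|q0 - c0| <= r / 2 -> `|q1 - c0| <= r / 2 ->
  forall y, discrete_critical Qs Qf Ms Mf V W rW rV p h q0 q1 y ->
    discrete_unique_minimiser Qs Qf Ms Mf V W rW rV p h q0 q1 y.

Notation Ld := (Ld_multi Qs Qf Ms Mf V W rW rV p h).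

(** [xget] selects some critical value. Any two critical paths minimise, so their values bound each
    other. *)
Lemma Ld_multi_corrected q0 q1 e : critical_correction q0 q1 e -> small q0 q1 e ->
  Ld q0 q1 = corrected_action q0 q1 e.
Proof.
move=> ce sm; have cy := corrected_path_critical ce sm; have [q0r q1r _] := sm.
rewrite -Ld_micro_corrected /Ld_multi; last by case: ce.
have [|y' cy' ->] := @xgetPex _ 0 [set a | exists2 y,
   discrete_critical Qs Qf Ms Mf V W rW rV p h q0 q1 y & a = Ldm q0.1 q1.1 y].
  by exists (Ldm q0.1 q1.1 (corrected_path q0 q1 e)); exists (corrected_path q0 q1 e).
apply/eqP; rewrite eq_le.
have [H1 _] := crit_min q0r q1r cy' cy.1.
by have [-> _] := crit_min q0r q1r cy cy'.1; rewrite H1.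
Qed.

(** Moving one end point by [d] moves the correction by at most the norm of [d], so the expansion
    has remainder [C] times the square of twice that norm, whence [C * 4]. *)
Lemma Ld_multi_diff q0 q1 e : critical_correction q0 q1 e -> small q0 q1 e ->
  `|q0 - c0| <= r / 4 -> `|q1 - c0| <= r / 4 ->
  [/\ differentiable (Ld ^~ q1) q0, differentiable (Ld q0) q1,
      grad (Ld ^~ q1) q0 = - momentum0 q0 q1 e & grad (Ld q0) q1 = momentum1 q0 q1 e].
Proof.
move=> ce sm q0r q1r; have r4 : 0 < r / 4 by rewrite divr_gt0.
have [C HC] := corrected_action_expansion ce sm.
have add_ball (q d : E) : `|q - c0| <= r / 4 -> `|d| <= r / 4 -> `|q + d - c0| <= r / 2.
  move=> qr dr; rewrite addrAC; apply: le_trans (ler_normD _ _) _; lra.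
have [|D0 g0 _] := @quadratic_remainder_diff _ _ _ (Ld ^~ q1) q0 (- momentum0 q0 q1 e)
    (r / 4) (C * 4) r4.
  move=> d dr; have [_ q1r2 _] := sm.
  have [e' [ce' sm']] := critical_correction_exists (add_ball _ _ q0r dr) q1r2.
  rewrite (Ld_multi_corrected ce sm) (Ld_multi_corrected ce' sm').
  have eD k : (k <= p)%N -> `|e' k - e k| <= `|d|.
    move=> kp; apply: le_trans (critical_correction_lip ce sm ce' sm' kp) _.
    by rewrite [q1 - q1]subrr normr0 addr0 [q0 + d]addrC addrK.
  have := HC (q0 + d) q1 e' `|d| ce'.1 sm' eD.
  rewrite [q1 - q1]subrr dotE0r normr0 !addr0 [q0 + d - q0]addrAC subrr add0r.
  by move=> H; apply: le_trans H _; rewrite le_eqVlt; apply/orP; left; apply/eqP; ring.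
have [|D1 g1 _] := @quadratic_remainder_diff _ _ _ (Ld q0) q1 (momentum1 q0 q1 e)
    (r / 4) (C * 4) r4.
  move=> d dr; have [q0r2 _ _] := sm.
  have [e' [ce' sm']] := critical_correction_exists q0r2 (add_ball _ _ q1r dr).
  rewrite (Ld_multi_corrected ce sm) (Ld_multi_corrected ce' sm').
  have eD k : (k <= p)%N -> `|e' k - e k| <= `|d|.
    move=> kp; apply: le_trans (critical_correction_lip ce sm ce' sm' kp) _.
    by rewrite [q0 - q0]subrr normr0 add0r [q1 + d]addrC addrK.
  have := HC q0 (q1 + d) e' `|d| ce'.1 sm' eD.
  rewrite [q0 - q0]subrr dotE0r normr0 !add0r [q1 + d - q1]addrAC subrr add0r.
  by move=> H; apply: le_trans H _; rewrite le_eqVlt; apply/orP; left; apply/eqP; ring.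
by split.
Qed.

(** * The scheme as a fixed-point problem for the end point *)

Notation mb := (mass_bound Ms Mf).
Notation start_impulse q1 e :=
  (tavg (fun b m c => (1 - sigma p m c) *: force c0 q1 e b m c)).

Lemma momentum0P q1 e p0 : momentum0 c0 q1 e = p0 <->
  q1 - c0 = h *: mass_inv (p0 - h *: start_impulse q1 e).
Proof.
rewrite /momentum0; set x := start_impulse _ _; split=> [<-|->].
  by rewrite addrK mass_invZ massK// scalerA divff// scale1r.
by rewrite massZ mass_invK// scalerA mulVf// scale1r subrK.
Qed.

Lemma start_impulse_norm q1 e : small c0 q1 e -> `|start_impulse q1 e| <= 2 * B.
Proof.
move=> sm; apply: tavg_norm => // b m c mp c01.
have /andP[s0 s1] := sigma_le mp c01.
rewrite normrZ ger0_norm ?subr_ge0//; apply: le_trans (force_norm sm b mp c01).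
by rewrite ler_piMl//; lra.
Qed.

Lemma start_impulse_lip q1 e q1' e' : critical_correction c0 q1 e -> small c0 q1 e ->
  critical_correction c0 q1' e' -> small c0 q1' e' ->
  `|start_impulse q1' e' - start_impulse q1 e| <= 4 * B * `|q1' - q1|.
Proof.
move=> ce sm ce' sm'; rewrite -tavgB.
have -> : 4 * B * `|q1' - q1| = 2 * (B * (`|c0 - c0| + `|q1' - q1| + `|q1' - q1|)).
  by rewrite subrr normr0; ring.
apply: tavg_norm => // b m c mp c01.
have /andP[s0 s1] := sigma_le mp c01.
rewrite -scalerBr normrZ ger0_norm ?subr_ge0//.
have eD k : (k <= p)%N -> `|e' k - e k| <= `|q1' - q1|.
  by move=> kp; have := critical_correction_lip ce sm ce' sm' kp; rewrite subrr normr0 add0r.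
apply: le_trans (force_lip sm sm' eD b mp c01).
by rewrite ler_piMl//; lra.
Qed.

Lemma scheme_step_momentum q1 e p0 p1 : critical_correction c0 q1 e -> small c0 q1 e ->
  `|q1 - c0| <= r / 4 ->
  scheme_step (Ld_multi Qs Qf Ms Mf V W rW rV p) h (c0, p0) (q1, p1) <->
  momentum0 c0 q1 e = p0 /\ p1 = momentum1 c0 q1 e.
Proof.
move=> ce sm q1r; have r4 : `|c0 - c0| <= r / 4 by rewrite subrr normr0 divr_ge0// ltW.
have [D0 D1 g0 g1] := Ld_multi_diff ce sm r4 q1r.
split=> [[_ _ /= -> ->]|[<- ->]]; first by rewrite g0 g1 opprK.
by split; rewrite //= ?g0 ?g1 ?opprK.
Qed.

(** The fixed point is found in the ball of radius [r / 8], while the contraction estimate holds up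
    to [r / 2]. This leaves room for uniqueness among all solutions at distance less than
    [r / 4]. *)
Lemma scheme_solution p0 : mb * h * (`|p0| + 2 * B * h) <= r / 8 ->
  exists q1 e, [/\ critical_correction c0 q1 e, small c0 q1 e, `|q1 - c0| <= r / 8,
    momentum0 c0 q1 e = p0 &
    scheme_step (Ld_multi Qs Qf Ms Mf V W rW rV p) h (c0, p0) (q1, momentum1 c0 q1 e) /\
    forall z, `|z.1 - c0| < r / 4 ->
      scheme_step (Ld_multi Qs Qf Ms Mf V W rW rV p) h (c0, p0) z ->
      z = (q1, momentum1 c0 q1 e)].
Proof.
move=> p0r; have r0 := r_gt0.
(* A total choice of corrections is needed to define [T]; outside the ball its value is
   unconstrained. *)
have ecE q1 : exists e, `|q1 - c0| <= r / 2 -> critical_correction c0 q1 e /\ small c0 q1 e.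
  have [q1r|q1r] := boolP (`|q1 - c0| <= r / 2); last first.
    by exists (fun=> 0) => H; case/negP: q1r.
  have [|e eP] := @critical_correction_exists c0 q1 _ q1r; last by exists e.
  by rewrite subrr normr0; lra.
have [ec ecP] := choice ecE.
pose T d := h *: mass_inv (p0 - h *: start_impulse (c0 + d) (ec (c0 + d))).
have inr d : `|d| <= r / 2 -> `|c0 + d - c0| <= r / 2 by rewrite addrC addKr.
have mb0 : 0 <= mb by exact: mass_bound_ge0.
have Tlip x y : `|x| <= r / 2 -> `|y| <= r / 2 -> `|T x - T y| <= 2^-1 * `|x - y|.
  move=> /inr/ecP[cx sx] /inr/ecP[cy sy].
  rewrite /T -scalerBr -mass_invB normrZ gtr0_norm//.
  rewrite opprB addrC addrA subrK -scalerBr.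
  have := mass_inv_norm Ms Mf (h *: start_impulse (c0 + y) (ec (c0 + y)) -
     h *: start_impulse (c0 + x) (ec (c0 + x))).
  rewrite -scalerBr normrZ gtr0_norm// => H.
  have := start_impulse_lip cx sx cy sy.
  have -> : c0 + y - (c0 + x) = y - x by rewrite opprD addrACA subrr add0r.
  rewrite [`|y - x|]distrC => L.
  apply: le_trans (ler_wpM2l (ltW h_gt0) H) _.
  apply: (@le_trans _ _ (h * (mb * (h * (4 * B * `|x - y|))))).
    by rewrite !ler_wpM2l ?(ltW h_gt0).
  (* The constant is half of the quantity bounded in [h_half], hence at most 1/4. *)
  have -> : h * (mb * (h * (4 * B * `|x - y|))) = (2^-1 * (8 * mb * B * h ^+ 2)) * `|x - y| by field.
  by rewrite ler_wpM2r//; have := h_half; lra.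
have TB d : `|d| <= r / 8 -> `|T d| <= r / 8.
  move=> dr; have /inr/ecP[_ sd] : `|d| <= r / 2 by lra.
  apply: le_trans p0r; rewrite /T normrZ gtr0_norm//.
  have -> : mb * h * (`|p0| + 2 * B * h) = h * (mb * (`|p0| + 2 * B * h)) by ring.
  rewrite ler_wpM2l ?(ltW h_gt0)//; apply: le_trans (mass_inv_norm _ _ _) _.
  rewrite ler_wpM2l//; apply: le_trans (ler_normB _ _) _; rewrite lerD2l normrZ gtr0_norm//.
  by rewrite mulrC ler_wpM2r ?(ltW h_gt0)//; exact: start_impulse_norm.
have [| |d dr Td] := @ball_contraction_fixpoint R _ T (r / 8) _ (@closed_ball_compactE R ns nf (r / 8)) TB.
- lra.
- by move=> x y xr yr; apply: Tlip; lra.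
have /inr/ecP[cd sd] : `|d| <= r / 2 by lra.
have dE : c0 + d - c0 = d by rewrite addrC addKr.
have d4 : `|c0 + d - c0| <= r / 4 by rewrite dE; lra.
have m0 : momentum0 c0 (c0 + d) (ec (c0 + d)) = p0.
  by apply/momentum0P; rewrite dE -[LHS]Td.
exists (c0 + d), (ec (c0 + d)); split => //; first by rewrite dE.
split; first by apply/(scheme_step_momentum _ _ cd sd d4).
move=> [q1 p1] /= q1r st.
have q1r2 : `|q1 - c0| <= r / 2 by lra.
have [c1 s1] := ecP _ q1r2.
have [m1 ->] := (scheme_step_momentum p0 p1 c1 s1 (ltW q1r)).1 st.
have T1 : T (q1 - c0) = q1 - c0 by rewrite /T subrKC; symmetry; apply/momentum0P.
have : `|q1 - c0 - d| <= 2^-1 * `|q1 - c0 - d|.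
  by rewrite -{1}T1 -{1}Td; apply: Tlip => //; lra.
have := normr_ge0 (q1 - c0 - d) => n0 n1.
have /eqP : `|q1 - c0 - d| = 0 by lra.
rewrite normr_eq0 subr_eq0 => /eqP q1d.
have -> : q1 = c0 + d by rewrite -q1d subrKC.
by [].
Qed.

(** * Taylor expansions of the scheme and of the discrete action *)

Section Taylor.
Variables (q1 : E) (e : nat -> E) (v : E) (C Mv : R).
Hypotheses (ce : critical_correction c0 q1 e) (sm : small c0 q1 e).
Hypotheses (h_le1 : h <= 1) (vM : `|v| <= Mv) (C_ge0 : 0 <= C).
Hypothesis q1v : `|q1 - c0 - h *: v| <= C * h ^+ 2.

(** Indicator of the nonsymmetric case, by which both cases of the estimate are treated in one
    computation. *)
Definition asym : R := if rule_symmetric rV && rule_symmetric rW then 0 else 1.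

(* Factor of the difference of the first-order moments of the rule and the integral. *)
Definition skew (b : bool) : R := (rule_mean (if b then rV else rW) - 2^-1) / p%:R.

Lemma asym_ge0 : 0 <= asym. Proof. by rewrite /asym; case: ifP. Qed.

Lemma skew_le b : `|skew b| <= asym / p%:R.
Proof.
rewrite /skew normrM normfV (gtr0_norm pR_gt0) ler_wpM2r ?invr_ge0 ?(ltW pR_gt0)//.
rewrite /asym; case: (boolP (rule_symmetric rV && rule_symmetric rW)) => [/andP[sV sW]|_].
  by case: b; rewrite rule_symmetricP// subrr normr0.
have /andP[] : 0 <= rule_mean (if b then rV else rW) <= 1.
  by case: b; exact: rule_mean_ge0.
by move=> ? ?; rewrite ler_norml; apply/andP; split; lra.
Qed.

(** [N0] bounds, at order [h^2], the deviation of a node from [c0 + sigma h v]: [C] comes from the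
    end point, the other term from the correction. [N1] bounds the distance to [c0] at order [h]. *)
Let N0 := C + 8 * mb * B.
Let N1 := Mv + N0.
Let mb_ge0 : 0 <= mb. Proof. exact: mass_bound_ge0. Qed.
Let Mv_ge0 : 0 <= Mv. Proof. exact: le_trans vM. Qed.
Let N0_ge0 : 0 <= N0. Proof. by rewrite addr_ge0// !mulr_ge0. Qed.
Let N1_ge0 : 0 <= N1. Proof. by rewrite addr_ge0. Qed.
Let h_ge0 : 0 <= h. Proof. exact: ltW. Qed.

Lemma node_taylor m (c : R) : (m < p)%N -> 0 <= c <= 1 ->
  `|node c0 q1 e m c - c0 - (sigma p m c * h) *: v| <= N0 * h ^+ 2.
Proof.
move=> mp c01; have /andP[s0 s1] := sigma_le mp c01.
have -> : node c0 q1 e m c - c0 - (sigma p m c * h) *: v =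
    sigma p m c *: (q1 - c0 - h *: v) + ((1 - c) *: e m + c *: e m.+1).
  by apply: coordE_inj => k; rewrite !(coordED, coordEZ, coordEN); ring.
apply: le_trans (ler_normD _ _) _; rewrite mulrDl; apply: lerD.
  rewrite normrZ ger0_norm//; apply: le_trans q1v.
  by rewrite ler_piMl.
by apply: convex_norm => //; apply: (critical_correction_norm ce sm) => //; exact: ltnW.
Qed.

Lemma node_dist m (c : R) : (m < p)%N -> 0 <= c <= 1 -> `|node c0 q1 e m c - c0| <= N1 * h.
Proof.
move=> mp c01; have /andP[s0 s1] := sigma_le mp c01.
rewrite -[node c0 q1 e m c - c0](subrK ((sigma p m c * h) *: v)).
apply: le_trans (ler_normD _ _) _; rewrite addrC mulrDl; apply: lerD.
  have sh0 : 0 <= sigma p m c * h by rewrite mulr_ge0.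
  rewrite normrZ (ger0_norm sh0); apply: (@le_trans _ _ (h * `|v|)).
    by rewrite ler_wpM2r// ler_piMl.
  by rewrite mulrC ler_wpM2r.
apply: le_trans (node_taylor mp c01) _; rewrite expr2 mulrA ler_wpM2r//.
by rewrite ler_piMr.
Qed.

Let center_ball : `|c0 - c0| <= r. Proof. by rewrite subrr normr0 ltW. Qed.

Lemma force_taylor0 b m (c : R) : (m < p)%N -> 0 <= c <= 1 ->
  `|force c0 q1 e b m c - grad (pot b) c0| <= B * N1 * h.
Proof.
move=> mp c01; have [_ _ /(_ _ (node_ball sm mp c01))[_ L _]] := tameV b center_ball.
by apply: le_trans L _; rewrite -mulrA ler_wpM2l//; exact: node_dist.
Qed.

Lemma node_dist_sqr m (c : R) : (m < p)%N -> 0 <= c <= 1 ->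
  `|node c0 q1 e m c - c0| ^+ 2 <= N1 ^+ 2 * h ^+ 2.
Proof.
by move=> mp c01; rewrite -exprMn lerXn2r ?nnegrE ?mulr_ge0//; exact: node_dist.
Qed.

Lemma force_taylor1 b m (c : R) : (m < p)%N -> 0 <= c <= 1 ->
  `|force c0 q1 e b m c - grad (pot b) c0 - (sigma p m c * h) *: hess (pot b) c0 v| <=
  B * (N1 ^+ 2 + N0) * h ^+ 2.
Proof.
move=> mp c01; have [_ H /(_ _ (node_ball sm mp c01))[_ _ L]] := tameV b center_ball.
set x := node c0 q1 e m c - c0; set y := (sigma p m c * h) *: v.
have -> : force c0 q1 e b m c - grad (pot b) c0 - (sigma p m c * h) *: hess (pot b) c0 v =
    (force c0 q1 e b m c - grad (pot b) c0 - hess (pot b) c0 x) + hess (pot b) c0 (x - y).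
  have -> : hess (pot b) c0 (x - y) = hess (pot b) c0 x - (sigma p m c * h) *: hess (pot b) c0 v.
    by rewrite hessB hessZ.
  by rewrite addrA subrK.
apply: le_trans (ler_normD _ _) _; rewrite mulrDr mulrDl; apply: lerD.
  by apply: le_trans L _; rewrite -mulrA ler_wpM2l//; exact: node_dist_sqr.
by apply: le_trans (H _) _; rewrite -mulrA ler_wpM2l//; exact: node_taylor.
Qed.

Lemma pot_taylor b m (c : R) : (m < p)%N -> 0 <= c <= 1 ->
  `|pot b (node c0 q1 e m c) - pot b c0 - sigma p m c * (h * dotE (grad (pot b) c0) v)| <=
  B * (N1 ^+ 2 + dimE * N0) * h ^+ 2.
Proof.
move=> mp c01; have [G _ /(_ _ (node_ball sm mp c01))[L _ _]] := tameV b center_ball.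
set x := node c0 q1 e m c - c0; set y := (sigma p m c * h) *: v.
have -> : pot b (node c0 q1 e m c) - pot b c0 - sigma p m c * (h * dotE (grad (pot b) c0) v) =
    (pot b (node c0 q1 e m c) - pot b c0 - dotE (grad (pot b) c0) x) +
    dotE (grad (pot b) c0) (x - y).
  by rewrite (dotEBr x y) /y dotEZr; ring.
apply: le_trans (ler_normD _ _) _; rewrite mulrDr mulrDl; apply: lerD.
  by apply: le_trans L _; rewrite -mulrA ler_wpM2l//; exact: node_dist_sqr.
apply: le_trans (dotE_norm _ _) _.
have -> : B * (dimE * N0) * h ^+ 2 = dimE * (B * (N0 * h ^+ 2)) by ring.
by rewrite ler_wpM2l ?dimE_ge0//; apply: ler_pM => //; exact: node_taylor.
Qed.

Notation g b := (grad (pot b) c0).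
Notation G := (g true + g false).
Notation Hv := (hess (pot true) c0 v + hess (pot false) c0 v).

Lemma tavg_sigmaZ (U : lmodType R) (u : bool -> U) :
  tavg (fun b m c => sigma p m c *: u b) =
  2^-1 *: (u true + u false) + (skew true *: u true + skew false *: u false).
Proof. by rewrite /tavg /= !avg_sigmaZ// !scalerDl addrACA -scalerDr. Qed.

Lemma tavg_cst (U : lmodType R) (u : bool -> U) :
  tavg (fun b m c => u b) = u true + u false.
Proof. by rewrite /tavg /= !avg_cst. Qed.

Lemma skew_norm (U : normedModType R) (u : bool -> U) (M : R) :
  (forall b, `|u b| <= M) ->
  `|skew true *: u true + skew false *: u false| <= 2 * M * (asym / p%:R).
Proof.
move=> uM; apply: le_trans (ler_normD _ _) _; rewrite (normrZ (skew true)) (normrZ (skew false)).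
have H b : `|skew b| * `|u b| <= asym / p%:R * M by apply: ler_pM => //; exact: skew_le.
by have := H true; have := H false; lra.
Qed.

Let gB b : `|g b| <= B. Proof. by have [] := tameV b center_ball. Qed.

(** The weights [1 - sigma] average to [1/2 - skew]. Order zero of the forces suffices, because this
    mean enters [q1] with the factor [h^2]. *)
Lemma start_impulse_taylor :
  `|start_impulse q1 e - 2^-1 *: G| <= 2 * (B * N1 * h) + 2 * B * (asym / p%:R).
Proof.
pose R0 b m c := (1 - sigma p m c) *: (force c0 q1 e b m c - g b).
have -> : start_impulse q1 e - 2^-1 *: G =
    tavg R0 - (skew true *: g true + skew false *: g false).
  have -> : start_impulse q1 e = tavg R0 +
      (tavg (fun b m c => g b) - tavg (fun b m c => sigma p m c *: g b)).
    rewrite -tavgB -tavgD; apply: eq_tavg => b m c _ _.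
    by apply: coordE_inj => k; rewrite !(coordED, coordEZ, coordEN); ring.
  rewrite tavg_cst tavg_sigmaZ.
  move: (tavg _) (skew _) (skew _) (g _) (g _) => x s t y z.
  by apply: coordE_inj => k; rewrite !(coordED, coordEZ, coordEN); field.
apply: le_trans (ler_normB _ _) _; apply: lerD.
  2: exact: (@skew_norm _ (fun b => g b) B gB).
apply: tavg_norm => // b m c mp c01; have /andP[s0 s1] := sigma_le mp c01.
rewrite /R0 normrZ ger0_norm ?subr_ge0//; apply: le_trans (force_taylor0 b mp c01).
by rewrite ler_piMl//; lra.
Qed.

(** Constants are averaged exactly by every rule; the skewness meets only the Hessian term and so
    carries an additional factor [h]. *)
Lemma total_force_taylor :
  `|tavg (force c0 q1 e) - G - (h / 2) *: Hv| <=
  2 * (B * (N1 ^+ 2 + N0) * h ^+ 2) + 2 * (h * (B * Mv)) * (asym / p%:R).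
Proof.
pose R1 b m c := force c0 q1 e b m c - g b - (sigma p m c * h) *: hess (pot b) c0 v.
pose u b := h *: hess (pot b) c0 v.
have -> : tavg (force c0 q1 e) - G - (h / 2) *: Hv =
    tavg R1 + (skew true *: u true + skew false *: u false).
  have -> : tavg (force c0 q1 e) = tavg R1 +
      (tavg (fun b m c => g b) + tavg (fun b m c => sigma p m c *: u b)).
    rewrite -!tavgD; apply: eq_tavg => b m c _ _.
    rewrite /R1 /u; move: (force _ _ _ _ _ _) (grad _ _) (hess _ _ _) => x y z.
    by apply: coordE_inj => k; rewrite !(coordED, coordEZ, coordEN); ring.
  rewrite tavg_cst tavg_sigmaZ /u.
  move: (tavg _) (skew _) (skew _) (g _) (g _) (hess _ _ _) (hess _ _ _) => x s t y z y' z'.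
  by apply: coordE_inj => k; rewrite !(coordED, coordEZ, coordEN); field.
apply: le_trans (ler_normD _ _) _; apply: lerD.
  by apply: tavg_norm => // b m c mp c01; exact: force_taylor1.
apply: skew_norm => b; rewrite /u normrZ gtr0_norm// ler_wpM2l//.
have [_ H _] := tameV b center_ball.
by apply: le_trans (H _) _; rewrite ler_wpM2l.
Qed.

Lemma pot_avg_taylor :
  `|tavg (fun b m c => pot b (node c0 q1 e m c) : R^o) - (pot true c0 + pot false c0) -
    h / 2 * dotE G v| <=
  2 * (B * (N1 ^+ 2 + dimE * N0) * h ^+ 2) + 2 * (h * (dimE * (B * Mv))) * (asym / p%:R).
Proof.
pose u b : R^o := h * dotE (g b) v.
pose R1 b m c : R^o := pot b (node c0 q1 e m c) - pot b c0 - sigma p m c * u b.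
have -> : tavg (fun b m c => pot b (node c0 q1 e m c) : R^o) - (pot true c0 + pot false c0) -
    h / 2 * dotE G v = tavg R1 + (skew true *: u true + skew false *: u false).
  have -> : tavg (fun b m c => pot b (node c0 q1 e m c) : R^o) = tavg R1 +
      (tavg (fun b m c => pot b c0 : R^o) + tavg (fun b m c => sigma p m c *: u b)).
    rewrite -!tavgD; apply: eq_tavg => b m c _ _.
    by rewrite /R1 scale_regE; ring.
  rewrite tavg_cst tavg_sigmaZ /u !scale_regE dotEDl.
  by move: (tavg _) (skew _) (skew _) (dotE _ _) (dotE _ _) => x s t y z; field.
apply: le_trans (ler_normD _ _) _; apply: lerD.
  by apply: tavg_norm => // b m c mp c01; exact: pot_taylor.
apply: skew_norm => b; rewrite /u normrM gtr0_norm// ler_wpM2l//.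
by apply: le_trans (dotE_norm _ _) _; rewrite ler_wpM2l ?dimE_ge0//; apply: ler_pM.
Qed.

End Taylor.
(** A form of the error in which the two sources, Taylor remainders and skewness, are still
    separate. *)
Definition step_error : R := h ^+ 3 + asym * (h ^+ 2 / p%:R).

Lemma step_error_ge (a b M : R) : 0 <= b -> a <= M -> b <= M -> h <= 1 ->
  a * h ^+ 3 + b * (h ^+ 2 * (asym / p%:R)) <= M * step_error.
Proof.
move=> b0 aM bM h1; rewrite mulrDr; apply: lerD.
  by rewrite ler_wpM2r// exprn_ge0// ltW.
have -> : asym * (h ^+ 2 / p%:R) = h ^+ 2 * (asym / p%:R) by ring.
rewrite ler_wpM2r// mulr_ge0 ?sqr_ge0// divr_ge0 ?asym_ge0//.
Qed.

Let mb_ge0 : 0 <= mb. Proof. exact: mass_bound_ge0. Qed.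
Let h_ge0 : 0 <= h. Proof. exact: ltW. Qed.

Notation G := (grad (pot true) c0 + grad (pot false) c0).

Lemma total_grad_center_norm : `|G| <= 2 * B.
Proof.
have cb : `|c0 - c0| <= r by rewrite subrr normr0 ltW.
apply: le_trans (ler_normD _ _) _.
by have [H1 _ _] := tameV true cb; have [H2 _ _] := tameV false cb; lra.
Qed.

Definition scheme_const (Mv : R) : R :=
  let N0 := 2 * mb * B + 8 * mb * B in let N1 := Mv + N0 in
  2 * mb * B * (N1 + 1) + 2 * B * (N1 ^+ 2 + N0) + 2 * B * Mv.

Lemma scheme_taylor q1 e p0 (Mv : R) : critical_correction c0 q1 e -> small c0 q1 e ->
  momentum0 c0 q1 e = p0 -> h <= 1 -> `|mass_inv p0| <= Mv ->
  `|q1 - (c0 + h *: mass_inv p0 - (h ^+ 2 / 2) *: mass_inv G)| <=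
    scheme_const Mv * step_error /\
  `|momentum1 c0 q1 e - (p0 - h *: G -
     (h ^+ 2 / 2) *: (hess (pot true) c0 (mass_inv p0) + hess (pot false) c0 (mass_inv p0)))| <=
    scheme_const Mv * step_error.
Proof.
move=> ce sm m0 h1 vM; set v := mass_inv p0 in vM *.
have Mv0 : 0 <= Mv by exact: le_trans vM.
have mB : 0 <= mb * B by rewrite mulr_ge0.
have C8 : 0 <= 8 * mb * B by rewrite !mulr_ge0.
have C0 : 0 <= 2 * mb * B by rewrite !mulr_ge0.
have q1E : q1 - c0 = h *: v - h ^+ 2 *: mass_inv (start_impulse q1 e).
  have /momentum0P -> := m0; rewrite mass_invB mass_invZ scalerBr scalerA expr2.
  by [].
have q1v : `|q1 - c0 - h *: v| <= 2 * mb * B * h ^+ 2.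
  rewrite q1E addrAC subrr add0r normrN normrZ ger0_norm ?sqr_ge0// mulrC.
  rewrite ler_wpM2r ?sqr_ge0//; apply: le_trans (mass_inv_norm _ _ _) _.
  by rewrite [2 * mb]mulrC -mulrA ler_wpM2l// start_impulse_norm.
have Kb : 0 <= (Mv + (2 * mb * B + 8 * mb * B)).
  by lra.
set N0 := 2 * mb * B + 8 * mb * B in Kb *; set N1 := Mv + N0 in Kb *.
have N00 : 0 <= N0 by rewrite /N0; lra.
have t1 : 0 <= 2 * mb * B * N1 by rewrite mulr_ge0.
have t2 : 0 <= 2 * B * (N1 ^+ 2 + N0) by rewrite !mulr_ge0 ?addr_ge0 ?sqr_ge0.
have t3 : 0 <= 2 * B * Mv by rewrite !mulr_ge0.
have KE : scheme_const Mv = 2 * mb * B * N1 + 2 * mb * B + 2 * B * (N1 ^+ 2 + N0) + 2 * B * Mv.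
  by rewrite /scheme_const -/N0 -/N1; ring.
split.
  have -> : q1 - (c0 + h *: v - (h ^+ 2 / 2) *: mass_inv G) =
      - (h ^+ 2 *: mass_inv (start_impulse q1 e - 2^-1 *: G)).
    have gen (a b c d : E) : a - (b + c - d) = a - b - c + d.
      by apply: coordE_inj => k; rewrite !(coordED, coordEN); ring.
    rewrite gen q1E mass_invB mass_invZ /v.
    move: (mass_inv p0) (mass_inv (start_impulse q1 e)) (mass_inv G) => z x y.
    by apply: coordE_inj => k; rewrite !(coordED, coordEZ, coordEN); field.
  rewrite normrN normrZ ger0_norm ?sqr_ge0//.
  have L := start_impulse_taylor ce sm h1 vM C0 q1v.
  apply: le_trans (ler_wpM2l (sqr_ge0 h) (mass_inv_norm Ms Mf _)) _.
  apply: le_trans (ler_wpM2l (sqr_ge0 h) (ler_wpM2l mb_ge0 L)) _.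
  rewrite -/N0 -/N1.
  have -> : h ^+ 2 * (mb * (2 * (B * N1 * h) + 2 * B * (asym / p%:R))) =
     (2 * mb * B * N1) * h ^+ 3 + (2 * mb * B) * (h ^+ 2 * (asym / p%:R)) by ring.
  by apply: step_error_ge; rewrite // KE; lra.
have -> : momentum1 c0 q1 e - (p0 - h *: G - (h ^+ 2 / 2) *: (hess (pot true) c0 v + hess (pot false) c0 v)) =
    - (h *: (tavg (force c0 q1 e) - G - (h / 2) *: (hess (pot true) c0 v + hess (pot false) c0 v))).
  (* The weights [1 - sigma] and [sigma] add up to one, so [p0 - p1] is [h] times the full average
     of the forces. *)
  have -> : tavg (force c0 q1 e) = start_impulse q1 e +
      tavg (fun b m c => sigma p m c *: force c0 q1 e b m c).
    rewrite -tavgD; apply: eq_tavg => b m c _ _.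
    by rewrite -scalerDl subrK scale1r.
  rewrite -m0 /momentum1 /momentum0.
  move: (hess _ _ _) (hess _ _ _) (grad _ _) (grad _ _) (start_impulse _ _) (tavg _) (mass _).
  move=> h1' h2' g1 g2 x y z.
  by apply: coordE_inj => k; rewrite !(coordED, coordEZ, coordEN); field.
rewrite normrN normrZ ger0_norm//.
have L := total_force_taylor ce sm h1 vM C0 q1v.
apply: le_trans (ler_wpM2l h_ge0 L) _; rewrite -/N0 -/N1.
have -> : h * (2 * (B * (N1 ^+ 2 + N0) * h ^+ 2) + 2 * (h * (B * Mv)) * (asym / p%:R)) =
   (2 * B * (N1 ^+ 2 + N0)) * h ^+ 3 + (2 * B * Mv) * (h ^+ 2 * (asym / p%:R)) by ring.
by apply: step_error_ge; rewrite // KE; lra.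
Qed.

Definition action_const (Mv C3 : R) : R :=
  let C := mb * B + C3 in let N0 := C + 8 * mb * B in let N1 := Mv + N0 in
  dimE * mb * Mv * C3 + dimE * mb * C ^+ 2 + dimE * mb * (8 * mb * B) ^+ 2 +
  2 * B * (N1 ^+ 2 + dimE * N0) + 2 * dimE * B * Mv.

(** The hypothesis on [q1] is the third-order expansion of the exact end point, where the two
    Lagrangians are compared. The kinetic and the potential part each contribute one half of the
    term in [dotE G v]. *)
Lemma corrected_action_taylor q1 e v (Mv C3 : R) : critical_correction c0 q1 e -> small c0 q1 e ->
  h <= 1 -> `|v| <= Mv -> 0 <= C3 ->
  `|q1 - c0 - h *: v + (h ^+ 2 / 2) *: mass_inv G| <= C3 * h ^+ 3 ->
  `|corrected_action c0 q1 e -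
    (h * kin v - h * (pot true c0 + pot false c0) - h ^+ 2 * dotE G v)| <=
  action_const Mv C3 * step_error.
Proof.
move=> ce sm h1 vM C30 q1v.
have Mv0 : 0 <= Mv by exact: le_trans vM.
have mB : 0 <= mb * B by rewrite mulr_ge0.
have d0 : 0 <= dimE := dimE_ge0.
have h3 : h ^+ 3 <= h ^+ 2 by rewrite exprS ler_piMl// sqr_ge0.
pose rho := q1 - c0 - h *: v; pose tau := rho + (h ^+ 2 / 2) *: mass_inv G.
set C := mb * B + C3; have C0 : 0 <= C by rewrite addr_ge0.
have Q1 : `|rho| <= C * h ^+ 2.
  have -> : rho = tau - (h ^+ 2 / 2) *: mass_inv G by rewrite /tau addrK.
  apply: le_trans (ler_normB _ _) _; rewrite /C mulrDl addrC; apply: lerD.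
    have h2 : 0 <= h ^+ 2 / 2 by rewrite divr_ge0// sqr_ge0.
    rewrite normrZ (ger0_norm h2).
    apply: le_trans (ler_wpM2l h2 (mass_inv_norm Ms Mf _)) _.
    apply: le_trans (ler_wpM2l h2 (ler_wpM2l mb_ge0 total_grad_center_norm)) _.
    by rewrite le_eqVlt; apply/orP; left; apply/eqP; field.
  by apply: le_trans q1v _; rewrite ler_wpM2l.
have L := pot_avg_taylor ce sm h1 vM C0 Q1.
set N0 := C + 8 * mb * B; set N1 := Mv + N0.
set tp := tavg (fun b m c => pot b (node c0 q1 e m c) : R^o) in L.
pose se := \sum_(0 <= m < p) dt^-1 * kin (e m.+1 - e m).
have kE : h^-1 * kin (q1 - c0) = h * kin v - h ^+ 2 / 2 * dotE G v +
    dotE (mass v) tau + h^-1 * kin rho.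
  have -> : q1 - c0 = h *: v + rho by rewrite /rho addrCA subrr addr0.
  rewrite kinD kinZ massZ dotEZl (_ : rho = tau - (h ^+ 2 / 2) *: mass_inv G); last by rewrite /tau addrK.
  rewrite dotEBr dotEZr [dotE (mass v) (mass_inv _)]mass_sym mass_invK//.
  by move: (kin _) (kin _) (dotE _ _) (dotE _ _) => x y z w; field.
have -> : corrected_action c0 q1 e -
    (h * kin v - h * (pot true c0 + pot false c0) - h ^+ 2 * dotE G v) =
    dotE (mass v) tau + h^-1 * kin rho + se -
    h * (tp - (pot true c0 + pot false c0) - h / 2 * dotE G v).
  rewrite /corrected_action kE -/se -/tp.
  by move: (kin _) (kin _) (dotE _ _) (dotE _ _) (pot _ _) (pot _ _) (se) (tp) => x y z w a b s t; field.
have n1 : `|dotE (mass v) tau| <= dimE * mb * Mv * C3 * h ^+ 3.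
  apply: le_trans (dotE_norm _ _) _; have -> : dimE * mb * Mv * C3 * h ^+ 3 = dimE * (mb * Mv * (C3 * h ^+ 3)) by ring.
  rewrite ler_wpM2l//; apply: ler_pM => //; apply: le_trans (mass_norm _ _ _) _.
  by rewrite ler_wpM2l.
have n2 : `|h^-1 * kin rho| <= dimE * mb * C ^+ 2 * h ^+ 3.
  rewrite normrM gtr0_norm ?invr_gt0// ler_pdivrMl//.
  apply: le_trans (kin_norm _ _ _) _.
  have -> : h * (dimE * mb * C ^+ 2 * h ^+ 3) = dimE * mb * (C * h ^+ 2) ^+ 2 by ring.
  by rewrite ler_wpM2l ?mulr_ge0// lerXn2r ?nnegrE ?mulr_ge0 ?sqr_ge0.
have n3 : `|se| <= dimE * mb * (8 * mb * B) ^+ 2 * h ^+ 3.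
  apply: le_trans (ler_norm_sum _ _ _) _.
  (* The sum has [p] terms of size [(h dt)^2 / dt], which together give [h^3] whatever [p] is. *)
  have -> : dimE * mb * (8 * mb * B) ^+ 2 * h ^+ 3 =
      \sum_(0 <= m < p) dt^-1 * (dimE * mb * (8 * mb * B * h * dt) ^+ 2).
    by rewrite sumr_const_nat subn0 -[RHS]mulr_natl; field; rewrite pR_neq0 h_neq0.
  apply: ler_sum_nat => m /= mp.
  rewrite normrM gtr0_norm ?invr_gt0// ler_wpM2l ?invr_ge0 ?(ltW dt_gt0)//.
  apply: le_trans (kin_norm _ _ _) _; rewrite ler_wpM2l ?mulr_ge0//.
  rewrite lerXn2r ?nnegrE ?mulr_ge0 ?(ltW dt_gt0)//.
  exact: (critical_correctionS_norm ce sm mp).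
have n4 := ler_wpM2l h_ge0 L.
have n5 : `|h * (tp - (pot true c0 + pot false c0) - h / 2 * dotE G v)| <=
   2 * B * (N1 ^+ 2 + dimE * N0) * h ^+ 3 + 2 * dimE * B * Mv * (h ^+ 2 * (asym / p%:R)).
  rewrite normrM ger0_norm//; apply: le_trans n4 _; rewrite -/N0 -/N1.
  by rewrite le_eqVlt; apply/orP; left; apply/eqP; ring.
have N00 : 0 <= N0 by rewrite addr_ge0// !mulr_ge0.
have k1 : 0 <= dimE * mb * Mv * C3 by rewrite !mulr_ge0.
have k2 : 0 <= dimE * mb * C ^+ 2 by rewrite !mulr_ge0 ?sqr_ge0.
have k3 : 0 <= dimE * mb * (8 * mb * B) ^+ 2 by rewrite !mulr_ge0 ?sqr_ge0.
have k4 : 0 <= 2 * B * (N1 ^+ 2 + dimE * N0) by rewrite !mulr_ge0// addr_ge0 ?sqr_ge0 ?mulr_ge0.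
have k5 : 0 <= 2 * dimE * B * Mv by rewrite !mulr_ge0.
apply: (@le_trans _ _ ((dimE * mb * Mv * C3 + dimE * mb * C ^+ 2 + dimE * mb * (8 * mb * B) ^+ 2 +
  2 * B * (N1 ^+ 2 + dimE * N0)) * h ^+ 3 + 2 * dimE * B * Mv * (h ^+ 2 * (asym / p%:R)))).
  apply: le_trans (ler_normB _ _) _.
  have := ler_normD (dotE (mass v) tau + h^-1 * kin rho) se.
  have := ler_normD (dotE (mass v) tau) (h^-1 * kin rho).
  lra.
by apply: step_error_ge; rewrite // /action_const -/C -/N0 -/N1; lra.
Qed.

End Ball.
End DiscreteCritical.

(** * The exact flow *)

Section Curves.
Context {R : realType} {ns nf : nat}.
Notation E := (config R ns nf).

Lemma is_derive_coordE (x : R -> E) (t : R) (dx : E) k : is_derive t 1 x dx ->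
  is_derive t 1 (fun s => coordE (x s) k) (coordE dx k).
Proof.
move=> [xd xv].
have lim : h^-1 *: ((x \o shift t) (h *: (1 : R)) - x t) @[h --> (0 : R)^'] --> dx.
  by rewrite -xv; exact: xd.
have lim2 : h^-1 *: (((fun s => coordE (x s) k) \o shift t) (h *: (1 : R)) - coordE (x t) k)
    @[h --> (0 : R)^'] --> (coordE dx k : R^o).
  apply/cvgrPdist_lt => e e0; move/cvgrPdist_lt : lim => /(_ e e0).
  apply: filterS => h; apply: le_lt_trans.
  have -> : coordE dx k - h^-1 *: (coordE ((x \o shift t) (h *: 1)) k - coordE (x t) k) =
      coordE (dx - h^-1 *: ((x \o shift t) (h *: 1) - x t)) k.
    by rewrite coordEB coordEZ coordEB.
  exact: coordE_norm.
by apply: DeriveDef; [exact: cvgP lim2|exact: cvg_lim lim2].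
Qed.

Lemma within_continuous_coordE (A : set R) (x : R -> E) k :
  {within A, continuous x} -> {within A, continuous (fun s => coordE (x s) k)}.
Proof.
move=> /within_continuous_epsP cx; apply/(@within_continuous_epsP R R^o R^o) => t At e e0.
have [d d0 xd] := cx t At e e0; exists d => // s As st.
by rewrite -coordEB; apply: le_lt_trans (coordE_norm _ _) (xd s As st).
Qed.

(** Mean value theorem for each coordinate of [x + t a + (t^2 / 2) b]. The intermediate times may
    differ between coordinates, which the maximum norm tolerates. *)
Lemma curve_quadratic_bound (x x' : R -> E) (a b : E) (T M : R) : 0 <= T ->
  {within `[0, T], continuous x} ->
  (forall t, 0 < t < T -> is_derive t 1 x (x' t)) ->
  (forall t, 0 < t < T -> `|x' t + a + t *: b| <= M) ->
  0 <= M -> `|x T - x 0 + T *: a + (T ^+ 2 / 2) *: b| <= M * T.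
Proof.
move=> T0 cx dx xM M0; apply/coordE_le => [|k]; first by rewrite mulr_ge0.
pose g : R -> R := (coordE a k \*: (@id R)) + ((coordE b k / 2) \*: ((@id R) ^+ 2)).
have gE s : g s = s * coordE a k + s ^+ 2 / 2 * coordE b k.
  by rewrite /g !fctE /= /GRing.scale /=; field.
have dg (t : R) : is_derive t 1 g (coordE a k + t * coordE b k).
  by apply: is_derive_eq; rewrite /GRing.scale /=; field.
pose f (s : R) : R := coordE (x s) k + g s.
have cf : {within `[0, T], continuous f}.
  apply/subspace_continuousP => s sT; apply: (@cvgD R R^o).
    by move/subspace_continuousP : (within_continuous_coordE (k:=k) cx); exact.
  apply: cvg_within_filter; apply: differentiable_continuous.
  by apply/derivable1_diffP; exact: ex_derive.
have df t : t \in `]0, T[%R -> is_derive t 1 f (coordE (x' t + a + t *: b) k).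
  rewrite in_itv /= => tT; have xk := is_derive_coordE k (dx t tT).
  rewrite !coordED coordEZ -addrA.
  exact: (is_deriveD xk (dg t)).
have -> : coordE (x T - x 0 + T *: a + (T ^+ 2 / 2) *: b) k = f T - f 0.
  by rewrite /f !gE !(coordED, coordEN, coordEZ); ring.
case: (ltrgtP 0 T) T0 => // [T0 _|<- _]; last by rewrite subrr normr0 mulr0.
have [c c0T ->] := MVT T0 df cf.
rewrite subr0 normrM (gtr0_norm T0) ler_wpM2r ?(ltW T0)//.
apply: le_trans (coordE_norm _ _) _; apply: xM.
by move: c0T; rewrite in_itv.
Qed.

Lemma within_continuous_linear_bounded (A : set R) (F : E -> E) (M : R) (x : R -> E) :
  0 <= M -> (forall u v, F (u - v) = F u - F v) -> (forall u, `|F u| <= M * `|u|) ->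
  {within A, continuous x} -> {within A, continuous (F \o x)}.
Proof.
move=> M0 FB FM /within_continuous_epsP cx; apply/within_continuous_epsP => t At e e0.
have M1 : 0 < M + 1 by rewrite ltr_wpDl.
have [|d d0 xd] := cx t At (e / (M + 1)); first exact: divr_gt0.
exists d => // s As st; rewrite /= -FB; apply: le_lt_trans (FM _) _.
apply: (@le_lt_trans _ _ ((M + 1) * `|x s - x t|)); first by rewrite ler_wpM2r// lerDl.
by rewrite -ltr_pdivlMl// mulrC; exact: xd.
Qed.

Lemma within_continuous_comp_at (A : set R) (x : R -> E) (f : E -> R) :
  {within A, continuous x} -> (forall t, A t -> {for x t, continuous f}) ->
  {within A, continuous (f \o x)}.
Proof.
move=> /subspace_continuousP cx cf; apply/subspace_continuousP => t At.
by apply: cvg_comp (cx t At) _; exact: cf.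
Qed.

End Curves.

Section Flow.
Context {R : realType} {ns nf : nat}.
Notation E := (config R ns nf).
Variables (Q : set E) (Ms : 'M[R]_ns) (Mf : 'M[R]_nf) (V : E -> R) (W : 'cV[R]_nf -> R).
Hypotheses (uS : sym_part Ms \in unitmx) (uF : sym_part Mf \in unitmx).
Notation L := (L_multi Ms Mf V W).
Notation mass := (mass Ms Mf).
Notation mass_inv := (mass_inv Ms Mf).
Notation kin := (kin Ms Mf).
Notation mb := (mass_bound Ms Mf).
Notation pot := (pot V W).
Notation dimE := (dimE (R := R) (ns := ns) (nf := nf)).

Definition total_grad (x : E) : E := grad (pot true) x + grad (pot false) x.

(* The common form of the Euler-Lagrange and of Hamilton's equations. *)
Definition newton_flow (h : R) (q pi : R -> E) : Prop :=
  [/\ {within `[0, h], continuous q}, {within `[0, h], continuous pi},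
      forall t, 0 <= t <= h -> Q (q t) &
      forall t, 0 < t < h -> is_derive t 1 q (mass_inv (pi t)) /\
                             is_derive t 1 pi (- total_grad (q t))].

Section Potential.
Hypothesis smoothp : forall b, smooth_on Q (pot b).

(** The plus sign serves Hamilton's equations, the minus sign the Euler-Lagrange equations; [a]
    stands for the kinetic energy. *)
Lemma grad_total (x : E) (a : R) : Q x ->
  grad (fun y => a + (V y + W y.2)) x = total_grad x /\
  grad (fun y => a - (V y + W y.2)) x = - total_grad x.
Proof.
move=> Qx; have [D1 D2] := ((smooth_on_C1 (smoothp true)) x Qx, (smooth_on_C1 (smoothp false)) x Qx).
have e1 : (fun y => a + (V y + W y.2)) = cst a + (pot true + pot false) by [].
have e2 : (fun y => a - (V y + W y.2)) = cst a - (pot true + pot false) by [].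
split; apply: coordE_inj => k; rewrite coordE_grad ?e1 ?e2.
  rewrite deriveD ?derive_cst ?add0r; last by apply: derivableD; [apply: (D1 _).1|apply: (D2 _).1].
    by rewrite deriveD ?coordED ?coordE_grad//; [apply: (D1 _).1|apply: (D2 _).1].
  exact: derivable_cst.
rewrite deriveB ?derive_cst ?sub0r; last by apply: derivableD; [apply: (D1 _).1|apply: (D2 _).1].
  by rewrite deriveD ?coordEN ?coordED ?coordE_grad//; [apply: (D1 _).1|apply: (D2 _).1].
exact: derivable_cst.
Qed.

Lemma EL_newton (h : R) (q v : R -> E) : EL_solution Q L h q v ->
  newton_flow h q (fun t => mass (v t)).
Proof.
move=> [[cq cv dq Qq] EL]; split => //.
  apply: (within_continuous_linear_bounded (mass_bound_ge0 Ms Mf) (massB Ms Mf)) => //.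
  exact: mass_norm.
move=> t th; split; first by rewrite massK//; exact: dq.
have := EL t th.
have -> : (fun s => grad (L (q s)) (v s)) = (fun s => mass (v s)).
  by apply/funext => s; exact: (L_multi_velocity Ms Mf V W (q s) (v s)).1.
have -> : (fun a => L a (v t)) = (fun y => kin (v t) - (V y + W y.2)).
  by apply/funext => y; rewrite L_multiE.
have tQ : Q (q t) by apply: Qq; case/andP: th => t0 t1; rewrite !ltW.
by rewrite (grad_total (kin (v t)) tQ).2.
Qed.

Lemma legendre_invE (q pi : E) : legendre_inv L q pi = mass_inv pi.
Proof.
rewrite /legendre_inv; have gE v : grad (L q) v = mass v.
  exact: (L_multi_velocity Ms Mf V W q v).1.
have /(xgetPex 0) /= : exists v, [set v | grad (L q) v = pi] v.
  by exists (mass_inv pi); rewrite /= gE mass_invK.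
by set w := xget _ _; rewrite gE => <-; rewrite massK.
Qed.

Lemma hamiltonianE (q pi : E) : hamiltonian L q pi = kin (mass_inv pi) + (V q + W q.2).
Proof.
rewrite /hamiltonian legendre_invE L_multiE -{1}[pi](mass_invK uS uF) /kin.
by set x := dotE _ _; set a := V q + _; field.
Qed.

Lemma hamilton_newton (h : R) (q pi : R -> E) : hamilton_solution Q L h q pi ->
  newton_flow h q pi.
Proof.
move=> [cq cpi Qq H]; split => // t th; have [dq dpi] := H t th.
have tQ : Q (q t) by apply: Qq; case/andP: th => t0 t1; rewrite !ltW.
split.
  rewrite (_ : mass_inv (pi t) = grad (hamiltonian L (q t)) (pi t))//.
  have bnd d : `|d| <= 1 -> `|hamiltonian L (q t) (pi t + d) - hamiltonian L (q t) (pi t) -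
      dotE (mass_inv (pi t)) d| <= dimE * mb * mb ^+ 2 * `|d| ^+ 2.
    move=> _; rewrite !hamiltonianE.
    have -> : mass_inv (pi t + d) = mass_inv (pi t) + mass_inv d.
      exact: mass_invD.
    rewrite kinD mass_invK// (_ : dotE (pi t) (mass_inv d) = dotE (mass_inv (pi t)) d); last first.
      by rewrite -{1}[pi t](mass_invK uS uF) mass_sym mass_invK// dotEC.
    have -> (x y z w : R) : x + y + z + w - (x + w) - y = z by ring.
    apply: le_trans (kin_norm _ _ _) _.
    rewrite -[leRHS]mulrA ler_wpM2l ?mulr_ge0 ?dimE_ge0 ?mass_bound_ge0//.
    rewrite -exprMn lerXn2r ?nnegrE ?mulr_ge0 ?mass_bound_ge0//.
    exact: mass_inv_norm.
  by have [_ ->] := quadratic_remainder_diff ltr01 bnd.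
rewrite (_ : total_grad (q t) = grad (fun a => hamiltonian L a (pi t)) (q t))//.
have -> : (fun a => hamiltonian L a (pi t)) = (fun y => kin (mass_inv (pi t)) + (V y + W y.2)).
  by apply/funext => y; rewrite hamiltonianE.
by rewrite (grad_total _ tQ).1.
Qed.

End Potential.

Definition lagrangian_const (B Mv : R) : R :=
  let N := Mv + mb * (2 * B) in
  dimE * (2 * B * N * Mv) + dimE * mb * (mb * (2 * B)) ^+ 2 +
  2 * (B * N ^+ 2 + dimE * (B * (mb * (2 * B)))).

(** * Taylor expansion of the exact flow *)

Section Expansion.
Variables (h : R) (q pi : R -> E).
Hypothesis flow : newton_flow h q pi.
Variables (r B Mv : R).
Hypotheses (h_gt0 : 0 < h) (h_le1 : h <= 1) (r_gt0 : 0 < r) (B_ge0 : 0 <= B).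
Hypothesis tameV : forall b, tame (pot b) (q 0) r B.
Hypothesis vM : `|mass_inv (pi 0)| <= Mv.
Hypothesis h_small : h * (Mv + mb * (2 * B)) < r.

Let mb_ge0 : 0 <= mb. Proof. exact: mass_bound_ge0. Qed.
Let Mv_ge0 : 0 <= Mv. Proof. exact: le_trans vM. Qed.
Let h_ge0 : 0 <= h. Proof. exact: ltW. Qed.
Let center_ball : `|q 0 - q 0| <= r. Proof. by rewrite subrr normr0 ltW. Qed.

Lemma within_sub (U : normedModType R) (x : R -> U) (T : R) : T <= h ->
  {within `[0, h], continuous x} -> {within `[0, T], continuous x}.
Proof.
by move=> Th; apply: continuous_subspaceW => t /=; rewrite !in_itv /= => /andP[-> /le_trans->].
Qed.

Lemma total_grad_ball_norm x : `|x - q 0| <= r -> `|total_grad x| <= 2 * B.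
Proof.
move=> xr; apply: le_trans (ler_normD _ _) _.
by have [H1 _ _] := tameV true xr; have [H2 _ _] := tameV false xr; lra.
Qed.

(** An a priori bound: that the curve stays in the ball is assumed up to [T], because [flow_stays]
    relies on it. *)
Lemma momentum_dist T : 0 <= T <= h -> (forall t, 0 < t < T -> `|q t - q 0| <= r) ->
  `|pi T - pi 0| <= 2 * B * T.
Proof.
move=> /andP[T0 Th] qr; have [_ cpi _ H] := flow.
have := @curve_quadratic_bound _ _ _ pi (fun t => - total_grad (q t)) 0 0 T (2 * B) T0
  (within_sub Th cpi).
rewrite !scaler0 !addr0; apply.
- by move=> t /andP[t0 tT]; apply: (H t _).2; rewrite t0 (lt_le_trans tT).
- by move=> t tT; rewrite scaler0 !addr0 normrN; apply/total_grad_ball_norm/qr.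
- by rewrite mulr_ge0.
Qed.

Lemma velocity_dist T : 0 <= T <= h -> (forall t, 0 < t < T -> `|q t - q 0| <= r) ->
  `|mass_inv (pi T) - mass_inv (pi 0)| <= mb * (2 * B * T).
Proof.
move=> T0h qr; rewrite -mass_invB; apply: le_trans (mass_inv_norm _ _ _) _.
by rewrite ler_wpM2l//; exact: momentum_dist.
Qed.

Lemma position_dist T : 0 <= T <= h -> (forall t, 0 < t < T -> `|q t - q 0| <= r) ->
  `|q T - q 0| <= (Mv + mb * (2 * B)) * T.
Proof.
move=> /andP[T0 Th] qr; have [cq _ _ H] := flow.
have := @curve_quadratic_bound _ _ _ q (fun t => mass_inv (pi t)) 0 0 T (Mv + mb * (2 * B)) T0
  (within_sub Th cq).
rewrite !scaler0 !addr0; apply.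
- by move=> t /andP[t0 tT]; apply: (H t _).1; rewrite t0 (lt_le_trans tT).
- move=> t /andP[t0 tT]; rewrite scaler0 !addr0 -[mass_inv (pi t)](subrK (mass_inv (pi 0))).
  apply: le_trans (ler_normD _ _) _; rewrite addrC; apply: lerD => //.
  have t1 : t <= 1 by apply: le_trans h_le1; apply: le_trans Th; exact: ltW.
  apply: le_trans (velocity_dist _ _) _.
  + by rewrite ltW//= (le_trans _ Th)// ltW.
  + by move=> u /andP[u0 ut]; apply: qr; rewrite u0 (lt_trans ut).
  + by rewrite ler_wpM2l// ler_piMr// mulr_ge0.
- by rewrite addr_ge0// mulr_ge0// mulr_ge0.
Qed.

(* Otherwise the estimate [position_dist] is violated at the first exit time from the ball. *)
Lemma flow_stays T : 0 <= T <= h -> `|q T - q 0| <= r.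
Proof.
move=> /andP[T0 Th]; rewrite leNgt; apply/negP => Tr.
pose S := [set t | 0 <= t <= h /\ r <= `|q t - q 0|].
have S_T : S T by rewrite /S /= T0 Th ltW.
have infS : has_inf S by split; [exists T|exists 0 => t [/andP[]]].
set tau := inf S.
have tau0 : 0 <= tau by apply: lb_le_inf; [exists T|move=> t [/andP[]]].
have tauT : tau <= T by exact: (inf_lbound infS.2).
have before t : 0 < t < tau -> `|q t - q 0| <= r.
  move=> /andP[t0 tt]; rewrite leNgt; apply/negP => tr.
  have : tau <= t.
    apply: (inf_lbound infS.2); split; last exact: ltW.
    by rewrite ltW//= (le_trans (ltW tt))// (le_trans tauT).
  by rewrite leNgt tt.
have tauh : 0 <= tau <= h by rewrite tau0 (le_trans tauT).
have lt_r : `|q tau - q 0| < r.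
  apply: le_lt_trans (position_dist tauh before) _; apply: le_lt_trans h_small.
  rewrite mulrC ler_wpM2r//; first by rewrite addr_ge0// mulr_ge0// mulr_ge0.
  by case/andP: tauh.
(* At [tau] the distance is strictly below [r], hence also shortly afterwards, whereas the infimum
   has points of [S] arbitrarily close to it. *)
have [cq _ _ _] := flow; move/within_continuous_epsP : cq => cq.
have [||d d0 qd] := cq tau _ (r - `|q tau - q 0|); first by rewrite /= in_itv.
  by rewrite subr_gt0.
have [t [th tr] td] := inf_adherent d0 infS.
have tt : tau <= t by apply: (inf_lbound infS.2).
have : `|q t - q tau| < r - `|q tau - q 0|.
  by apply: qd; rewrite /= ?in_itv//= ger0_norm ?subr_ge0// ltrBlDl.
have := ler_normD (q t - q tau) (q tau - q 0); rewrite addrA subrK.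
by move: tr; set a := `|q t - q 0|; set b := `|q t - q tau|; lra.
Qed.

Let in_ball T t : T <= h -> 0 < t < T -> `|q t - q 0| <= r.
Proof.
by move=> Th /andP[t0 tT]; apply: flow_stays; rewrite ltW//= (le_trans (ltW tT)).
Qed.

Let N := Mv + mb * (2 * B).
Let N_ge0 : 0 <= N. Proof. by rewrite addr_ge0// mulr_ge0// mulr_ge0. Qed.
Notation G := (total_grad (q 0)).
Notation v0 := (mass_inv (pi 0)).
Notation Hv := (hess (pot true) (q 0) v0 + hess (pot false) (q 0) v0).

(** Start of a bootstrap: a bound on one of [q], [pi] is inserted in the equation of the other and
    integrated, which raises the order, until both reach [h^3]. *)
Lemma flow_momentum0 t : 0 <= t <= h -> `|pi t - pi 0| <= 2 * B * h.
Proof.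
move=> /[dup] th /andP[t0 t1]; apply: le_trans (momentum_dist th _) _ => [u|].
  exact: in_ball.
by rewrite ler_wpM2l// mulr_ge0.
Qed.

Lemma flow_position0 t : 0 <= t <= h -> `|q t - q 0| <= N * h.
Proof.
move=> /[dup] th /andP[t0 t1]; apply: le_trans (position_dist th _) _ => [u|].
  exact: in_ball.
by rewrite ler_wpM2l.
Qed.

Lemma flow_position1 t : 0 <= t <= h ->
  `|q t - q 0 - t *: v0| <= mb * (2 * B) * h ^+ 2.
Proof.
move=> /andP[t0 th]; have [cq _ _ H] := flow.
have := @curve_quadratic_bound _ _ _ q (fun t => mass_inv (pi t)) (- v0) 0 t
  (mb * (2 * B) * h) t0 (within_sub th cq).
rewrite scaler0 addr0 scalerN => Hb; apply: le_trans (Hb _ _ _) _.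
- by move=> u /andP[u0 ut]; apply: (H u _).1; rewrite u0 (lt_le_trans ut).
- move=> u /andP[u0 ut]; rewrite scaler0 addr0 -mass_invB.
  apply: le_trans (mass_inv_norm _ _ _) _; rewrite -mulrA ler_wpM2l//.
  by apply: flow_momentum0; rewrite ltW//= (le_trans (ltW ut)).
- by rewrite !mulr_ge0.
- by rewrite expr2 [leRHS]mulrA ler_wpM2l// !mulr_ge0.
Qed.

Lemma grad_flow t : 0 <= t <= h -> `|total_grad (q t) - G| <= 2 * B * N * h.
Proof.
move=> th; rewrite /total_grad opprD addrACA; apply: le_trans (ler_normD _ _) _.
have -> : 2 * B * N * h = B * (N * h) + B * (N * h) by ring.
have Hb b : `|grad (pot b) (q t) - grad (pot b) (q 0)| <= B * (N * h).
  have [_ _ /(_ _ (flow_stays th))[_ Hl _]] := tameV b center_ball.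
  by apply: le_trans Hl _; rewrite ler_wpM2l//; exact: flow_position0.
exact: lerD.
Qed.

Lemma flow_momentum1 t : 0 <= t <= h ->
  `|pi t - pi 0 + t *: G| <= 2 * B * N * h ^+ 2.
Proof.
move=> /andP[t0 th]; have [_ cpi _ H] := flow.
have := @curve_quadratic_bound _ _ _ pi (fun t => - total_grad (q t)) G 0 t
  (2 * B * N * h) t0 (within_sub th cpi).
rewrite scaler0 addr0 => Hb; apply: le_trans (Hb _ _ _) _.
- by move=> u /andP[u0 ut]; apply: (H u _).2; rewrite u0 (lt_le_trans ut).
- move=> u /andP[u0 ut]; rewrite scaler0 addr0 addrC -normrN opprB.
  by apply: grad_flow; rewrite ltW//= (le_trans (ltW ut)).
- by rewrite !mulr_ge0.
- by rewrite expr2 [leRHS]mulrA ler_wpM2l// !mulr_ge0.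
Qed.

Lemma flow_position2 :
  `|q h - q 0 - h *: v0 + (h ^+ 2 / 2) *: mass_inv G| <= mb * (2 * B * N) * h ^+ 3.
Proof.
have [cq _ _ H] := flow.
have := @curve_quadratic_bound _ _ _ q (fun t => mass_inv (pi t)) (- v0) (mass_inv G) h
  (mb * (2 * B * N) * h ^+ 2) h_ge0 cq.
rewrite scalerN => Hb.
have -> : mb * (2 * B * N) * h ^+ 3 = mb * (2 * B * N) * h ^+ 2 * h by ring.
apply: Hb.
- by move=> u uh; exact: (H u uh).1.
- move=> u /andP[u0 uh]; rewrite -mass_invB -mass_invZ.
  rewrite -mass_invD.
  rewrite -mulrA; apply: le_trans (mass_inv_norm _ _ _) _; rewrite ler_wpM2l//.
  by apply: flow_momentum1; rewrite !ltW.
- by rewrite !mulr_ge0// sqr_ge0.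
Qed.

Lemma flow_momentum2 :
  `|pi h - pi 0 + h *: G + (h ^+ 2 / 2) *: Hv| <= 2 * (B * (N ^+ 2 + mb * (2 * B))) * h ^+ 3.
Proof.
have [_ cpi _ H] := flow.
have := @curve_quadratic_bound _ _ _ pi (fun t => - total_grad (q t)) G Hv h
  (2 * (B * (N ^+ 2 + mb * (2 * B))) * h ^+ 2) h_ge0 cpi.
move=> Hb.
have -> : 2 * (B * (N ^+ 2 + mb * (2 * B))) * h ^+ 3 =
  2 * (B * (N ^+ 2 + mb * (2 * B))) * h ^+ 2 * h by ring.
apply: Hb.
- by move=> u uh; exact: (H u uh).2.
- move=> u /andP[u0 uh]; have uh' : 0 <= u <= h by rewrite !ltW.
  have Hb b : `|grad (pot b) (q u) - grad (pot b) (q 0) - u *: hess (pot b) (q 0) v0| <=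
      B * (N ^+ 2 + mb * (2 * B)) * h ^+ 2.
    have [_ Hh /(_ _ (flow_stays uh'))[_ _ Hl]] := tameV b center_ball.
    have -> : grad (pot b) (q u) - grad (pot b) (q 0) - u *: hess (pot b) (q 0) v0 =
       (grad (pot b) (q u) - grad (pot b) (q 0) - hess (pot b) (q 0) (q u - q 0)) +
       hess (pot b) (q 0) (q u - q 0 - u *: v0).
      have -> : hess (pot b) (q 0) (q u - q 0 - u *: v0) =
          hess (pot b) (q 0) (q u - q 0) - u *: hess (pot b) (q 0) v0.
        by rewrite (hessB _ _ (q u - q 0)) hessZ.
      by rewrite addrA subrK.
    apply: le_trans (ler_normD _ _) _; rewrite mulrDr mulrDl; apply: lerD.
      apply: le_trans Hl _; rewrite -mulrA ler_wpM2l// -exprMn lerXn2r ?nnegrE ?mulr_ge0//.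
      exact: flow_position0.
    by apply: le_trans (Hh _) _; rewrite -mulrA ler_wpM2l//; exact: flow_position1.
  have -> : - total_grad (q u) + G + u *: Hv =
     - ((grad (pot true) (q u) - grad (pot true) (q 0) - u *: hess (pot true) (q 0) v0) +
        (grad (pot false) (q u) - grad (pot false) (q 0) - u *: hess (pot false) (q 0) v0)).
    rewrite /total_grad; move: (grad _ _) (grad _ _) (grad _ _) (grad _ _) (hess _ _ _) (hess _ _ _).
    move=> a1 a2 a3 a4 b1 b2.
    by apply: coordE_inj => k; rewrite !(coordED, coordEN, coordEZ); ring.
  rewrite normrN; apply: le_trans (ler_normD _ _) _.
  have -> (x : R) : 2 * x * h ^+ 2 = x * h ^+ 2 + x * h ^+ 2 by ring.
  exact: lerD.
- by rewrite !mulr_ge0 ?sqr_ge0// addr_ge0 ?sqr_ge0// !mulr_ge0.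
Qed.

(** To first order the kinetic energy falls at the rate [dotE G v0] and the potential energy grows
    at the same rate, whence the factor -2. *)
Lemma lagrangian_flow t : 0 <= t <= h ->
  `|kin (mass_inv (pi t)) - (pot true (q t) + pot false (q t)) -
    (kin v0 - (pot true (q 0) + pot false (q 0))) - t * (- 2 * dotE G v0)| <=
  lagrangian_const B Mv * h ^+ 2.
Proof.
move=> th; pose w := mass_inv (pi t - pi 0).
pose P b := pot b (q t) - pot b (q 0) - t * dotE (grad (pot b) (q 0)) v0.
have -> : kin (mass_inv (pi t)) - (pot true (q t) + pot false (q t)) -
    (kin v0 - (pot true (q 0) + pot false (q 0))) - t * (- 2 * dotE G v0) =
    dotE (pi t - pi 0 + t *: G) v0 + kin w - (P true + P false).
  have -> : mass_inv (pi t) = v0 + w by rewrite /w mass_invB subrKC.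
  have -> : kin (v0 + w) = kin v0 + dotE (pi t - pi 0) v0 + kin w.
    by rewrite kinD mass_sym /w mass_invK.
  rewrite /P [dotE (_ + t *: _) _]dotEDl dotEZl [dotE G v0]dotEDl.
  move: (dotE _ _) (dotE _ _) (dotE _ _) (kin _) (kin _) (pot _ _) (pot _ _) (pot _ _) (pot _ _).
  by move=> *; ring.
have n1 : `|dotE (pi t - pi 0 + t *: G) v0| <= dimE * (2 * B * N * Mv) * h ^+ 2.
  apply: le_trans (dotE_norm _ _) _.
  have -> : dimE * (2 * B * N * Mv) * h ^+ 2 = dimE * ((2 * B * N * h ^+ 2) * Mv) by ring.
  by rewrite ler_wpM2l ?dimE_ge0//; apply: ler_pM => //; exact: flow_momentum1.
have n2 : `|kin w| <= dimE * mb * (mb * (2 * B)) ^+ 2 * h ^+ 2.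
  apply: le_trans (kin_norm _ _ _) _.
  rewrite -[leRHS]mulrA ler_wpM2l ?mulr_ge0 ?dimE_ge0// -exprMn.
  rewrite lerXn2r ?nnegrE ?mulr_ge0//; apply: le_trans (mass_inv_norm _ _ _) _.
  by rewrite -mulrA ler_wpM2l// flow_momentum0.
have n3 b : `|P b| <= (B * N ^+ 2 + dimE * (B * (mb * (2 * B)))) * h ^+ 2.
  have [Gb _ /(_ _ (flow_stays th))[Hl _ _]] := tameV b center_ball.
  have -> : P b = (pot b (q t) - pot b (q 0) - dotE (grad (pot b) (q 0)) (q t - q 0)) +
      dotE (grad (pot b) (q 0)) (q t - q 0 - t *: v0).
    by rewrite /P (dotEBr (q t - q 0)) dotEZr addrA subrK.
  apply: le_trans (ler_normD _ _) _; rewrite mulrDl; apply: lerD.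
    apply: le_trans Hl _; rewrite -mulrA ler_wpM2l// -exprMn lerXn2r ?nnegrE ?mulr_ge0//.
    exact: flow_position0.
  apply: le_trans (dotE_norm _ _) _; rewrite -mulrA ler_wpM2l ?dimE_ge0// -mulrA.
  by apply: ler_pM => //; exact: flow_position1.
rewrite /lagrangian_const -/N [leRHS]mulrDl [X in _ <= X + _]mulrDl.
apply: le_trans (ler_normB _ _) _; apply: lerD.
  by apply: le_trans (ler_normD _ _) _; exact: lerD.
apply: le_trans (ler_normD _ _) _.
have -> (x : R) : 2 * x * h ^+ 2 = x * h ^+ 2 + x * h ^+ 2 by ring.
exact: lerD.
Qed.

End Expansion.
End Flow.

Section CurveProducts.
Context {R : realType} {ns nf : nat}.
Notation E := (config R ns nf).

Lemma within_continuous_dotE (A : set R) (x y : R -> E) :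
  {within A, continuous x} -> {within A, continuous y} ->
  {within A, continuous (fun s => dotE (x s) (y s))}.
Proof.
move=> cx cy; apply/subspace_continuousP => t At.
have -> : (fun s => dotE (x s) (y s)) = (fun s => \sum_k coordE (x s) k * coordE (y s) k).
  by apply/funext => s; rewrite dotE_sum.
apply: cvg_big => [|k _]; first exact: add_continuous.
have /subspace_continuousP/(_ t At) cxk := within_continuous_coordE (k := k) cx.
have /subspace_continuousP/(_ t At) cyk := within_continuous_coordE (k := k) cy.
exact: cvgM.
Qed.

Lemma is_derive_dotE (x y : R -> E) (t : R) (dx dy : E) :
  is_derive t 1 x dx -> is_derive t 1 y dy ->
  is_derive t 1 (fun s => dotE (x s) (y s)) (dotE dx (y t) + dotE (x t) dy).
Proof.
move=> Dx Dy.
have dsum (I : Type) (r : seq I) (f : I -> R -> R) (df : I -> R) :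
    (forall i, is_derive t 1 (f i) (df i)) ->
    is_derive t 1 (fun s => \sum_(i <- r) f i s) (\sum_(i <- r) df i).
  move=> fd; elim: r => [|i r IH].
    rewrite big_nil (_ : (fun s => _) = cst 0); first exact: is_derive_cst.
    by apply/funext => s; rewrite big_nil.
  rewrite big_cons (_ : (fun s => _) = f i + (fun s => \sum_(i <- r) f i s)).
    exact: is_deriveD.
  by apply/funext => s; rewrite big_cons.
have -> : (fun s => dotE (x s) (y s)) = (fun s => \sum_k coordE (x s) k * coordE (y s) k).
  by apply/funext => s; rewrite dotE_sum.
rewrite !dotE_sum -big_split /=; apply: dsum => k.
have := is_deriveM (is_derive_coordE k Dx) (is_derive_coordE k Dy).
by rewrite /GRing.scale /= addrC [coordE (y t) k * _]mulrC.
Qed.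

End CurveProducts.

(** * The exact action *)

Section SegmentIntegral.
Context {R : realType}.
Implicit Types f F : R -> R.
Notation mu := (@lebesgue_measure R).

Lemma segment_integrable f (h : R) : {within `[0, h], continuous f} ->
  mu.-integrable `[0, h]%classic (EFin \o f).
Proof. by move=> cf; apply: continuous_compact_integrable => //; exact: segment_compact. Qed.

Lemma Rintegral_primitive f F (h : R) : 0 < h -> {within `[0, h], continuous f} ->
  {within `[0, h], continuous F} -> (forall t, 0 < t < h -> is_derive t 1 F (f t)) ->
  \int[mu]_(t in `[0, h]) f t = F h - F 0.
Proof.
move=> h0 cf /(continuous_within_itvP _ h0)[_ F0 Fh] dF.
rewrite /Rintegral (@continuous_FTC2 _ f F 0 h h0 cf)//.
  split => // t; rewrite in_itv /= => th.
  exact: (@ex_derive _ _ _ _ _ _ _ (dF t th)).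
move=> t; rewrite in_itv /= => th; rewrite derive1E.
exact: (@derive_val _ _ _ _ _ _ _ (dF t th)).
Qed.

Lemma Rintegral_norm_le f (h M : R) : 0 < h -> {within `[0, h], continuous f} ->
  (forall t, 0 <= t <= h -> `|f t| <= M) -> `|\int[mu]_(t in `[0, h]) f t| <= M * h.
Proof.
move=> h0 cf fM; have If := segment_integrable cf.
have mE : \int[mu]_(t in `[0, h]) M = M * h.
  have -> : M * h = M * fine (mu `[0, h]%classic).
    by rewrite lebesgue_measure_itv /= lte_fin h0 sube0.
  exact: Rintegral_cst.
apply: le_trans (le_normr_Rintegral _ If) _ => //; rewrite -mE; apply: le_Rintegral => //.
- apply: segment_integrable; apply/subspace_continuousP => t At.
  by apply: cvg_norm; move/subspace_continuousP : cf; exact.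
- by apply: segment_integrable => t; exact: cst_continuous.
Qed.

Lemma Rintegral_affine_approx f (h a b M : R) : 0 < h -> {within `[0, h], continuous f} ->
  (forall t, 0 <= t <= h -> `|f t - a - t * b| <= M) ->
  `|\int[mu]_(t in `[0, h]) f t - (h * a + h ^+ 2 / 2 * b)| <= M * h.
Proof.
move=> h0 cf fM.
pose F : R -> R := (a \*: (@id R)) + ((b / 2) \*: ((@id R) ^+ 2)).
pose g (t : R) : R := a + t * b.
have dF (t : R) : is_derive t 1 F (g t).
  by apply: is_derive_eq; rewrite /g /GRing.scale /=; field.
have FE t : F t = t * a + t ^+ 2 / 2 * b by rewrite /F !fctE /= /GRing.scale /=; field.
have cF : {within `[0, h], continuous F}.
  by apply: derivable_within_continuous => t _; exact: (@ex_derive _ _ _ _ _ _ _ (dF t)).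
have cg : {within `[0, h], continuous g}.
  apply: derivable_within_continuous => t _.
  rewrite (_ : g = cst a + (b \*: (@id R))); first exact: derivableD.
  by apply/funext => s; rewrite /g !fctE /= /GRing.scale /= mulrC.
have gE : \int[mu]_(t in `[0, h]) g t = h * a + h ^+ 2 / 2 * b.
  by rewrite (Rintegral_primitive h0 cg cF)// !FE; ring.
have If := segment_integrable cf; have Ig := segment_integrable cg.
rewrite -gE -RintegralB//; apply: Rintegral_norm_le => //.
  exact: within_continuousB.
by move=> t th; rewrite /g opprD addrA; exact: fM.
Qed.

End SegmentIntegral.

Section Action.
Context {R : realType} {ns nf : nat}.
Notation E := (config R ns nf).
Variables (Q : set E) (Ms : 'M[R]_ns) (Mf : 'M[R]_nf) (V : E -> R) (W : 'cV[R]_nf -> R).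
Notation L := (L_multi Ms Mf V W).
Notation mass := (mass Ms Mf).
Notation mass_inv := (mass_inv Ms Mf).
Notation kin := (kin Ms Mf).
Notation mb := (mass_bound Ms Mf).
Notation pot := (pot V W).
Notation total_grad := (total_grad V W).
Notation dimE := (dimE (R := R) (ns := ns) (nf := nf)).
Hypotheses (oQ : open Q) (smoothp : forall b, smooth_on Q (pot b)).

Lemma pot_tame (K : set E) : compact K -> K `<=` Q ->
  exists r B : R, [/\ 0 < r, 0 <= B, (forall c x, K c -> `|x - c| <= r -> Q x) &
    forall b c, K c -> tame (pot b) c r B].
Proof.
move=> cK KQ.
have [r1 [B1 [r10 B10 rQ1 tame1]]] := smooth_on_tame oQ (smoothp true) cK KQ.
have [r2 [B2 [r20 B20 rQ2 tame2]]] := smooth_on_tame oQ (smoothp false) cK KQ.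
exists (Num.min r1 r2), (Num.max B1 B2); split.
- by rewrite lt_min r10.
- by rewrite le_max B10.
- by move=> c x Kc; rewrite le_min => /andP[xr1 _]; exact: rQ1 xr1.
- move=> [] c Kc.
    by apply: tame_le (tame1 _ Kc); rewrite ?ge_min ?le_max lexx ?orbT.
  by apply: tame_le (tame2 _ Kc); rewrite ?ge_min ?le_max lexx ?orbT.
Qed.

Lemma L_pot (q v : E) : L q v = kin v - (pot true q + pot false q).
Proof. by rewrite L_multiE. Qed.

Lemma within_continuous_mass (A : set R) (v : R -> E) :
  {within A, continuous v} -> {within A, continuous (fun t => mass (v t))}.
Proof.
move=> cv; apply: (within_continuous_linear_bounded (mass_bound_ge0 Ms Mf) (massB Ms Mf)) => //.
exact: mass_norm.
Qed.

Lemma within_continuous_L (h : R) (q v : R -> E) :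
  {within `[0, h], continuous q} -> {within `[0, h], continuous v} ->
  (forall t, 0 <= t <= h -> Q (q t)) ->
  {within `[0, h], continuous (fun t => L (q t) (v t))}.
Proof.
move=> cq cv Qq.
have cp b : {within `[0, h], continuous (pot b \o q)}.
  apply: within_continuous_comp_at => // t; rewrite /= in_itv /= => /Qq Qt.
  exact: (smooth_on_continuous (smoothp b)).
have ck : {within `[0, h], continuous (fun t => kin (v t))}.
  have := within_continuous_dotE (within_continuous_mass cv) cv.
  move=> /subspace_continuousP cd; apply/subspace_continuousP => t At.
  by apply: cvgM (cd t At); exact: cvg_cst.
have -> : (fun t => L (q t) (v t)) = (fun t => kin (v t)) - ((pot true \o q) + (pot false \o q)).
  by apply/funext => t; rewrite L_pot.
apply: within_continuousB => //; exact: within_continuousD.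
Qed.

(** Links the curves that define [Ld_exact] with those the minimality hypothesis speaks of. The
    first variation is the integral of the derivative of [dotE (mass v) d], hence zero; what is left
    is quadratic in [e]. *)
Lemma action_critical (h : R) (q v : R -> E) :
  sym_part Ms \in unitmx -> sym_part Mf \in unitmx -> 0 < h ->
  EL_solution Q L h q v -> critical_curve Q L h q v.
Proof.
move=> uS uF h0 EL; have [[cq cv dq Qq] _] := EL; split; first by case: EL.
move=> d d' [cd cd' dd _] [d0 dh].
have [_ cpi _ dpi] := EL_newton uS uF smoothp EL.
(* The trace of the curve is compact, so one radius and one constant serve along the whole of it. *)
have cQ : compact (q @` `[0, h]%classic).
  by apply: continuous_compact => //; exact: segment_compact.
have QK : q @` `[0, h]%classic `<=` Q.
  by move=> _ [t th <-]; apply: Qq; move: th; rewrite /= in_itv.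
have [r [B [r0 B0 rQ' tameB']]] := pot_tame cQ QK.
have inq t : 0 <= t <= h -> (q @` `[0, h]%classic) (q t).
  by move=> th; exists t => //; rewrite /= in_itv.
have rQ t x : 0 <= t <= h -> `|x - q t| <= r -> Q x by move=> /inq; exact: rQ'.
have tameB b t : 0 <= t <= h -> tame (pot b) (q t) r B by move=> /inq; exact: tameB'.
have bnd (x : R -> E) : {within `[0, h], continuous x} ->
    \forall M \near +oo, forall t, 0 <= t <= h -> `|x t| <= M.
  move=> cx; have [M [Mr MM]] := compact_bounded (continuous_compact cx (@segment_compact R 0 h)).
  exists M; split => // M' MM' t th; apply: MM => //; exists t.
have [Md [Md0 dM dM']] : exists Md : R, [/\ 0 < Md,
    forall t, 0 <= t <= h -> `|d t| <= Md & forall t, 0 <= t <= h -> `|d' t| <= Md].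
  near +oo_R => M; exists M; split; near: M; [exact: nbhs_pinfty_gt|exact: bnd|exact: bnd].
pose l (t : R) : R := dotE (mass (v t)) (d' t) + dotE (- total_grad (q t)) (d t).
pose act (e : R) := action L h (fun t => q t + e *: d t) (fun t => v t + e *: d' t).
have r2 : 0 < r / Md by rewrite divr_gt0.
pose C := dimE * mb * Md ^+ 2 + 2 * (B * Md ^+ 2).
apply: (@quadratic_remainder_is_derive _ act 0 (r / Md) (C * h) r2) => e er.
have eM : `|e| * Md <= r by rewrite -ler_pdivlMr.
have ce (x y : R -> E) : {within `[0, h], continuous x} -> {within `[0, h], continuous y} ->
    {within `[0, h], continuous (fun t => x t + e *: y t)}.
  move=> /subspace_continuousP cx /subspace_continuousP cy; apply/subspace_continuousP => t At.
  by apply: cvgD; [exact: cx|apply: cvgZr; exact: cy].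
have inr t : 0 <= t <= h -> `|q t + e *: d t - q t| <= r.
  move=> th; rewrite addrAC subrr add0r normrZ; apply: le_trans eM.
  by rewrite ler_wpM2l// dM.
have cLe : {within `[0, h], continuous (fun t => L (q t + e *: d t) (v t + e *: d' t))}.
  by apply: within_continuous_L; [exact: ce|exact: ce|move=> t th; exact: rQ th (inr t th)].
have cL : {within `[0, h], continuous (fun t => L (q t) (v t))} by exact: within_continuous_L.
have cg : {within `[0, h], continuous (fun t => - total_grad (q t))}.
  apply/subspace_continuousP => t; rewrite /= in_itv /= => th.
  have cgb b : {within `[0, h], continuous (fun s => grad (pot b) (q s))}.
    apply/within_continuous_epsP => s; rewrite /= in_itv /= => sh e1 e10.
    have B1 : 0 < B + 1 by rewrite ltr_wpDl.
    move/within_continuous_epsP : (cq) => /(_ s); rewrite /= in_itv /= => /(_ sh).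
    have m0 : 0 < Num.min r (e1 / (B + 1)) by rewrite lt_min r0 divr_gt0.
    move=> /(_ _ m0)[dl dl0 Hd]; exists dl => // u uh us.
    have := Hd u uh us; rewrite lt_min => /andP[ur ue].
    have cc : `|q s - q s| <= r by rewrite subrr normr0 ltW.
    have [_ _ /(_ _ (ltW ur))[_ Hl _]] := tameB b s sh _ cc.
    apply: le_lt_trans Hl _; apply: (@le_lt_trans _ _ ((B + 1) * `|q u - q s|)).
      by rewrite ler_wpM2r// lerDl.
    by rewrite mulrC -ltr_pdivlMr.
  have /subspace_continuousP ct := cgb true; have /subspace_continuousP cf := cgb false.
  by apply: cvgN; apply: cvgD; [apply: ct|apply: cf]; rewrite /= in_itv.
have cl : {within `[0, h], continuous l}.
  have c1 := within_continuous_dotE (within_continuous_mass cv) cd'.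
  have c2 := within_continuous_dotE cg cd.
  exact: (within_continuousD c1 c2).
have l0 : \int[lebesgue_measure]_(t in `[0, h]) l t = 0.
  have cP := within_continuous_dotE (within_continuous_mass cv) cd.
  have dP t : 0 < t < h -> is_derive t 1 (fun s => dotE (mass (v s)) (d s)) (l t).
    by move=> th; rewrite /l addrC; apply: is_derive_dotE; [exact: (dpi t th).2|exact: dd].
  by rewrite (Rintegral_primitive h0 cl cP dP) d0 dh !dotE0r subrr.
have Ie := segment_integrable cLe; have I0 := segment_integrable cL.
have cle : {within `[0, h], continuous (fun t => e * l t)}.
  move/subspace_continuousP : (cl) => cl'; apply/subspace_continuousP => t At.
  by apply: cvgM (cl' t At); exact: cvg_cst.
have act0 : act 0 = \int[lebesgue_measure]_(t in `[0, h]) L (q t) (v t).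
  rewrite /act /action; congr Rintegral; apply/funext => t.
  by rewrite !scale0r !addr0.
have -> : act e - act 0 - 0 * e = \int[lebesgue_measure]_(t in `[0, h])
    (L (q t + e *: d t) (v t + e *: d' t) - L (q t) (v t) - e * l t).
  rewrite RintegralB//; last 2 first.
  - apply: segment_integrable; exact: (within_continuousB cLe cL).
  - exact: segment_integrable.
  rewrite RintegralB// RintegralZl//; last exact: segment_integrable.
  by rewrite l0 act0 mulr0 mul0r.
rewrite -mulrA [h * _]mulrC mulrA; apply: Rintegral_norm_le => //.
  exact: (within_continuousB (within_continuousB cLe cL) cle).
move=> t th; have cc : `|q t - q t| <= r by rewrite subrr normr0 ltW.
pose rem b := pot b (q t + e *: d t) - pot b (q t) - dotE (grad (pot b) (q t)) (e *: d t).
have -> : L (q t + e *: d t) (v t + e *: d' t) - L (q t) (v t) - e * l t =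
    e ^+ 2 * kin (d' t) - (rem true + rem false).
  rewrite !L_pot kinD kinZ dotEZr /l /rem /total_grad !dotEZr dotENl dotEDl.
  by ring.
have e2 : 0 <= e ^+ 2 by exact: sqr_ge0.
have remb b : `|rem b| <= B * Md ^+ 2 * e ^+ 2.
  have [_ _ /(_ _ (inr t th))[Hl _ _]] := tameB b t th _ cc.
  have aE : q t + e *: d t - q t = e *: d t by rewrite addrAC subrr add0r.
  rewrite aE in Hl; apply: le_trans Hl _.
  rewrite normrZ exprMn -mulrA ler_wpM2l// real_normK ?num_real// mulrC ler_wpM2r//.
  by rewrite lerXn2r ?nnegrE ?(ltW Md0)// dM.
rewrite /C mulrDl; apply: le_trans (ler_normB _ _) _; apply: lerD.
  rewrite normrM ger0_norm// mulrC ler_wpM2r//; apply: le_trans (kin_norm _ _ _) _.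
  rewrite ler_wpM2l ?mulr_ge0 ?dimE_ge0 ?mass_bound_ge0//.
  by rewrite lerXn2r ?nnegrE ?(ltW Md0)// dM'.
apply: le_trans (ler_normD _ _) _.
have -> : 2 * (B * Md ^+ 2) * e ^+ 2 = B * Md ^+ 2 * e ^+ 2 + B * Md ^+ 2 * e ^+ 2 by ring.
exact: lerD.
Unshelve. all: by end_near. Qed.

Lemma action_taylor (h r B Mv : R) (q v : R -> E) :
  sym_part Ms \in unitmx -> sym_part Mf \in unitmx -> 0 < h -> h <= 1 -> 0 < r -> 0 <= B ->
  EL_solution Q L h q v -> (forall b, tame (pot b) (q 0) r B) -> `|v 0| <= Mv ->
  h * (Mv + mb * (2 * B)) < r ->
  `|action L h q v - (h * kin (v 0) - h * (pot true (q 0) + pot false (q 0)) -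
     h ^+ 2 * dotE (total_grad (q 0)) (v 0))| <= lagrangian_const Ms Mf B Mv * h ^+ 3.
Proof.
move=> uS uF h0 h1 r0 B0 EL tm vM hs; have [[cq cv dq Qq] _] := EL.
have fl := EL_newton uS uF smoothp EL.
have v0 : mass_inv (mass (v 0)) = v 0 by exact: massK.
have vM' : `|mass_inv (mass (v 0))| <= Mv by rewrite v0.
have LF := lagrangian_flow uS uF fl h0 h1 r0 B0 tm vM' hs.
have cL := within_continuous_L cq cv Qq.
have := @Rintegral_affine_approx _ (fun t => L (q t) (v t)) h
  (kin (v 0) - (pot true (q 0) + pot false (q 0))) (- 2 * dotE (total_grad (q 0)) (v 0))
  (lagrangian_const Ms Mf B Mv * h ^+ 2) h0 cL.
rewrite /action; set A := Rintegral _ _ _.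
have -> : h * (kin (v 0) - (pot true (q 0) + pot false (q 0))) +
    h ^+ 2 / 2 * (- 2 * dotE (total_grad (q 0)) (v 0)) =
    h * kin (v 0) - h * (pot true (q 0) + pot false (q 0)) -
     h ^+ 2 * dotE (total_grad (q 0)) (v 0) by field.
have -> : lagrangian_const Ms Mf B Mv * h ^+ 3 = lagrangian_const Ms Mf B Mv * h ^+ 2 * h by ring.
apply=> t th; have := LF t th; rewrite !massK//.
by rewrite L_pot.
Qed.

End Action.

(** * Error estimates *)

Section SmallSteps.
Context {R : realType}.

(** The smallness conditions on the step are of this form; they are intersected as a filter and then
    converted into a single [h0]. *)
Lemma small_step (K eps : R) : 0 < eps -> \forall h \near (0 : R)^'+, h * K < eps.
Proof.
move=> e0; have K0 : 0 < `|K| + 1 by rewrite ltr_wpDl.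
near=> h; have h0 : 0 < h by [].
apply: (@lt_le_trans _ _ (h * (`|K| + 1))).
  by rewrite ltr_pM2l//; have := ler_norm K; lra.
by rewrite -ler_pdivlMr//; near: h; apply: nbhs_right_le; exact: divr_gt0.
Unshelve. all: by end_near. Qed.

Lemma near_small_step (P : R -> Prop) : (\forall h \near (0 : R)^'+, P h) ->
  exists2 h0 : R, 0 < h0 & forall h, 0 < h < h0 -> P h.
Proof.
move=> /nbhs_normP[d /= d0 dP]; exists d => // h /andP[h0 hd].
by apply: dP => //; rewrite /ball_ /= sub0r normrN gtr0_norm.
Qed.

End SmallSteps.

Section SmoothProjection.
Context {R : realType} {ns nf : nat}.

(** Iterated derivatives of [W] composed with the projection are iterated derivatives of [W] in the
    projected directions. *)
Lemma smooth_on_snd (Qs : set 'cV[R]_ns) (Qf : set 'cV[R]_nf) (W : 'cV[R]_nf -> R) :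
  smooth_on Qf W -> smooth_on (Qs `*` Qf) (fun x : config R ns nf => W x.2).
Proof.
move=> sW vs x [_ Qx].
have E us : iter_derive us (fun y : config R ns nf => W y.2) =
    fun y => iter_derive (map snd us) W y.2.
  by elim: us => [//|u us IH] /=; rewrite /iter_derive /= -/(iter_derive us _) IH.
rewrite E; have [c d] := sW (map snd vs) x.2 Qx; split; last by move=> v; exact: (d v.2).
by apply: (@cvg_comp _ _ _ snd); [exact: cvg_snd|exact: c].
Qed.

End SmoothProjection.

Section ErrorEstimates.
Context {R : realType} {ns nf : nat}.
Notation E := (config R ns nf).
Variables (Qs : set 'cV[R]_ns) (Qf : set 'cV[R]_nf).
Variables (Ms : 'M[R]_ns) (Mf : 'M[R]_nf) (V : E -> R) (W : 'cV[R]_nf -> R).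
Variables (rW rV : quad_rule R).
Hypotheses (openQs : open Qs) (openQf : open Qf).
Notation Q := (Q_multi Qs Qf).
Notation L := (L_multi Ms Mf V W).
Notation Ld := (Ld_multi Qs Qf Ms Mf V W rW rV).
Hypotheses (smoothV : smooth_on Q V) (smoothW : smooth_on Qf W).
Hypotheses (okW : rule_param_ok rW) (okV : rule_param_ok rV).
Hypotheses (uS : sym_part Ms \in unitmx) (uF : sym_part Mf \in unitmx).
Notation mb := (mass_bound Ms Mf).
Notation critical_min := (critical_curves_minimise Qs Qf Ms Mf V W rW rV).

Let openQ : open Q.
Proof.
rewrite openE => -[x y] [/= Qx Qy].
by exists (Qs, Qf) => //; split; exact: open_nbhs_nbhs.
Qed.
Let mb_ge0 : 0 <= mb. Proof. exact: mass_bound_ge0. Qed.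

Lemma smooth_pot b : smooth_on Q (pot V W b).
Proof. by case: b => //; exact: smooth_on_snd. Qed.

(** Two Euler-Lagrange solutions with the same end points are both critical, hence both minimise, so
    their actions agree. *)
Lemma Ld_exact_action (h : R) (q v : R -> E) : 0 < h -> EL_solution Q L h q v ->
  (forall q' v', critical_curve Q L h q' v' -> joins h q' (q 0) (q h) ->
     unique_minimiser Q L h q' v') ->
  Ld_exact Q L h (q 0) (q h) = action L h q v.
Proof.
move=> h0 EL um; rewrite /Ld_exact.
have [|q' [v' [EL' j' ->]]] := @xgetPex _ 0 [set a | exists q' v',
    [/\ EL_solution Q L h q' v', joins h q' (q 0) (q h) & a = action L h q' v']].
  by exists (action L h q v); exists q, v; split.
have crit x y : EL_solution Q L h x y -> critical_curve Q L h x y.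
  exact: (action_critical openQ smooth_pot uS uF h0).
have U := um _ _ (crit _ _ EL) (conj erefl erefl).
have U' := um _ _ (crit _ _ EL') j'.
have [j0 jh] := j'.
have [le1 _] := U q' v' EL'.1 j'.
have [le2 _] := U' q v EL.1 (conj (esym j0) (esym jh)).
by apply/eqP; rewrite eq_le le1 le2.
Qed.

Lemma critical_min_near (K : set E) (r : R) (p : nat) : compact K -> 0 < r ->
  (forall c x, K c -> `|x - c| <= r -> Q x) -> critical_min p ->
  exists r1 h1 : R, [/\ 0 < r1, r1 <= r, 0 < h1 & forall h c q0 q1, 0 < h < h1 -> K c ->
    `|q0 - c| <= r1 / 2 -> `|q1 - c| <= r1 / 2 ->
    critical_minimise_at Qs Qf Ms Mf V W rW rV p h q0 q1].
Proof.
move=> cK r0 rQ cm.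
have cK' := compact_thickening (@closed_ball_compactE R ns nf r) cK.
have [|d [h1 [d0 h10 H]]] := cm _ cK'.
  by move=> x [c Kc]; exact: rQ.
(* Two end points within half of this radius of [c] are less than [d] apart. *)
exists (Num.min r (d / 2)), h1; split => //.
- by rewrite lt_min r0 divr_gt0.
- by rewrite ge_min lexx.
move=> h c q0 q1 hh Kc q0c q1c; have [m1 m2] : Num.min r (d / 2) <= r /\ Num.min r (d / 2) <= d / 2.
  by rewrite !ge_min !lexx orbT.
apply: H => //; first by exists c => //; lra.
have -> : q1 - q0 = (q1 - c) - (q0 - c) by rewrite opprB addrA subrK.
by apply: le_lt_trans (ler_normB _ _) _; lra.
Qed.

(** The factor 2 pays for the absorbed cubic term. The condition linking [h] and [p] restricts only
    the steps, so the constant stays independent of [p]. *)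
Lemma step_error_bound (K h : R) (p : nat) : 0 <= K -> 0 < h -> (0 < p)%N -> h * p%:R < 1 ->
  K * step_error rW rV p h <= error_bound rW rV (2 * K) p h.
Proof.
move=> K0 h0 p0 hp; have p1 : 0 < p%:R :> R by rewrite ltr0n.
rewrite /step_error /asym /error_bound; case: ifP => _.
  rewrite mul0r addr0.
  have : 0 <= K * h ^+ 3 by rewrite mulr_ge0// exprn_ge0// ltW.
  have : 0 <= p%:R * (2 * K * (h / p%:R) ^+ 3).
    apply: mulr_ge0; first exact: ltW.
    by apply: mulr_ge0; [exact: mulr_ge0|apply: exprn_ge0; apply: divr_ge0; exact: ltW].
  by move=> ? ?; lra.
have -> : p%:R^-1 * (2 * K * h ^+ 2) = K * (h ^+ 2 / p%:R + 1 * (h ^+ 2 / p%:R)).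
  by field; exact: lt0r_neq0.
rewrite ler_wpM2l// lerD2r ler_pdivlMr// exprSr -mulrA.
by rewrite ler_piMr ?sqr_ge0// ltW.
Qed.

Lemma cube_step_error (h : R) p : 0 < h -> h ^+ 3 <= step_error rW rV p h.
Proof.
move=> h0; rewrite /step_error lerDl mulr_ge0 ?asym_ge0// divr_ge0// sqr_ge0//.
Qed.

Lemma lagrangian_const_ge0 (B Mv : R) : 0 <= B -> 0 <= Mv -> 0 <= lagrangian_const Ms Mf B Mv.
Proof.
move=> B0 M0; have N0 : 0 <= Mv + mb * (2 * B) by rewrite addr_ge0// !mulr_ge0.
by rewrite /lagrangian_const; rewrite !addr_ge0// ?mulr_ge0 ?dimE_ge0 ?sqr_ge0// ?addr_ge0 ?mulr_ge0 ?dimE_ge0 ?sqr_ge0.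
Qed.

Lemma action_const_ge0 (B Mv C : R) : 0 <= B -> 0 <= Mv -> 0 <= C ->
  0 <= action_const Ms Mf B Mv C.
Proof.
move=> B0 M0 C0; have mB : 0 <= mb * B by rewrite mulr_ge0.
have N0 : 0 <= mb * B + C + 8 * mb * B by rewrite !addr_ge0// !mulr_ge0.
have C0' : 0 <= mb * B + C by rewrite addr_ge0.
rewrite /action_const; move: (mb * B + C) C0' N0 => x x0 N0.
have d0 : 0 <= dimE (R := R) (ns := ns) (nf := nf) := dimE_ge0.
have dm : 0 <= dimE (R := R) (ns := ns) (nf := nf) * mb by rewrite mulr_ge0.
apply: addr_ge0; last by apply: mulr_ge0 => //; apply: mulr_ge0 => //; exact: mulr_ge0.
apply: addr_ge0; last first.
  by apply: mulr_ge0; [exact: mulr_ge0|apply: addr_ge0; [exact: sqr_ge0|exact: mulr_ge0]].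
apply: addr_ge0; last by apply: mulr_ge0 => //; exact: sqr_ge0.
apply: addr_ge0; last by apply: mulr_ge0 => //; exact: sqr_ge0.
by apply: mulr_ge0 => //; exact: mulr_ge0.
Qed.

Lemma scheme_const_ge0 (B Mv : R) : 0 <= B -> 0 <= Mv -> 0 <= scheme_const Ms Mf B Mv.
Proof.
move=> B0 M0.
have N0 : 0 <= 2 * mb * B + 8 * mb * B by rewrite !addr_ge0// !mulr_ge0.
rewrite /scheme_const; move: (2 * mb * B + 8 * mb * B) N0 => x x0.
have t : 0 <= 2 * B by rewrite mulr_ge0.
apply: addr_ge0; last exact: mulr_ge0.
apply: addr_ge0.
  apply: mulr_ge0; first by rewrite !mulr_ge0.
  by rewrite !addr_ge0.
by apply: mulr_ge0 => //; apply: addr_ge0 => //; exact: sqr_ge0.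
Qed.

Lemma compact_snd_bounded (K : set (E * E)) : compact K ->
  exists2 M : R, 0 <= M & forall z, K z -> `|z.2| <= M.
Proof.
move=> cK; have [M [Mr MM]] := compact_bounded cK.
exists (Num.max 0 (M + 1)); first by rewrite le_max lexx.
move=> z Kz; have : `|z| <= Num.max 0 (M + 1).
  by apply: MM => //; rewrite lt_max ltrDl ltr01 orbT.
by move=> /prod_norm_le[].
Qed.

Lemma compact_fst (K : set (E * E)) : compact K -> compact (fst @` K).
Proof.
move=> cK; apply: continuous_compact => //.
by apply: continuous_subspaceT => z; exact: cvg_fst.
Qed.

Lemma discrete_lagrangian_error (K : set (E * E)) : compact K -> K `<=` Q `*` setT ->
  exists C : R, forall p : nat, (0 < p)%N -> critical_min p ->
    exists2 h0 : R, 0 < h0 & forall h, 0 < h < h0 ->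
      forall q v, EL_solution Q L h q v -> K (q 0, v 0) ->
        `|Ld_exact Q L h (q 0) (q h) - Ld p h (q 0) (q h)| <= error_bound rW rV C p h.
Proof.
move=> cK KQ; have cK1 := compact_fst cK.
have K1Q : fst @` K `<=` Q by move=> _ [z /KQ[Qz _] <-].
have [r [B [r0 B0 rQ tm]]] := pot_tame openQ smooth_pot cK1 K1Q.
have [Mv Mv0 vM] := compact_snd_bounded cK.
pose N := Mv + mb * (2 * B); pose C3 := mb * (2 * B * N).
have N0 : 0 <= N by rewrite addr_ge0// !mulr_ge0.
have C30 : 0 <= C3 by rewrite !mulr_ge0.
pose KL := lagrangian_const Ms Mf B Mv; pose KA := action_const Ms Mf B Mv C3.
have KL0 : 0 <= KL by exact: lagrangian_const_ge0.
have KA0 : 0 <= KA by exact: action_const_ge0.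
(* The constant is fixed before [p] is introduced; [r1], [h1] and [h0] come afterwards and may
   depend on it. *)
exists (2 * (KL + KA)) => p p0 cm.
have [r1 [h1 [r10 r1r h10 Hc]]] := critical_min_near cK1 r0 rQ cm.
have r12 : 0 < r1 / 2 by rewrite divr_gt0.
have r14 : 0 < r1 / 4 by rewrite divr_gt0.
have half : 0 < 2^-1 :> R by rewrite invr_gt0.
have [h0 h00 Hh] := near_small_step (filterI (filterI (small_step 1 h10) (small_step 1 ltr01))
  (filterI (filterI (small_step p%:R ltr01) (small_step N r12))
    (filterI (small_step (8 * mb * B) r14) (small_step (8 * mb * B) half)))).
exists h0 => // h hh q v EL Kqv.
have [[+ +] [[hp hN] [hr hhalf]]] := Hh h hh; rewrite !mulr1 => hh1 /ltW hle1.
have /andP[hpos _] := hh.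
have h8 : 8 * mb * B * h ^+ 2 <= h * (8 * mb * B).
  by rewrite mulrC ler_wpM2r ?mulr_ge0// expr2 ler_piMl// ltW.
have K1q : (fst @` K) (q 0) by exists (q 0, v 0).
have tm1 b : tame (pot V W b) (q 0) r1 B by apply: tame_le (tm b _ K1q).
have v0M : `|v 0| <= Mv by exact: (vM _ Kqv).
have hN1 : h * (Mv + mb * (2 * B)) < r1 by rewrite -/N; lra.
have fl := EL_newton uS uF smooth_pot EL.
have vM' : `|mass_inv Ms Mf (mass Ms Mf (v 0))| <= Mv by rewrite massK.
have hin : 0 <= h <= h by rewrite lexx ltW.
have qh : `|q h - q 0| <= r1 / 2.
  apply: le_trans (flow_position0 fl hle1 B0 tm1 vM' hN1 hin) _.
  by rewrite mulrC ltW.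
have q00 : `|q 0 - q 0| <= r1 / 2 by rewrite subrr normr0 ltW.
have ballQ x : `|x - q 0| <= r1 -> Q x by move=> H; apply: rQ K1q _; exact: le_trans r1r.
have hr' : 8 * mb * B * h ^+ 2 <= r1 / 4 by apply: le_trans h8 _; exact: ltW.
have hhalf' : 8 * mb * B * h ^+ 2 <= 2^-1 by apply: le_trans h8 _; exact: ltW.
have hh1' : 0 < h < h1 by rewrite hpos.
have cmin q0 q1 : `|q0 - q 0| <= r1 / 2 -> `|q1 - q 0| <= r1 / 2 -> forall y,
    discrete_critical Qs Qf Ms Mf V W rW rV p h q0 q1 y ->
    discrete_unique_minimiser Qs Qf Ms Mf V W rW rV p h q0 q1 y.
  by move=> H0 H1; have [] := Hc h (q 0) q0 q1 hh1' K1q H0 H1.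
have [e [ce sm]] := critical_correction_exists okW okV p0 hpos r10 B0 tm1 hr' hhalf' q00 qh.
rewrite (Ld_multi_corrected okW okV uS uF p0 hpos r10 B0 tm1 hr' ballQ cmin ce sm).
have [cu _] := Hc h (q 0) (q 0) (q h) hh1' K1q q00 qh.
rewrite (Ld_exact_action hpos EL cu).
have AT := action_taylor smooth_pot uS uF hpos hle1 r10 B0 EL tm1 v0M hN1.
have FP := flow_position2 fl hpos hle1 r10 B0 tm1 vM' hN1.
rewrite massK// in FP.
have CT := corrected_action_taylor okW okV uS uF p0 hpos r10 B0 tm1 ce sm hle1 v0M C30 FP.
have SB := step_error_bound (addr_ge0 KL0 KA0) hpos p0 hp.
apply: le_trans SB; rewrite mulrDl.
rewrite -/KL in AT; rewrite -/KA in CT.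
have AT' : KL * h ^+ 3 <= KL * step_error rW rV p h by rewrite ler_wpM2l// cube_step_error.
move: (le_trans AT AT') CT; rewrite /total_grad.
(* [T] is the common expansion of both actions at the initial values; the error is the sum of the
   two distances to it. *)
set T := h * _ - _ - _; set A := action _ _ _ _; set D := corrected_action _ _ _ _ _ _ _ _ _ _ _.
have sub3 (x y z : R) : x - y = (x - z) - (y - z) by ring.
move=> H1 H2; rewrite (sub3 A D T).
by apply: le_trans (ler_normB _ _) _; exact: lerD.
Qed.

(** End point and momentum of the scheme and of the flow are compared with the same polynomials in
    [h]. Nonnegativity of [C] is recorded for the derivation of the order. *)
Lemma discrete_map_error (K : set (E * E)) : compact K -> K `<=` Q `*` setT ->
  exists2 C : R, 0 <= C & forall p : nat, (0 < p)%N -> critical_min p ->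
    local_error_le Q L (Ld p) K (error_bound rW rV C p).
Proof.
move=> cK KQ; have cK1 := compact_fst cK.
have K1Q : fst @` K `<=` Q by move=> _ [z /KQ[Qz _] <-].
have [r [B [r0 B0 rQ tm]]] := pot_tame openQ smooth_pot cK1 K1Q.
have [Mp Mp0 pM] := compact_snd_bounded cK.
pose Mv := mb * Mp; have Mv0 : 0 <= Mv by rewrite mulr_ge0.
pose N := Mv + mb * (2 * B).
have N0 : 0 <= N by rewrite addr_ge0// !mulr_ge0.
pose KS := scheme_const Ms Mf B Mv.
pose KF := mb * (2 * B * N) + 2 * (B * (N ^+ 2 + mb * (2 * B))).
have KS0 : 0 <= KS by exact: scheme_const_ge0.
have KF1 : 0 <= mb * (2 * B * N) by rewrite !mulr_ge0.
have KF2 : 0 <= 2 * (B * (N ^+ 2 + mb * (2 * B))).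
  by rewrite !mulr_ge0// addr_ge0 ?sqr_ge0// !mulr_ge0.
have KF0 : 0 <= KF by rewrite addr_ge0.
exists (2 * (KS + KF)) => [|p p0 cm]; first by rewrite mulr_ge0// addr_ge0.
have [r1 [h1 [r10 r1r h10 Hc]]] := critical_min_near cK1 r0 rQ cm.
have r18 : 0 < r1 / 8 by rewrite divr_gt0.
have r14 : 0 < r1 / 4 by rewrite divr_gt0.
have half : 0 < 2^-1 :> R by rewrite invr_gt0.
have [h0 h00 Hh] := near_small_step (filterI (filterI (small_step 1 h10) (small_step 1 ltr01))
  (filterI (filterI (small_step p%:R ltr01)
     (filterI (small_step N r10) (small_step (mb * (Mp + 2 * B)) r18)))
    (filterI (small_step (8 * mb * B) r14) (small_step (8 * mb * B) half)))).
exists (r1 / 4), h0; split => // h hh [q0 p0'] Kz.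
have [[+ +] [[hp [hN1 hM]] [hr hhalf]]] := Hh h hh; rewrite !mulr1 => hh1 /ltW hle1.
have /andP[hpos _] := hh.
have h8 : 8 * mb * B * h ^+ 2 <= h * (8 * mb * B).
  by rewrite mulrC ler_wpM2r ?mulr_ge0// expr2 ler_piMl// ltW.
have K1q : (fst @` K) q0 by exists (q0, p0').
have tm1 b : tame (pot V W b) q0 r1 B by apply: tame_le (tm b _ K1q).
have p0M : `|p0'| <= Mp by exact: (pM _ Kz).
have vM : `|mass_inv Ms Mf p0'| <= Mv.
  by apply: le_trans (mass_inv_norm _ _ _) _; rewrite ler_wpM2l.
have ballQ x : `|x - q0| <= r1 -> Q x by move=> H; apply: rQ K1q _; exact: le_trans r1r.
have hr' : 8 * mb * B * h ^+ 2 <= r1 / 4 by apply: le_trans h8 _; exact: ltW.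
have hhalf' : 8 * mb * B * h ^+ 2 <= 2^-1 by apply: le_trans h8 _; exact: ltW.
have hh1' : 0 < h < h1 by rewrite hpos.
have cmin q0' q1 : `|q0' - q0| <= r1 / 2 -> `|q1 - q0| <= r1 / 2 -> forall y,
    discrete_critical Qs Qf Ms Mf V W rW rV p h q0' q1 y ->
    discrete_unique_minimiser Qs Qf Ms Mf V W rW rV p h q0' q1 y.
  by move=> H0 H1; have [] := Hc h q0 q0' q1 hh1' K1q H0 H1.
have hp0 : mb * h * (`|p0'| + 2 * B * h) <= r1 / 8.
  apply: le_trans (ltW hM); rewrite mulrA [h * mb]mulrC.
  rewrite ler_wpM2l ?mulr_ge0 1?(ltW hpos)//; apply: lerD => //.
  by rewrite ler_piMr// mulr_ge0.
have [q1 [e [ce sm q1r m0 [st un]]]] := scheme_solution okW okV uS uF p0 hpos r10 B0 tm1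
  hr' hhalf' ballQ cmin hp0.
exists (q1, momentum1 Ms Mf V W rW rV p h q0 q1 e); split => //.
  by apply: le_lt_trans q1r _; lra.
move=> q pi HS [qq pp]; have fl := hamilton_newton uS uF smooth_pot HS.
have [T1 T2] := scheme_taylor okW okV uS uF p0 hpos r10 B0 tm1 ce sm m0 hle1 vM.
rewrite -qq in tm1; rewrite -pp in vM.
have FP := flow_position2 fl hpos hle1 r10 B0 tm1 vM hN1.
(* With [FP] this supplies the expansions of the exact flow to be set against [T1] and [T2]. *)
have FM := flow_momentum2 fl hpos hle1 r10 B0 tm1 vM hN1.
rewrite qq pp in FP FM.
have SB := step_error_bound (addr_ge0 KS0 KF0) hpos p0 hp.
apply: le_trans SB; rewrite mulrDl; move: T1 T2; rewrite -/KS => T1 T2.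
have c3 (x : R) : 0 <= x -> x <= KF -> x * h ^+ 3 <= KF * step_error rW rV p h.
  move=> x0 xK; apply: ler_pM => //; last exact: cube_step_error.
  by rewrite exprn_ge0// ltW.
have k1 : mb * (2 * B * N) <= KF by rewrite /KF lerDl.
have k2 : 2 * (B * (N ^+ 2 + mb * (2 * B))) <= KF by rewrite /KF lerDr.
have F1 := le_trans FP (c3 _ KF1 k1).
have F2 := le_trans FM (c3 _ KF2 k2).
have add4 (x x' a b c : E) (M M' : R) : `|x - (a + b - c)| <= M ->
    `|x' - a - b + c| <= M' -> `|x - x'| <= M + M'.
  move=> xM xM'; have -> : x - x' = (x - (a + b - c)) - (x' - a - b + c).
    by apply: coordE_inj => k; rewrite !(coordED, coordEN); ring.
  by apply: le_trans (ler_normB _ _) _; exact: lerD.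
have add5 (x x' a b c : E) (M M' : R) : `|x - (a - b - c)| <= M ->
    `|x' - a + b + c| <= M' -> `|x - x'| <= M + M'.
  move=> xM xM'; apply: (@add4 _ _ a (- b) c) => //; by rewrite opprK.
by apply/prod_norm_le; split; [exact: add4 T1 F1|exact: add5 T2 F2].
Qed.

End ErrorEstimates.

Theorem lemma4p5 (R : realType) (ns nf : nat)
  (Qs : set 'cV[R]_ns) (Qf : set 'cV[R]_nf)
  (Ms : 'M[R]_ns) (Mf : 'M[R]_nf)
  (V : config R ns nf -> R) (W : 'cV[R]_nf -> R)
  (rW rV : quad_rule R)
  (Q := Q_multi Qs Qf) (L := L_multi Ms Mf V W)
  (Ld := Ld_multi Qs Qf Ms Mf V W rW rV)
  (openQs : open Qs) (openQf : open Qf)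
  (smoothV : smooth_on Q V) (smoothW : smooth_on Qf W)
  (regL : regular Q L)
  (okW : rule_param_ok rW) (okV : rule_param_ok rV)
  (okWV : rules_allowed rW rV) :
  [/\ (* error of the discrete Lagrangian along exact solutions with initial
         values in a compact set *)
      forall K : set (config R ns nf * config R ns nf),
        compact K -> K `<=` Q `*` setT ->
        exists C : R, forall p : nat, (0 < p)%N ->
          critical_curves_minimise Qs Qf Ms Mf V W rW rV p ->
          exists2 h0 : R, 0 < h0 &
            forall h, 0 < h < h0 ->
            forall q v, EL_solution Q L h q v -> K (q 0, v 0) ->
              `|Ld_exact Q L h (q 0) (q h) - Ld p h (q 0) (q h)|
                <= error_bound rW rV C p h,
      (* error of the discrete evolution map *)
      forall K : set (config R ns nf * config R ns nf),
        compact K -> K `<=` Q `*` setT ->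
        exists C : R, forall p : nat, (0 < p)%N ->
          critical_curves_minimise Qs Qf Ms Mf V W rW rV p ->
          local_error_le Q L (Ld p) K (error_bound rW rV C p) &
      (* order *)
      forall p : nat, (0 < p)%N ->
        critical_curves_minimise Qs Qf Ms Mf V W rW rV p ->
        scheme_of_order Q L (Ld p)
          (if rule_symmetric rV && rule_symmetric rW then 2%N else 1%N)].
Proof.
(* For empty [Q] regularity does not make the masses invertible, but then [K] is empty and all
   claims hold vacuously. *)
have [Q0|/set0P Q0] := eqVneq Q set0.
  have KF (K : set (config R ns nf * config R ns nf)) : K `<=` Q `*` setT -> forall z, ~ K z.
    by move=> KQ z /KQ[]; rewrite Q0.
  have vac (K : set (config R ns nf * config R ns nf)) p e : K `<=` Q `*` setT ->
      local_error_le Q L (Ld p) K e.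
    by move=> /KF KQ; exists 1, 1; split => // h _ z /KQ.
  split.
  - move=> K _ /KF KQ; exists 0 => p _ _; exists 1 => // h _ q v _ Kqv.
    by case: (KQ (q 0, v 0)).
  - by move=> K _ KQ; exists 0 => p _ _; exact: vac.
  - by move=> p _ _ K _ KQ; exists 0; exact: vac.
have [uS uF] := regular_unitmx regL Q0.
have mapE := discrete_map_error openQs openQf smoothV smoothW okW okV uS uF.
split.
- exact: (discrete_lagrangian_error openQs openQf smoothV smoothW okW okV uS uF).
- by move=> K cK KQ; have [C _ HC] := mapE K cK KQ; exists C.
move=> p p0 cm K cK KQ; have [C C0 /(_ p p0 cm)[d [h0 [d0 h00 H]]]] := mapE K cK KQ.
(* As [p >= 1], the micro term of the symmetric bound is at most the macro term, and [1 / p] is at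
   most 1; the constant [2 * C] covers both cases. *)
exists (2 * C), d, h0; split => // h hh z Kz.
have [z1 [zd st un err]] := H h hh z Kz; exists z1; split => // q pi HS qz.
have /andP[hpos _] := hh.
apply: le_trans (err q pi HS qz) _; rewrite /error_bound.
have p1 : 1 <= p%:R :> R by rewrite ler1n.
have pN : p%:R != 0 :> R by rewrite pnatr_eq0 -lt0n.
have pV : p%:R^-1 <= 1 :> R by rewrite invf_le1// (lt_le_trans ltr01).
have pV0 : 0 <= p%:R^-1 :> R by rewrite invr_ge0.
case: ifP => _.
  have -> : C * h ^+ 3 + p%:R * (C * (h / p%:R) ^+ 3) =
      C * h ^+ 3 + (C * h ^+ 3) * p%:R^-1 ^+ 2 by field.
  have -> : 2 * C * h ^+ 3 = C * h ^+ 3 + C * h ^+ 3 by ring.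
  have Ch : 0 <= C * h ^+ 3 by rewrite mulr_ge0// exprn_ge0// ltW.
  by rewrite lerD2l ler_piMr// exprn_ile1.
have Ch : 0 <= C * h ^+ 2 by rewrite mulr_ge0// sqr_ge0.
have -> : 2 * C * h ^+ 2 = C * h ^+ 2 + C * h ^+ 2 by ring.
by apply: (@le_trans _ _ (C * h ^+ 2)); [rewrite ler_piMl|rewrite lerDl].
Qed.
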